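(* Let $(\mu_t)_{t\in[0,1]}$ be a sufficiently smooth curve in the Wasserstein-Fisher-Rao space over $\mathbb{R}^d$, with tangent fields $(v_t,\alpha_t)$. Then there is a probability measure $P\in\mathcal{P}(\Omega_{\mathfrak{C}})$ on paths in the cone space $\mathfrak{C}$ such that $\mathfrak{P}[(e_t)_\#P]=\mu_t$ for all $t\in[0,1]$, and the $E$-cost of $(\mu_t)$ is equal to the $P$-cost of $P$, i.e. $$\int_0^1\Big\|\frac{\mathbf{D}^2}{dt^2}\mu_t\Big\|_{\mu_t}^2\,dt=\int_{\Omega_{\mathfrak{C}}}\int_0^1|\ddot z_t|^2\,dt\,dP(z).$$ Moreover, $P$ is induced by the flow maps associated to the curve $(\mu_t)$.
   Context: WFR structure. $\mathcal{M}_+(\mathbb{R}^d)$ is the set of non-negative (finite) measures on $\mathbb{R}^d$. Curves $(\mu_t)$ satisfy, weakly, $\partial_t\mu_t+\operatorname{div}(v_t\mu_t)=4\alpha_t\mu_t$ with tangent fields $(v_t,\alpha_t)$, where $v_t=\nabla\alpha_t$. The norm of a pair is $\|(v,\alpha)\|_\mu^2=\int(|v|^2+4\alpha^2)\,d\mu$. The covariant acceleration of the curve is $$\frac{\mathbf{D}^2}{dt^2}\mu_t=\begin{pmatrix}\partial_tv_t+\nabla v_t\cdot v_t+4\alpha_tv_t\\ \partial_t\alpha_t+\tfrac12|\nabla\alpha_t|^2+2\alpha_t^2\end{pmatrix},$$ where $\nabla v_t\cdot v_t$ is the Jacobian of $v_t$ applied to $v_t$. The $E$-cost of $(\mu_t)$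 is $\int_0^1\|\frac{\mathbf{D}^2}{dt^2}\mu_t\|_{\mu_t}^2\,dt$. ''Sufficiently smooth'' means: $v\in L^1([0,1];W^{1,\infty}(\mathbb{R}^d,\mathbb{R}^d))$; $\alpha$ is continuous on $\mathbb{R}^d\times[0,1]$, bounded and locally Lipschitz; and $v,\alpha$ are continuously differentiable in $(x,t)$, so that the expressions above are classical. Flow maps. $X_t:\mathbb{R}^d\to\mathbb{R}^d$ and $R_t:\mathbb{R}^d\to(0,\infty)$ solve $$\dot X_t=v_t(X_t),\quad X_0=\mathrm{Id};\qquad \dot R_t=2\alpha_t(X_t)R_t,\quad R_0=1.$$ Cone space. $\mathfrak{C}$ is $\mathbb{R}^d\times[0,\infty)$ with $\mathbb{R}^d\times\{0\}$ identified to a single point $\mathfrak{0}$ (the vertex). Away from $\mathfrak{0}$ it carries the Riemannian metric $$\langle(v_1,p_1),(v_2,p_2)\rangle_{(x,r)}=r^2\langle v_1,v_2\rangle+p_1p_2.$$ $\Omega_{\mathfrak{C}}$ is the set of paths $z:[0,1]\to\mathfrak{C}$ with absolutely continuous derivative, and $e_t(z)=z_t$ is evaluation at time $t$. For $z\in\Omega_{\mathfrak{C}}$, $\ddot z_t=\nabla_{\dot z_t}\dot z_t$ is the covariant acceleration for the Levi-Civita connection of the cone metric, and $|\ddot z_t|$ is its norm in that metric; the path constantly equal to $\mathfrak{0}$ has zero acceleration. The $P$-cost of $P\in\mathcal{P}(\Omega_{\mathfrak{C}})$ is $\int\int_0^1|\ddot z_t|^2\,dt\,dP(z)$. Projection and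 lifts. For a measure $\lambda$ on $\mathfrak{C}$, $\mathfrak{P}\lambda$ is the measure on $\mathbb{R}^d$ defined by $\int f\,d\mathfrak{P}\lambda=\int r^2f(x)\,d\lambda(x,r)$; $\lambda$ is called a lift of $\mathfrak{P}\lambda$. ''$P$ is induced by the flow maps'' means: $P$ is the push-forward of some lift $\lambda_0\in\mathcal{P}(\mathfrak{C})$ of $\mu_0$ under the map sending $(x_0,r_0)$ to the path $t\mapsto(X_t(x_0),R_t(x_0)\,r_0)$. *)

(* Defs.v *)
From HB Require Import structures.
From mathcomp Require Import all_boot all_order all_algebra.
From mathcomp Require Import all_classical all_reals all_analysis.
From mathcomp Require Import measurable_realfun.
Set Implicit Arguments.
Unset Strict Implicit.
Unset Printing Implicit Defensive.
Import Order.TTheory GRing.Theory Num.Theory.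
Import numFieldNormedType.Exports.
Local Open Scope classical_set_scope.
Local Open Scope ring_scope.
Local Open Scope quotient_scope.

Notation borel T := (g_sigma_algebraType (@open T)).
Notation lebR R := (@lebesgue_measure R).

Section Euclidean.
Context {R : realType}.

(* The norm of 'rV[R]_n in the library is the sup norm; lengths of vectors are
   computed with this inner product instead. *)
Definition dotv {n : nat} (u w : 'rV[R]_n) : R := \sum_i u 0 i * w 0 i.

Definition evec {n : nat} (i : 'I_n) : 'rV[R]_n := delta_mx 0 i.

Definition grad {n : nat} (f : 'rV[R]_n -> R) (x : 'rV[R]_n) : 'rV[R]_n :=
  \row_i 'D_(evec i) f x.

End Euclidean.

Section AbsoluteContinuity.
Context {R : realType} {V : normedModType R}.

Definition abs_continuous (a b : R) (f : R -> V) : Prop :=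
  forall e : R, 0 < e -> exists2 delta : R, 0 < delta &
    forall (n : nat) (s t : 'I_n -> R),
      (forall i, a <= s i /\ s i <= t i /\ t i <= b) ->
      (forall i j, i != j -> t i <= s j \/ t j <= s i) ->
      \sum_i (t i - s i) < delta ->
      \sum_i `|f (t i) - f (s i)| < e.

(* f is C^1 on [0,1] and its derivative, extended by continuity to the
   endpoints, is absolutely continuous; values of f outside [0,1] are
   irrelevant. *)
Definition has_AC_derivative (f : R -> V) : Prop :=
  {within `[0, 1], continuous f} /\
  exists2 f' : R -> V, abs_continuous 0 1 f' &
    forall t : R, t \in `]0, 1[ -> is_derive t 1 f (f' t).

Lemma has_AC_derivative_cst (c : V) : has_AC_derivative (fun=> c).
Proof.
split; first by apply: continuous_subspaceT => x; exact: cst_continuous.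
exists (fun=> 0); last by move=> t _; exact: is_derive_cst.
move=> e e0; exists 1 => // n s t _ _ _.
by rewrite big1 // => i _; rewrite subrr normr0.
Qed.

End AbsoluteContinuity.

Section Regularity.
Context {R : realType} {d : nat}.
Implicit Types (v : R -> 'rV[R]_d -> 'rV[R]_d) (alpha : R -> 'rV[R]_d -> R).

Definition slab : set (R * 'rV[R]_d) := [set p | p.1 \in `[0, 1]].
Definition open_slab : set (R * 'rV[R]_d) := [set p | p.1 \in `]0, 1[].

(* C^1 up to the boundary times: the differential, defined on ]0,1[ x R^d,
   extends continuously to [0,1] x R^d. *)
Definition C1_slab {V : normedModType R} (f : R * 'rV[R]_d -> V) : Prop :=
  [/\ {within slab, continuous f},
      forall p, open_slab p -> differentiable f p &
      forall h : R * 'rV[R]_d, exists2 g : R * 'rV[R]_d -> V,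
        {within slab, continuous g} &
        forall p, open_slab p -> 'd f p h = g p].

(* For a C^1 field the essential suprema in the W^{1,oo} norm are suprema and
   the weak derivative is the Jacobian. *)
Definition W1oo_norm (f : 'rV[R]_d -> 'rV[R]_d) : \bar R :=
  (ereal_sup [set (`|f x|)%:E | x in [set: 'rV[R]_d]] +
   ereal_sup [set (`|'J f x|)%:E | x in [set: 'rV[R]_d]])%E.

Definition sufficiently_smooth v alpha : Prop :=
  [/\ (\int[lebR R]_(t in `[0%R, 1%R]) W1oo_norm (v t) < +oo)%E,
      [/\ {within slab, continuous (fun p => alpha p.1 p.2)},
          [bounded alpha p.1 p.2 | p in slab] &
          [locally [lipschitz alpha p.1 p.2 | p in slab]]] &
      C1_slab (fun p => v p.1 p.2) /\ C1_slab (fun p => alpha p.1 p.2)].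

End Regularity.

Section WFR.
Context {R : realType} {d : nat}.
Implicit Types (mu : R -> {finite_measure set (borel 'rV[R]_d) -> \bar R})
  (v : R -> 'rV[R]_d -> 'rV[R]_d) (alpha : R -> 'rV[R]_d -> R).

(* Continuity for the WFR distance, which metrizes the narrow topology on
   finite non-negative measures. *)
Definition narrowly_continuous mu : Prop :=
  forall f : 'rV[R]_d -> R, continuous f -> [bounded f x | x in setT] ->
    {within `[0, 1], continuous (fun t => \int[mu t]_x f x)}.

(* Compactly supported C^1 functions on ]0,1[ x R^d, extended by zero. *)
Definition test_function (phi : R * 'rV[R]_d -> R) : Prop :=
  [/\ forall p, differentiable phi p,
      forall h, continuous (fun p => 'd phi p h) &
      exists K, [/\ compact K, K `<=` open_slab &
                    forall p, ~ K p -> phi p = 0]].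

Definition continuity_equation mu v alpha : Prop :=
  forall phi, test_function phi ->
    (\int[lebR R]_(t in `[0%R, 1%R]) \int[mu t]_x
       (derive1 (fun s => phi (s, x)) t
        + dotv (grad (fun y => phi (t, y)) x) (v t x)
        + 4 * alpha t x * phi (t, x))%:E = 0)%E.

Definition WFR_curve mu v alpha : Prop :=
  [/\ narrowly_continuous mu,
      continuity_equation mu v alpha &
      forall (t : R) x, t \in `[0, 1] -> v t x = grad (alpha t) x].

Definition WFR_sqnorm (m : {finite_measure set (borel 'rV[R]_d) -> \bar R})
    (w : 'rV[R]_d -> 'rV[R]_d) (b : 'rV[R]_d -> R) : \bar R :=
  (\int[m]_x (dotv (w x) (w x) + 4 * b x ^+ 2)%:E)%E.

(* The library's Jacobian acts on row vectors from the right: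
   u *m 'J f x is the differential of f at x applied to u. *)
Definition accel_v v alpha (t : R) (x : 'rV[R]_d) : 'rV[R]_d :=
  derive1 (fun s => v s x) t + v t x *m 'J (v t) x + (4 * alpha t x) *: v t x.

Definition accel_alpha alpha (t : R) (x : 'rV[R]_d) : R :=
  derive1 (fun s => alpha s x) t
  + 2^-1 * dotv (grad (alpha t) x) (grad (alpha t) x) + 2 * alpha t x ^+ 2.

(* Only t in ]0,1[ matters: at t = 0, 1 the derivative in time also sees the
   unspecified values of the fields outside [0,1]. *)
Definition E_cost mu v alpha : \bar R :=
  (\int[lebR R]_(t in `[0%R, 1%R])
     WFR_sqnorm (mu t) (accel_v v alpha t) (accel_alpha alpha t))%E.

Definition flow_maps v alpha (X : R -> 'rV[R]_d -> 'rV[R]_d)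
    (Rad : R -> 'rV[R]_d -> {posnum R}) : Prop :=
  forall x,
  [/\ X 0 x = x,
      {within `[0, 1], continuous (fun t => X t x)} &
      forall t : R, t \in `]0, 1[ ->
        is_derive t 1 (fun s => X s x) (v t (X t x))] /\
  [/\ (Rad 0 x)%:num = 1,
      {within `[0, 1], continuous (fun t => (Rad t x)%:num)} &
      forall t : R, t \in `]0, 1[ ->
        is_derive t 1 (fun s => (Rad s x)%:num)
          (2 * alpha t (X t x) * (Rad t x)%:num)].

End WFR.

Section ConeSpace.
Variables (R : realType) (d : nat).

Let half_space_incl (p : 'rV[R]_d * {nonneg R}) : 'rV[R]_d * R :=
  (p.1, p.2%:num).

Definition half_space := initial_topology half_space_incl.

HB.instance Definition _ := Topological.on half_space.

Let cone_rel' (p q : half_space) : bool :=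
  (p == q) || ((p.2%:num == 0) && (q.2%:num == 0)).

Let cone_rel_refl : reflexive cone_rel'.
Proof. by move=> p; rewrite /cone_rel' eqxx. Qed.

Let cone_rel_sym : symmetric cone_rel'.
Proof. by move=> p q; rewrite /cone_rel' eq_sym andbC. Qed.

Let cone_rel_trans : transitive cone_rel'.
Proof.
move=> q p r /predU1P[-> //|] + /predU1P[<- //|]; rewrite /cone_rel'.
by move=> /andP[-> _] /andP[_ ->]; rewrite orbT.
Qed.

Definition cone_rel := EquivRel cone_rel' cone_rel_refl cone_rel_sym cone_rel_trans.

(* The Borel sets of the quotient topology coincide with those of the usual
   cone distance: both topologies agree off the vertex, which is closed. *)
Definition cone := {eq_quot cone_rel}.
HB.instance Definition _ := Topological.copy cone (quotient_topology cone).
HB.instance Definition _ := Quotient.on cone.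

Definition cone_mk (x : 'rV[R]_d) (r : {nonneg R}) : cone :=
  \pi_cone ((x, r) : half_space).

Definition vertex : cone := cone_mk 0 0%:nng.

HB.instance Definition _ := isPointed.Build cone vertex.

End ConeSpace.

Section ConeCoordinates.
Context {R : realType} {d : nat}.
Implicit Types c : cone R d.

(* Away from the vertex the representative is unique; at the vertex cone_x is
   arbitrary and cone_r is 0. *)
Definition cone_x c : 'rV[R]_d := (repr c).1.
Definition cone_r c : R := (repr c).2%:num.

Definition cone_chart c : 'rV[R]_(d + 1) :=
  row_mx (cone_x c) (const_mx (cone_r c)).

Definition chart_x (p : 'rV[R]_(d + 1)) : 'rV[R]_d := lsubmx p.
Definition chart_r (p : 'rV[R]_(d + 1)) : R := rsubmx p 0 0.

Definition cone_metric (p u w : 'rV[R]_(d + 1)) : R :=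
  chart_r p ^+ 2 * dotv (chart_x u) (chart_x w) + chart_r u * chart_r w.

End ConeCoordinates.

Section LeviCivita.
Context {R : realType} {n : nat}.
Variable g : 'rV[R]_n -> 'rV[R]_n -> 'rV[R]_n -> R.

Definition gram (p : 'rV[R]_n) : 'M[R]_n :=
  \matrix_(i, j) g p (evec i) (evec j).

Definition christoffel (p : 'rV[R]_n) (k i j : 'I_n) : R :=
  2^-1 * \sum_l invmx (gram p) k l *
    ('D_(evec i) (fun q => gram q j l) p + 'D_(evec j) (fun q => gram q i l) p
     - 'D_(evec l) (fun q => gram q i j) p).

Definition covariant_accel (q : R -> 'rV[R]_n) (t : R) : 'rV[R]_n :=
  \row_k (derive1 (derive1 q) t 0 k
          + \sum_i \sum_j christoffel (q t) k i j * derive1 q t 0 i * derive1 q t 0 j).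

End LeviCivita.

Section Paths.
Variables (R : realType) (d : nat).

(* A path on [0,1] is stored as a function on R frozen outside [0,1]. Its
   derivative is absolutely continuous when it is so for a lift (x, r) to
   R^d x [0, +oo[; off the vertex the lift is unique and this is the regularity
   of the path in the chart. *)
Definition AC1_path : set (R -> cone R d) := [set z |
  (forall t, z t = z (Num.max 0 (Num.min t 1))) /\
  exists (x : R -> 'rV[R]_d) (r : R -> {nonneg R}),
    [/\ has_AC_derivative x, has_AC_derivative (fun t => (r t)%:num) &
        forall t : R, t \in `[0, 1] -> z t = cone_mk (x t) (r t)]].

Definition Omega := {z : R -> cone R d | z \in AC1_path}.

Lemma AC1_path_vertex : (fun=> vertex R d) \in AC1_path.
Proof.
rewrite inE; split=> //; exists (fun=> 0), (fun=> 0%:nng).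
by split=> //; exact: has_AC_derivative_cst.
Qed.

HB.instance Definition _ := Choice.on Omega.
HB.instance Definition _ := isPointed.Build Omega
  (exist _ (fun=> vertex R d) AC1_path_vertex).

Definition path_eval (t : R) (z : Omega) : cone R d := sval z t.

Definition cylinders : set (set Omega) :=
  [set C | exists (t : R) (A : set (borel (cone R d))),
     [/\ t \in `[0, 1], measurable A & C = path_eval t @^-1` A]].

End Paths.
Notation mOmega R d := (g_sigma_algebraType (@cylinders R d)).

Section ConeCost.
Context {R : realType} {d : nat}.

(* Instants spent at the vertex contribute zero. This is consistent with the
   metric: at almost every t with r t = 0 one has r' t = r'' t = 0, so the
   expression in the chart vanishes there as well. *)
Definition path_accel_sqnorm (z : Omega R d) (t : R) : R :=
  let q := fun s => cone_chart (path_eval s z) in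
  let a := covariant_accel cone_metric q t in
  if path_eval t z == vertex R d then 0 else cone_metric (q t) a a.

Definition P_cost (P : probability (mOmega R d) R) : \bar R :=
  (\int[P]_z \int[lebR R]_(t in `[0%R, 1%R]) (path_accel_sqnorm z t)%:E)%E.

(* The projection of lam to R^d, with density r^2, is m. At the vertex cone_x
   is arbitrary but the weight is 0. *)
Definition lift_of (lam : set (borel (cone R d)) -> \bar R)
    (m : set (borel 'rV[R]_d) -> \bar R) : Prop :=
  forall f : borel 'rV[R]_d -> \bar R, measurable_fun setT f ->
    (forall x, 0 <= f x)%E ->
    (\int[m]_x f x = \int[lam]_c ((cone_r c ^+ 2)%:E * f (cone_x c)))%E.

Definition induced_by_flow (P : probability (mOmega R d) R)
    (m0 : {finite_measure set (borel 'rV[R]_d) -> \bar R})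
    (X : R -> 'rV[R]_d -> 'rV[R]_d)
    (Rad : R -> 'rV[R]_d -> {posnum R}) : Prop :=
  exists (lam0 : probability (borel (cone R d)) R)
         (Phi : borel (cone R d) -> mOmega R d),
    [/\ lift_of lam0 m0,
        measurable_fun setT Phi,
        forall x r (t : R), t \in `[0, 1] ->
          path_eval t (Phi (cone_mk x r)) =
          cone_mk (X t x) ((Rad t x)%:num * r%:num)%:nng &
        forall A, measurable A -> P A = pushforward lam0 Phi A].

End ConeCost.

(* Main.v *)
Require Import Defs.
From HB Require Import structures.
From mathcomp Require Import all_boot all_order all_algebra.
From mathcomp Require Import all_classical all_reals all_analysis.
From mathcomp Require Import measurable_realfun ring lra.
Set Implicit Arguments.
Unset Strict Implicit.
Unset Printing Implicit Defensive.
Import Order.TTheory GRing.Theory Num.Theory.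
Import numFieldNormedType.Exports.
Local Open Scope classical_set_scope.
Local Open Scope ring_scope.
Local Open Scope quotient_scope.

(** Because [v] is of class C^1 with time-integrable W^{1,oo} norm, it has a
    global flow [X] of bounded displacement.  Integrating [alpha] along this flow
    gives [A] with [R_t = exp (2 A_t)], and the curve is represented as
    [mu_t = (X_t)_# (R_t^2 mu_0)].  For this, a test function is transported
    backwards by Euler steps [f (x + (b - s) w) exp (4 (b - s) a)] of the adjoint
    equation, with [w], [a] the fields frozen at the midpoint of the step: over a
    short step its total derivative is small both in the weak equation and
    along the flow, so the two pairings agree in the limit.

    In the chart [(x, r)] the covariant acceleration of the path
    [t |-> (X_t x, R_t r)] has squared norm
    [(R_t r)^2 (|accel_v|^2 + 4 accel_alpha^2)], evaluated at [X_t x].  When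
    [(x, r)] is distributed by a probability lift of [mu_0], for instance the
    normalized [mu_0] at the constant radius [sqrt (mu_0 (R^d))], Tonelli's
    theorem turns the P-cost into the E-cost.  The P-cost integrand is not known
    to be measurable on the whole path space; it is computed on the measurable
    set of paths that follow the flow from their starting point, which carries
    the law P. *)

(** * Comparison of derivatives *)

(** The natural test function, [psi] composed with the exact flow from [t] to [T] and weighted,
    would have to be C^1 in [x], whereas Picard iteration and the Gronwall estimate make the flow
    only Lipschitz on bounded sets. An Euler step, being an explicit formula in the fields at one
    interior time, is C^1 in space and time at once. Its residual is [O(tau)], so a step of length
    [tau] costs [O(tau^2)] and [n] steps cost [O(1/n)], provided that the C^1 norm and the support
    of the iterates stay bounded. The norm is multiplied by at most [exp (9 C tau)] per step. The
    support grows by the integral of the supremum of [|v_t|], up to a vanishing error; the same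
    integral confines the trajectories. Both therefore stay in a ball known in advance, outside
    which the fields can be truncated to bounded Lipschitz ones. The weak equation speaks only of
    distributions in time; narrow continuity and a du Bois-Reymond argument turn it into increments
    between two given times. *)

Section RowVectors.
Context {R : realType} {d : nat}.
Implicit Types (u w : 'rV[R]_d) (y : R -> 'rV[R]_d).

Lemma coord_le_norm u i : `|u 0 i| <= `|u|.
Proof.
rewrite {2}/Num.Def.normr /= mx_normrE.
exact: (le_bigmax _ (fun ij => `|u ij.1 ij.2|) (0, i)).
Qed.

Lemma coordB u w i : (u - w) 0 i = u 0 i - w 0 i.
Proof. by rewrite 2!mxE. Qed.

Lemma rV_norm_le u e : 0 <= e -> (forall i, `|u 0 i| <= e) -> `|u| <= e.
Proof.
move=> e0 ue; rewrite /Num.Def.normr /= mx_normrE; apply: bigmax_le => //.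
by move=> [i j] _ /=; rewrite ord1.
Qed.

Lemma is_derive_coord y (t : R) (dy : 'rV[R]_d) i :
  is_derive t 1 y dy -> is_derive t 1 (fun s => y s 0 i) (dy 0 i).
Proof.
move=> [dbl <-]; have /derivable_mxP dij := dbl.
by rewrite derive_mx// mxE; exact/derivableP.
Qed.

Lemma is_derive_row y (t : R) (dy : 'rV[R]_d) :
  (forall i, is_derive t 1 (fun s => y s 0 i) (dy 0 i)) -> is_derive t 1 y dy.
Proof.
move=> h; have dbl : derivable y t 1.
  by apply/derivable_mxP => i j; rewrite ord1; have [] := h j.
apply: DeriveDef => //; rewrite derive_mx//; apply/rowP => j.
by rewrite mxE; have [_ ->] := h j.
Qed.

End RowVectors.

Section Comparison.
Context {R : realType}.

Lemma itv01_bounds (t : R) : t \in `[0, 1] -> 0 <= t /\ t <= 1.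
Proof. by rewrite in_itv /= => /andP. Qed.

Lemma itv01_0 : (0 : R) \in `[0, 1]. Proof. by rewrite in_itv /= lexx ler01. Qed.

Lemma sub_itv01 (t : R) : t \in `[0, 1] -> forall s : R, s \in `[0, t] -> s \in `[0, 1].
Proof.
by rewrite in_itv /= => /andP[_ t1] s; rewrite !in_itv /= => /andP[-> /le_trans]; exact.
Qed.

Lemma is_derive_scale (c t : R) : is_derive t 1 (fun s => c * s) c.
Proof. by apply: is_derive_eq (is_deriveZ _ _) _; rewrite /GRing.scale /= mulr1. Qed.

(** The sum of the individual constants serves all indices, since they are non-negative; this merges
    bounds obtained coordinate by coordinate. *)
Lemma common_bound n (P : 'I_n -> R -> Prop) :
  (forall i M M', M <= M' -> P i M -> P i M') ->
  (forall i, exists2 M, 0 <= M & P i M) -> exists2 M, 0 <= M & forall i, P i M.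
Proof.
move=> mono h; pose H i := cid2 (h i); have H0 i : 0 <= s2val (H i) by exact: (s2valP (H i)).
exists (\sum_i s2val (H i)) => [|i]; first exact: sumr_ge0.
by apply: mono (s2valP' (H i)); rewrite (bigD1 i)//= lerDl sumr_ge0.
Qed.

Lemma le_of_derive (f f' : R -> R) (a b : R) : a <= b ->
  {within `[a, b], continuous f} ->
  (forall t, t \in `]a, b[ -> is_derive t 1 f (f' t)) ->
  (forall t, t \in `]a, b[ -> 0 <= f' t) -> f a <= f b.
Proof.
rewrite le_eqVlt => /predU1P[-> //|ab] cf df f0.
have [c cab e] := MVT ab df cf.
by rewrite -subr_ge0 e mulr_ge0 ?f0// subr_ge0 ltW.
Qed.

(** A mean value inequality with a variable majorant: [g + f] and [g - f] are both nondecreasing. It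
    bounds increments without integrating the derivative. *)
Lemma norm_le_of_derive (f f' g g' : R -> R) (a b : R) : a <= b ->
  {within `[a, b], continuous f} -> {within `[a, b], continuous g} ->
  (forall t, t \in `]a, b[ -> is_derive t 1 f (f' t)) ->
  (forall t, t \in `]a, b[ -> is_derive t 1 g (g' t)) ->
  (forall t, t \in `]a, b[ -> `|f' t| <= g' t) -> `|f b - f a| <= g b - g a.
Proof.
move=> ab cf cg df dg fg; rewrite ler_norml; apply/andP; split.
  suff : g a + f a <= g b + f b by lra.
  apply: (@le_of_derive (fun s => g s + f s) (fun s => g' s + f' s)) => //.
  - by move=> x; apply: continuousD; [exact: cg|exact: cf].
  - by move=> t tab; have := df _ tab; have := dg _ tab => ? ?; exact: is_deriveD.
  - by move=> t tab; have := fg _ tab; rewrite ler_norml => /andP[+ _]; lra.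
suff : g a - f a <= g b - f b by lra.
apply: (@le_of_derive (fun s => g s - f s) (fun s => g' s - f' s)) => //.
- by move=> x; apply: continuousB; [exact: cg|exact: cf].
- by move=> t tab; have := df _ tab; have := dg _ tab => ? ?; exact: is_deriveB.
- by move=> t tab; have := fg _ tab; rewrite ler_norml => /andP[_ +]; lra.
Qed.

Lemma within_continuous_derive {V : normedModType R} (f f' : R -> V) (a b : R) :
  (forall t, t \in `[a, b] -> is_derive t 1 f (f' t)) ->
  {within `[a, b], continuous f}.
Proof.
by move=> h; apply: derivable_within_continuous => t /h[].
Qed.

(** The sup norm lets the scalar inequality be applied coordinate by coordinate without a factor
    depending on [d]. *)
Lemma rV_norm_le_of_derive {d} (f f' : R -> 'rV[R]_d) (g g' : R -> R) (a b : R) :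
  a <= b ->
  (forall t, t \in `[a, b] -> is_derive t 1 f (f' t)) ->
  (forall t, t \in `[a, b] -> is_derive t 1 g (g' t)) ->
  (forall t, t \in `[a, b] -> `|f' t| <= g' t) -> `|f b - f a| <= g b - g a.
Proof.
move=> ab df dg fg.
have sub t : t \in `]a, b[ -> t \in `[a, b] by apply: subset_itv_oo_cc.
apply: rV_norm_le => [|i].
  have cg : {within `[a, b], continuous g}.
    exact: (@within_continuous_derive _ g g').
  have := le_of_derive ab cg (fun t h => dg t (sub t h)).
  by rewrite subr_ge0; apply=> t /sub /fg; apply: le_trans.
have cg : {within `[a, b], continuous g} by exact: (@within_continuous_derive _ g g').
have dfi t : t \in `[a, b] -> is_derive t 1 (fun s => f s 0 i) (f' t 0 i).
  by move=> /df; exact: is_derive_coord.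
have cfi := within_continuous_derive dfi.
rewrite coordB.
have := norm_le_of_derive ab cfi cg (fun t h => dfi t (sub t h)) (fun t h => dg t (sub t h)).
apply=> t /sub /fg; apply: le_trans; exact: coord_le_norm.
Qed.

End Comparison.

Section Gronwall.
Context {R : realType} {d : nat}.
Implicit Types X Y : R -> 'rV[R]_d.

Lemma sum_sqr_le (u : 'rV[R]_d) : \sum_i u 0 i ^+ 2 <= d%:R * `|u| ^+ 2.
Proof.
rewrite mulr_natl -[X in _ *+ X]card_ord -sumr_const.
apply: ler_sum => i _; rewrite -real_normK ?num_real// lerXn2r ?nnegrE//.
exact: coord_le_norm.
Qed.

Lemma norm_sqr_le (u : 'rV[R]_d) : `|u| ^+ 2 <= \sum_i u 0 i ^+ 2.
Proof.
have h : 0 <= \sum_i u 0 i ^+ 2 by apply: sumr_ge0 => i _; exact: sqr_ge0.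
have := @rV_norm_le _ _ u (Num.sqrt (\sum_i u 0 i ^+ 2)) (sqrtr_ge0 _).
move=> H; rewrite -[leRHS]sqr_sqrtr// lerXn2r ?nnegrE ?sqrtr_ge0//; apply: H => i.
rewrite -sqrtr_sqr ler_wsqrtr// (bigD1 i)//= lerDl.
by apply: sumr_ge0 => j _; exact: sqr_ge0.
Qed.

Lemma gronwall X Y X' Y' (L : R) : 0 <= L ->
  (forall t : R, t \in `[0, 1] -> is_derive t 1 X (X' t)) ->
  (forall t : R, t \in `[0, 1] -> is_derive t 1 Y (Y' t)) ->
  (forall t : R, t \in `[0, 1] -> `|X' t - Y' t| <= L * `|X t - Y t|) ->
  forall t : R, t \in `[0, 1] ->
    `|X t - Y t| ^+ 2 <= d%:R * expR (2 * d%:R * L) * `|X 0 - Y 0| ^+ 2.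
Proof.
move=> L0 dX dY XY t t01.
pose D s := X s - Y s.
pose D' s := X' s - Y' s.
have dD (s : R) : s \in `[0, 1] -> is_derive s 1 D (D' s).
  by move=> s01; have := dX _ s01; have := dY _ s01 => ? ?; exact: is_deriveB.
pose K := 2 * d%:R * L.
pose f s := \sum_i D s 0 i ^+ 2.
pose f' s := \sum_i (2 * D s 0 i * D' s 0 i).
have df (s : R) : s \in `[0, 1] -> is_derive s 1 f (f' s).
  move=> s01.
  have dDi i : is_derive s 1 (fun s => D s 0 i) (D' s 0 i).
    exact/is_derive_coord/dD.
  have -> : f = \sum_i (fun s => D s 0 i ^+ 2).
    by apply/funext => ?; rewrite fct_sumE.
  apply: is_derive_sum => i; have := dDi i => ?.
  by apply: is_derive_eq; rewrite /GRing.scale /=; ring.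
have f'le (s : R) : s \in `[0, 1] -> f' s <= K * f s.
  move=> s01; apply: (@le_trans _ _ (\sum_(i < d) 2 * (L * `|D s| ^+ 2))).
    apply: ler_sum => i _; rewrite -mulrA ler_wpM2l//.
    apply: le_trans (ler_norm _) _; rewrite normrM expr2 mulrCA.
    apply: ler_pM => //; first exact: coord_le_norm.
    apply: le_trans (XY _ s01); exact: coord_le_norm.
  rewrite sumr_const card_ord -[leLHS]mulr_natl /K.
  have -> : d%:R * (2 * (L * `|D s| ^+ 2)) = 2 * d%:R * L * `|D s| ^+ 2 by ring.
  by apply: ler_wpM2l; [rewrite !mulr_ge0|exact: norm_sqr_le].
(* The integrating factor makes [exp (- K s) f s] nonincreasing; the sign turns this into the growth
   expected by [le_of_derive]. *)
pose g s := - (expR (- K * s) * f s).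
pose g' s := - (expR (- K * s) * (f' s - K * f s)).
have dg (s : R) : s \in `[0, 1] -> is_derive s 1 g (g' s).
  move=> s01; have ? := df _ s01.
  have ? : is_derive s 1 (fun s => expR (- K * s)) (- K * expR (- K * s)).
    apply: is_derive_eq (is_derive1_comp _ _) _.
    by rewrite /GRing.scale /=; ring.
  apply: is_derive_eq.
  by rewrite /g' /GRing.scale /=; ring.
have [t0 t1] := itv01_bounds t01.
have st := sub_itv01 t01.
have : g 0 <= g t.
  have dgt (s : R) : s \in `[0, t] -> is_derive s 1 g (g' s) by move=> /st /dg.
  have cg := within_continuous_derive dgt.
  have := le_of_derive t0 cg (fun s h => dgt s (subset_itv_oo_cc h)); apply.
  move=> s /subset_itv_oo_cc /st /f'le; rewrite /g' -mulrN => fs.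
  by rewrite mulr_ge0 ?expR_ge0//; lra.
rewrite /g mulr0 expR0 mul1r lerN2 => ft.
have {}ft : f t <= expR K * f 0.
  rewrite -(ler_pM2l (expR_gt0 (- K * t))) (le_trans ft)// mulrA -expRD.
  rewrite ler_peMl ?sumr_ge0// => [i _|]; first exact: sqr_ge0.
  rewrite -expR0 ler_expR.
  by have -> : - K * t + K = K * (1 - t) by [ring]; rewrite mulr_ge0 ?mulr_ge0 ?subr_ge0.
rewrite (le_trans (norm_sqr_le _))// (le_trans ft)//.
rewrite [leRHS](_ : _ = expR K * (d%:R * `|D 0| ^+ 2)); last by rewrite /K /D; ring.
rewrite ler_wpM2l ?expR_ge0//.
exact: (sum_sqr_le (D 0)).
Qed.

End Gronwall.

(** * Picard iteration *)

(** Turns continuity relative to a subset into plain continuity; it is used with [c] clamping time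
    to [[0, 1]]. *)
Lemma continuous_comp_within {T S V : topologicalType} (c : T -> S) (A : set S)
    (f : S -> V) :
  {within A, continuous f} -> continuous c -> (forall t, A (c t)) ->
  continuous (f \o c).
Proof.
move=> /subspace_continuousP cf cc Ac t.
apply: cvg_trans (cf _ (Ac t)) => B /= nB.
have H : \forall s \near t, A (c s) -> B (f (c s)) by exact: (cc t _ nB).
suff : \forall s \near t, B (f (c s)) by [].
by apply: filterS H => s; apply; exact: Ac.
Qed.

Lemma continuous_pair {T U V : topologicalType} (f : T -> U) (g : T -> V) t :
  {for t, continuous f} -> {for t, continuous g} ->
  {for t, continuous (fun s => (f s, g s))}.
Proof. by move=> cf cg; exact: (cvg_pair cf cg). Qed.

Lemma continuous_compf {T U V : topologicalType} (g : U -> V) (f : T -> U) t :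
  {for f t, continuous g} -> {for t, continuous f} ->
  {for t, continuous (fun s => g (f s))}.
Proof. by move=> cg cf; have := continuous_comp cf cg. Qed.

Lemma continuous_coord {T : topologicalType} {R : realType} {m n} (f : T -> 'M[R]_(m, n)) t i j :
  {for t, continuous f} -> {for t, continuous (fun s => f s i j)}.
Proof.
move=> cf; have := continuous_comp cf (@coord_continuous _ m n i j (f t)); by [].
Qed.

Lemma continuous_comp2 {T U V W : topologicalType} (k : U -> V -> W)
    (f : T -> U) (g : T -> V) t :
  continuous (fun p => k p.1 p.2) ->
  {for t, continuous f} -> {for t, continuous g} ->
  {for t, continuous (fun s => k (f s) (g s))}.
Proof.
move=> ck cf cg.
have h := continuous_pair cf cg.
have := continuous_comp h (ck (f t, g t)).
by [].
Qed.

Section Clamp.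
Context {R : realType}.

(** The retraction of the line onto [[0, 1]], with the same formula as the freezing of paths in
    [AC1_path]. Composing with it replaces data given only on [[0, 1]] by functions continuous on
    all of [R]. *)
Definition clamp01 (t : R) : R := Num.max 0 (Num.min t 1).

Lemma clamp01_in t : clamp01 t \in `[0, 1].
Proof. by rewrite in_itv /= /clamp01 le_max lexx ge_max ler01 ge_min lexx orbT. Qed.

Lemma clamp01_id t : t \in `[0, 1] -> clamp01 t = t.
Proof.
by rewrite in_itv /= /clamp01 => /andP[t0 t1]; rewrite min_l// max_r.
Qed.

Lemma continuous_clamp01 : continuous clamp01.
Proof.
move=> t; rewrite (_ : clamp01 = (cst 0 \max (id \min cst 1)))//.
by apply: continuous_max; [exact: cst_continuous|apply: continuous_min;
  [exact: cvg_id|exact: cst_continuous]].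
Qed.

End Clamp.

Section Primitive.
Context {R : realType}.

Lemma continuous_primitive (y : R -> R) : continuous y ->
  exists2 F : R -> R, F 0 = 0 &
    forall t : R, t \in `[0, 1] -> is_derive t 1 F (y t).
Proof.
move=> cy.
(* The base point -1 and integrability up to 2 leave 0 and 1 in the interior, so that the derivative
   of the primitive is two-sided at these endpoints as well. *)
pose F x := (\int[lebesgue_measure]_(t in `[-1, x]) y t)%R.
exists (fun x => F x - F 0); first by rewrite subrr.
move=> t; rewrite in_itv /= => /andP[t0 t1].
have iy : (@lebesgue_measure R).-integrable `[-1, 2] (EFin \o y).
  apply: continuous_compact_integrable; first exact: segment_compact.
  by apply: continuous_subspaceT.
have [t2 t3] : t < 2 /\ -1 < t by lra.
have [dF eF] := continuous_FTC1_closed t2 iy t3 (cy t).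
have dFt : is_derive t 1 F (y t).
  exact: (DeriveDef dF (etrans (esym (derive1E F t)) eF)).
by apply: is_derive_eq (is_deriveB dFt (is_derive_cst (F 0) t 1)) _; rewrite subr0.
Qed.

End Primitive.

Section GeometricCauchy.
Context {R : realType} {d : nat}.

Lemma geometric_small (K e : R) : 0 < e -> exists n, K / 2 ^+ n < e.
Proof.
move=> e0; have := cvg_geometric K (z := 2^-1 : R).
rewrite ger0_norm// invf_lt1// ltr1n => /(_ isT) /cvgrPdist_lt /(_ _ e0).
move=> [n _ /(_ n (leqnn _))]; rewrite sub0r normrN /geometric /= exprVn => h.
by exists n; rewrite (le_lt_trans (ler_norm _)).
Qed.

Lemma geometric_cauchy_lim (u : nat -> 'rV[R]_d) (K : R) :
  (forall n, `|u n.+1 - u n| <= K / 2 ^+ n) ->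
  exists l, forall n, `|l - u n| <= 2 * K / 2 ^+ n.
Proof.
move=> uK.
have K0 : 0 <= K by have := uK 0%N; rewrite expr0 divr1; exact: le_trans.
(* Keeping the negative remainder makes the induction on [m] close exactly. *)
have bnd n m : `|u (n + m)%N - u n| <= 2 * K / 2 ^+ n - 2 * K / 2 ^+ (n + m).
  elim: m => [|m ih]; first by rewrite addn0 !subrr normr0.
  rewrite addnS -(subrKA (u (n + m)%N)) (le_trans (ler_normD _ _))//.
  apply: le_trans (lerD (uK _) ih) _.
  rewrite exprS invfM.
  have -> : 2 * K * (2^-1 / 2 ^+ (n + m)) = K / 2 ^+ (n + m) by field; rewrite expf_neq0.
  by lra.
have cu : cvg (u @ \oo).
  apply/cauchy_cvgP/cauchy_exP => e e0.
  have [n ne] := geometric_small (2 * K) e0; exists (u n); exists n => // m /= nm.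
  rewrite -ball_normE /ball_ /= distrC -(subnKC nm) (le_lt_trans (bnd _ _))//.
  rewrite (le_lt_trans _ ne)// lerBlDr lerDl divr_ge0 ?exprn_ge0//.
  by rewrite mulr_ge0.
exists (limn u) => n.
have h : (fun m => `|u m - u n|) @ \oo --> `|limn u - u n|.
  by apply: cvg_norm; apply: cvgB => //; exact: cvg_cst.
rewrite -(cvg_lim _ h)//; apply: limr_le; first by apply/cvg_ex; eexists; exact: h.
exists n => // m /= nm; rewrite -(subnKC nm) (le_trans (bnd _ _))//.
by rewrite lerBlDr lerDl divr_ge0 ?exprn_ge0// mulr_ge0.
Qed.

End GeometricCauchy.

Section PicardLindelof.
Context {R : realType} {d : nat}.
Variables (w : R -> 'rV[R]_d -> 'rV[R]_d) (L : R).
Hypothesis w_continuous : continuous (fun p : R * 'rV[R]_d => w p.1 p.2).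
Hypothesis L_ge0 : 0 <= L.
Hypothesis w_lipschitz : forall (t : R) x y, t \in `[0, 1] ->
  `|w t x - w t y| <= L * `|x - y|.
Variable x0 : 'rV[R]_d.

Let regular (Y : R -> 'rV[R]_d) := continuous (Y \o clamp01).

Let continuous_field Y : regular Y -> continuous (fun s => w s (Y (clamp01 s))).
Proof.
by move=> rY t; apply: continuous_comp2 => //; exact: rY.
Qed.

(** The Picard operator. [Y] enters through its clamped values, so the integrand is continuous on
    the whole line and the new curve has two-sided derivatives on all of [[0, 1]]. *)
Let picard_step Y : regular Y -> exists Z : R -> 'rV[R]_d, [/\ Z 0 = x0,
  regular Z &
  forall t : R, t \in `[0, 1] -> is_derive t 1 Z (w t (Y t))].
Proof.
move=> rY.
have H i : {F : R -> R | F 0 = 0 /\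
    forall t : R, t \in `[0, 1] -> is_derive t 1 F (w t (Y (clamp01 t)) 0 i)}.
  apply: cid; have ci : continuous (fun s => w s (Y (clamp01 s)) 0 i).
    by move=> t; apply: continuous_coord; exact: continuous_field.
  by have [F F0 dF] := continuous_primitive ci; exists F.
pose Z t : 'rV[R]_d := x0 + \row_i sval (H i) t.
have dZ (t : R) : t \in `[0, 1] -> is_derive t 1 Z (w t (Y t)).
  move=> t01; apply: is_derive_row => i.
  have [_ /(_ t t01) dF] := svalP (H i).
  have -> : (fun s => Z s 0 i) = cst (x0 0 i) + sval (H i).
    by apply/funext => s; rewrite /Z !mxE.
  apply: is_derive_eq (is_deriveD (is_derive_cst (x0 0 i) t 1) dF) _.
  by rewrite add0r clamp01_id.
exists Z; split=> //.
  apply/rowP => i; rewrite /Z !mxE.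
  by have [-> _] := svalP (H i); rewrite addr0.
move=> t; apply: (@continuous_compf _ _ _ Z clamp01 t _ (@continuous_clamp01 R t)).
apply: differentiable_continuous; apply/derivable1_diffP.
by have [] := dZ _ (clamp01_in t).
Qed.

Let reg := {Y : R -> 'rV[R]_d | regular Y}.

Let reg0 : reg.
Proof. by exists (fun=> x0) => t; exact: cst_continuous. Defined.

Let step (Y : reg) : reg :=
  let Z := cid (picard_step (svalP Y)) in
  exist _ (sval Z) (and3_rect (fun _ r _ => r) (svalP Z)).

Let stepP (Y : reg) : sval (step Y) 0 = x0 /\
  forall t : R, t \in `[0, 1] -> is_derive t 1 (sval (step Y)) (w t (sval Y t)).
Proof. by rewrite /step /=; case: cid => Z [Z0 cZ dZ]. Qed.

Let u n := iter n step reg0.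
Let X n := sval (u n).

(** Bielecki's weighted norm: measured against [exp (K t)] with [K = 2 L + 1], each iteration halves
    the difference, since [L <= K / 2]. Thus the iteration converges on all of [[0, 1]] at once,
    whatever the size of [L]. The extra 1 gives [1 <= K], used for the first difference. *)
Let picard_geometric : exists2 C, 0 <= C &
  forall n (t : R), t \in `[0, 1] -> `|X n.+1 t - X n t| <= C / 2 ^+ n.
Proof.
have [M M0 wM] : exists2 M, 0 <= M & forall t : R, t \in `[0, 1] -> `|w t x0| <= M.
  have cw : continuous (fun t : R => `|w t x0|).
    move=> t; apply: cvg_norm.
    by apply: continuous_comp2 => //; exact: cst_continuous.
  have [c c01 cM] := EVT_max ler01 (continuous_subspaceT cw).
  by exists `|w c x0|.
pose K := 2 * L + 1.
pose g n t := M / 2 ^+ n * expR (K * t).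
pose g' n t := K * g n t.
have dg n (t : R) : is_derive t 1 (g n) (g' n t).
  have ? : is_derive t 1 (fun s => expR (K * s)) (K * expR (K * t)).
    apply: is_derive_eq (is_derive1_comp _ _) _.
    by rewrite /GRing.scale /=; ring.
  apply: is_derive_eq (is_deriveZ _ _) _.
  by rewrite /g' /g /GRing.scale /=; ring.
have K1 : 1 <= K by rewrite /K; have := L_ge0; lra.
have g0 n t : 0 <= g n t by rewrite mulr_ge0 ?expR_ge0// divr_ge0// exprn_ge0.
have bnd n (t : R) : t \in `[0, 1] -> `|X n.+1 t - X n t| <= g n t.
  elim: n t => [|n ih] t t01; have [t0 t1] := itv01_bounds t01.
    have [X10 dX1] := stepP (u 0).
    have sub := sub_itv01 t01.
    have := rV_norm_le_of_derive t0 (fun s h => dX1 s (sub s h)) (fun s _ => dg 0%N s).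
    rewrite X10 => H; rewrite (le_trans (H _))//.
      move=> s /sub s01; rewrite (le_trans (wM _ s01))//.
      rewrite /g' /g expr0 divr1 mulrCA ler_peMr//.
      rewrite (le_trans K1)// ler_peMr ?(le_trans ler01)//.
      rewrite -expR0 ler_expR mulr_ge0 ?(le_trans ler01 K1)//.
      by move: s01; rewrite in_itv /= => /andP[].
    by rewrite lerBlDr lerDl.
  have [Xa0 dXa] := stepP (u n.+1); have [Xb0 dXb] := stepP (u n).
  have sub := sub_itv01 t01.
  have := rV_norm_le_of_derive t0
    (fun s h => is_deriveB (dXa s (sub s h)) (dXb s (sub s h)))
    (fun s _ => dg n.+1 s).
  rewrite -!/(X _) => H.
  have e : (X n.+2 - X n.+1) 0 = 0.
    transitivity (X n.+2 0 - X n.+1 0) => //.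
    by rewrite [X n.+2 0]Xa0 [X n.+1 0]Xb0 subrr.
  move: H; rewrite e subr0 => H; rewrite (le_trans (H _))//.
    move=> s /sub s01; rewrite (le_trans (w_lipschitz _ _ s01))//.
    rewrite (le_trans (ler_wpM2l L_ge0 (ih _ s01)))// /g' /g exprS invfM.
    have -> : K * (M * (2^-1 / 2 ^+ n) * expR (K * s)) = (L + 2^-1) * g n s.
      by rewrite /K /g; field; rewrite expf_neq0.
    by apply: ler_wpM2r; [exact: g0|lra].
  by rewrite lerBlDr lerDl.
exists (M * expR K) => [|n t t01]; first by rewrite mulr_ge0 ?expR_ge0.
rewrite (le_trans (bnd _ _ t01))// /g mulrAC ler_wpM2r ?invr_ge0 ?exprn_ge0//.
rewrite ler_wpM2l// ler_expR ler_piMr ?(le_trans ler01)//.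
by move: t01; rewrite in_itv /= => /andP[].
Qed.

Theorem picard_lindelof : exists2 Y : R -> 'rV[R]_d, Y 0 = x0 &
  forall t : R, t \in `[0, 1] -> is_derive t 1 Y (w t (Y t)).
Proof.
have [C C0 XC] := picard_geometric.
have lim (t : R) : exists l, t \in `[0, 1] ->
    forall n, `|l - X n t| <= 2 * C / 2 ^+ n.
  have [t01|t01] := boolP (t \in `[0, 1]); last by exists 0.
  have [l lX] := geometric_cauchy_lim (fun n => XC n t t01).
  by exists l.
pose Y t := sval (cid (lim t)).
have YX (t : R) n : t \in `[0, 1] -> `|Y t - X n t| <= 2 * C / 2 ^+ n.
  by move=> t01; apply: (svalP (cid (lim t))).
have rY : regular Y.
  move=> t; apply/cvgrPdist_lt => e e0.
  have e30 : 0 < e / 3 by rewrite divr_gt0.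
  have [n ne] := geometric_small (2 * C) e30.
  have /cvgrPdist_lt/(_ _ e30) := svalP (u n) t.
  move=> H; near=> s.
  have h1 := YX _ n (clamp01_in s); have h2 := YX _ n (clamp01_in t).
  have h3 : `|X n (clamp01 t) - X n (clamp01 s)| < e / 3 by near: s; exact: H.
  rewrite /= -(subrKA (X n (clamp01 t))) (le_lt_trans (ler_normD _ _))//.
  rewrite -(subrKA (X n (clamp01 s)) (X n (clamp01 t))).
  have := ler_normD (X n (clamp01 t) - X n (clamp01 s)) (X n (clamp01 s) - Y (clamp01 s)).
  by rewrite [`|X n (clamp01 s) - Y _|]distrC; lra.
(* [Z] is the image of the limit [Y] under the Picard operator, so it remains to see [Y = Z]. Both
   lie close to [X n.+1], at distances at most [b] and [L b], which is why [n] is chosen with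
   [b (1 + L) < e]. *)
have [Z [Z0 rZ dZ]] := picard_step rY.
exists Z => // t t01; suff YZ : Y t = Z t by rewrite -YZ; exact: dZ.
apply/eqP; rewrite -subr_eq0 -normr_le0; apply/ler_addgt0Pr => e e0.
have [n] := @geometric_small _ (2 * C) (e / (1 + L)) (divr_gt0 e0 (ltr_wpDr L_ge0 ltr01)).
rewrite ltr_pdivlMr ?ltr_wpDr// mulrDr mulr1; set b := 2 * C / _ => be.
have b0 : 0 <= b by rewrite divr_ge0 ?exprn_ge0// mulr_ge0.
have bnd : `|X n.+1 t - Z t| <= L * b.
  have [t0 t1] := itv01_bounds t01.
  have sub := sub_itv01 t01.
  have [Xa0 dXa] := stepP (u n).
  have dg (s : R) : is_derive s 1 (fun r : R => (L * b) * r) (L * b).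
    exact: is_derive_scale.
  have := rV_norm_le_of_derive t0
    (fun s h => is_deriveB (dXa s (sub s h)) (dZ s (sub s h))) (fun s _ => dg s).
  rewrite -!/(X _) => H.
  have e0' : (X n.+1 - Z) 0 = 0.
    transitivity (X n.+1 0 - Z 0) => //.
    by rewrite [X n.+1 0]Xa0 Z0 subrr.
  move: H; rewrite e0' subr0 mulr0 subr0 => H; rewrite (le_trans (H _))//.
    move=> s /sub s01; rewrite (le_trans (w_lipschitz _ _ s01))//.
    by rewrite ler_wpM2l// distrC; exact: YX.
  by rewrite ler_piMr// mulr_ge0.
have bS : 2 * C / 2 ^+ n.+1 <= b.
  by rewrite /b ler_wpM2l ?mulr_ge0// lef_pV2 ?posrE ?exprn_gt0// ler_eXn2l ?ltr1n.
rewrite -(subrKA (X n.+1 t)) (le_trans (ler_normD _ _))//.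
by have := YX t n.+1 t01; rewrite add0r; lra.
Unshelve. all: by end_near. Qed.

End PicardLindelof.

(** * Continuously differentiable functions *)

Section C1Calculus.
Context {R : realType}.

(** The differential is carried as explicit data. Its continuity is asked direction by direction,
    the form in which [C1_slab] and [test_function] state theirs. *)
Definition C1_with {V W : normedModType R} (f : V -> W) (Df : V -> V -> W) :=
  (forall x, is_diff x f (Df x)) /\ (forall h, continuous (fun x => Df x h)).

Lemma C1_with_ext {V W : normedModType R} (f g : V -> W) Df Dg :
  f =1 g -> (forall x h, Df x h = Dg x h) -> C1_with f Df -> C1_with g Dg.
Proof.
move=> /funext <- e; have -> // : Dg = Df.
by apply/funext => x; apply/funext => h.
Qed.

Lemma C1_with_continuous {V W : normedModType R} (f : V -> W) Df :
  C1_with f Df -> continuous f.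
Proof. by move=> [df _] x; apply: differentiable_continuous; have [] := df x. Qed.

Lemma C1_with_lin {V W : normedModType R} (f : V -> W) Df : C1_with f Df ->
  forall x a u w, Df x (a *: u + w) = a *: Df x u + Df x w.
Proof. by move=> [df _] x a u w; have [_ <-] := df x; rewrite linearP. Qed.

Lemma is_derive_diff {V W : normedModType R} (f : V -> W) x df v :
  is_diff x f df -> is_derive x v f (df v).
Proof.
move=> [dif <-]; apply: DeriveDef; first exact: diff_derivable.
by rewrite deriveE.
Qed.

Lemma is_diff_derive {W : normedModType R} (f : R -> W) (x : R) df :
  is_derive x 1 f df -> is_diff x f (fun h => h *: df).
Proof.
move=> [dbl <-]; apply: DiffDef; first exact/derivable1_diffP.
by rewrite deriv1E// derive1E.
Qed.

Lemma is_diff_path {V W : normedModType R} (f : V -> W) (y : R -> V) (t : R) df dy :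
  is_derive t 1 y dy -> is_diff (y t) f df ->
  is_derive t 1 (fun s => f (y s)) (df dy).
Proof.
move=> dyt dft; have := @is_diff_comp _ _ _ _ y _ f df t (is_diff_derive dyt) dft.
by move=> h; have := @is_derive_diff _ _ _ _ _ (1 : R) h; rewrite /= scale1r.
Qed.

Lemma C1_with_cst {V W : normedModType R} (c : W) :
  C1_with (fun _ : V => c) (fun _ _ => 0).
Proof. by split=> [x|h]; [exact: is_diff_cst|move=> x; exact: cst_continuous]. Qed.

Lemma C1_withD {V W : normedModType R} (f g : V -> W) Df Dg :
  C1_with f Df -> C1_with g Dg ->
  C1_with (fun x => f x + g x) (fun x h => Df x h + Dg x h).
Proof.
move=> [df cf] [dg cg]; split=> [x|h x]; last exact: cvgD (cf _ _) (cg _ _).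
by have := df x; have := dg x => ? ?; exact: is_diffD.
Qed.

Lemma C1_withN {V W : normedModType R} (f : V -> W) Df :
  C1_with f Df -> C1_with (fun x => - f x) (fun x h => - Df x h).
Proof.
move=> [df cf]; split=> [x|h x]; last exact: cvgN (cf _ _).
by have := df x => ?; exact: is_diffN.
Qed.

Lemma C1_withM {V : normedModType R} (f g : V -> R) Df Dg :
  C1_with f Df -> C1_with g Dg ->
  C1_with (fun x => f x * g x) (fun x h => f x * Dg x h + g x * Df x h).
Proof.
move=> cdf cdg; have cf := C1_with_continuous cdf; have cg := C1_with_continuous cdg.
move: cdf cdg => [df cDf] [dg cDg]; split=> [x|h x].
  by have := df x; have := dg x => ? ?; exact: is_diffM.
apply: cvgD; apply: cvgM; [exact: cf|exact: cDg|exact: cg|exact: cDf].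
Qed.

Lemma C1_with_linear {V W : normedModType R} (f : {linear V -> W}) :
  continuous f -> C1_with f (fun _ => f).
Proof.
move=> cf; split=> [x|h x]; last exact: cst_continuous.
by apply: DiffDef; [exact: linear_differentiable|exact: diff_lin].
Qed.

Lemma C1_with_comp1 {V : normedModType R} (F F' : R -> R) (f : V -> R) Df :
  (forall s : R, is_derive s 1 F (F' s)) -> continuous F' -> C1_with f Df ->
  C1_with (fun x => F (f x)) (fun x h => F' (f x) * Df x h).
Proof.
move=> dF cF' cdf; have cf := C1_with_continuous cdf; move: cdf => [df cDf]; split=> [x|h x].
  have h1 := @is_diff_comp _ _ _ _ f _ F _ x (df x) (is_diff_derive (dF (f x))).
  have <- : (fun h => h *: F' (f x)) \o Df x = (fun h => F' (f x) * Df x h).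
    by apply/funext => h /=; rewrite /GRing.scale /= mulrC.
  exact: h1.
apply: cvgM (cDf _ _); exact: (continuous_compf (cF' _) (cf x)).
Qed.

Lemma C1_withZl {V W : normedModType R} (k : V -> R) Dk (w : W) :
  C1_with k Dk -> C1_with (fun x => k x *: w) (fun x h => Dk x h *: w).
Proof.
move=> [dk ck]; split=> [x|h x]; last by apply: cvgZr_tmp; exact: ck.
have [dkx e] := dk x; apply: DiffDef; first exact: differentiableZl.
by rewrite diffZl// e.
Qed.

Lemma C1_with_sum {V W : normedModType R} n (f : 'I_n -> V -> W) Df :
  (forall i, C1_with (f i) (Df i)) ->
  C1_with (fun x => \sum_i f i x) (fun x h => \sum_i Df i x h).
Proof.
elim: n f Df => [|n ih] f Df h.
  by apply: C1_with_ext (C1_with_cst 0) => [x|x k]; rewrite big_ord0.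
apply: C1_with_ext (C1_withD (h ord0) (ih _ _ (fun i => h (lift ord0 i)))).
- by move=> x; rewrite big_ord_recl.
- by move=> x k; rewrite big_ord_recl.
Qed.

Lemma C1_with_row {V : normedModType R} {d} (f : V -> 'rV[R]_d) (Df : V -> V -> 'rV[R]_d) :
  (forall i, C1_with (fun x => f x 0 i) (fun x h => Df x h 0 i)) ->
  C1_with f Df.
Proof.
move=> h.
apply: C1_with_ext (C1_with_sum (fun i => C1_withZl (evec i) (h i))).
- by move=> x; rewrite [RHS]row_sum_delta.
- by move=> x k; rewrite [RHS]row_sum_delta.
Qed.

Lemma is_diff_coord {V : normedModType R} {m n} (f : V -> 'M[R]_(m, n)) x df i j :
  is_diff x f df -> is_diff x (fun y => f y i j) (fun h => df h i j).
Proof.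
move=> dfx; have lg : linear (fun u : 'M[R]_(m, n) => u i j) by move=> a u w; rewrite !mxE.
pose gM := GRing.isLinear.Build _ _ _ _ _ lg.
pose gL : {linear 'M[R]_(m, n) -> R} := HB.pack (fun u : 'M[R]_(m, n) => u i j) gM.
have cg : continuous gL by exact: coord_continuous.
exact: (@is_diff_comp _ _ _ _ f _ gL _ x dfx ((C1_with_linear cg).1 _)).
Qed.

Lemma C1_with_coord {V : normedModType R} {m n} (f : V -> 'M[R]_(m, n))
    (Df : V -> V -> 'M[R]_(m, n)) i j :
  C1_with f Df -> C1_with (fun x => f x i j) (fun x h => Df x h i j).
Proof.
move=> [df cDf]; split=> [x|h x]; first exact: is_diff_coord.
by apply: continuous_coord; exact: cDf.
Qed.

Lemma is_derive_graph {V W : normedModType R} (f : R * V -> W) (y : R -> V) (t : R) df dy :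
  is_derive t 1 y dy -> is_diff (t, y t) f df ->
  is_derive t 1 (fun s => f (s, y s)) (df (1, dy)).
Proof.
move=> dyt dft.
have dp : is_diff t (fun s : R => (s, y s)) (fun h => (h, h *: dy)).
  exact: (is_diff_pair (is_diff_id t) (is_diff_derive dyt)).
have := @is_diff_comp _ _ _ _ (fun s : R => (s, y s)) _ f _ t dp dft.
by move=> h; have := @is_derive_diff _ _ _ _ _ (1 : R) h; rewrite /= scale1r.
Qed.

Lemma is_diff_section {V W : normedModType R} (f : R * V -> W) (t : R) x df :
  is_diff (t, x) f df -> is_diff x (fun y => f (t, y)) (fun h => df (0, h)).
Proof.
have dp : is_diff x (fun y : V => (t, y)) (fun h => (0, h)).
  exact: (is_diff_pair (is_diff_cst t x) (is_diff_id x)).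
exact: (@is_diff_comp _ _ _ _ (fun y : V => (t, y)) _ f _ x dp).
Qed.

Lemma C1_withZ {V : normedModType R} {d} (k : V -> R) Dk (f : V -> 'rV[R]_d) Df :
  C1_with k Dk -> C1_with f Df ->
  C1_with (fun x => k x *: f x) (fun x h => k x *: Df x h + Dk x h *: f x).
Proof.
move=> ck cf; apply: C1_with_row => i.
apply: C1_with_ext (C1_withM ck (C1_with_coord 0 i cf)).
- by move=> x; rewrite !mxE.
- by move=> x h; rewrite !mxE; congr (_ + _); exact: mulrC.
Qed.

Lemma C1_with_fst {V W : normedModType R} : C1_with (@fst V W) (fun _ => fst).
Proof. exact: (@C1_with_linear _ _ (@fst V W) (fun x => cvg_fst)). Qed.

Lemma C1_with_snd {V W : normedModType R} : C1_with (@snd V W) (fun _ => snd).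
Proof. exact: (@C1_with_linear _ _ (@snd V W) (fun x => cvg_snd)). Qed.

Lemma C1_with_id {V : normedModType R} : C1_with (@id V) (fun _ => id).
Proof. exact: (@C1_with_linear _ _ idfun (fun x => cvg_id)). Qed.

Lemma diff_rV_sum {d} {W : normedModType R} (f : 'rV[R]_d -> W) Df :
  C1_with f Df -> forall x h, Df x h = \sum_i h 0 i *: Df x (evec i).
Proof.
move=> [df _] x h; have [_ <-] := df x.
rewrite [in LHS](row_sum_delta h) linear_sum.
by apply: eq_bigr => i _; rewrite linearZ.
Qed.

Lemma continuous_bigsum {T : topologicalType} {W : normedModType R} n
    (F : 'I_n -> T -> W) t : (forall i, {for t, continuous (F i)}) ->
  {for t, continuous (fun s => \sum_i F i s)}.
Proof.
elim: n F => [|n ih] F h.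
  rewrite (_ : (fun _ => _) = cst 0); first exact: cst_continuous.
  by apply/funext => s; rewrite big_ord0.
rewrite (_ : (fun _ => _) = fun s => F ord0 s + \sum_i F (lift ord0 i) s).
  by apply: continuousD; [exact: h|exact: ih].
by apply/funext => s; rewrite big_ord_recl.
Qed.

(** Continuity of [Df] is known only for fixed directions, while here the direction varies with [p];
    expanding it in the basis of the finite-dimensional space reduces to fixed ones. *)
Lemma C1_with_comp {d} {V : normedModType R} (f : 'rV[R]_d -> R) Df
    (Y : V -> 'rV[R]_d) DY :
  C1_with f Df -> C1_with Y DY ->
  C1_with (fun p => f (Y p)) (fun p h => Df (Y p) (DY p h)).
Proof.
move=> cdf cdY; have cY := C1_with_continuous cdY.
have [df cDf] := cdf; have [dY cDY] := cdY; split=> [p|h].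
  by have := df (Y p); have := dY p => ? ?; exact: (@is_diff_comp _ _ _ _ Y _ f).
rewrite (_ : (fun _ => _) = fun p => \sum_i DY p h 0 i * Df (Y p) (evec i)).
  move=> p; apply: continuous_bigsum => i; apply: continuousM.
    by apply: continuous_coord; exact: cDY.
  exact: (continuous_compf (cDf _ _) (cY p)).
by apply/funext => p; rewrite (diff_rV_sum cdf).
Qed.

End C1Calculus.

(** * Steps and bumps of class C^1 *)

Section Bump.
Context {R : realType}.

(** The square makes the positive part C^1, which is exactly the smoothness demanded of test
    functions. *)
Definition sqr_pos (s : R) : R := Num.max 0 s ^+ 2.

Definition sqr_pos' (s : R) : R := 2 * Num.max 0 s.

Lemma is_derive_sqr_pos (s : R) : is_derive s 1 sqr_pos (sqr_pos' s).
Proof.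
have [s0|s0|->] := ltgtP s 0.
- apply: (@near_eq_is_derive _ _ _ (cst 0)).
    near=> t; have t0 : t < 0 by near: t; exact: lt_nbhsl.
    by rewrite /sqr_pos max_l ?expr0n// ltW.
  have -> : sqr_pos' s = 0 by rewrite /sqr_pos' max_l ?mulr0// ltW.
  exact: is_derive_cst.
- have -> : sqr_pos' s = 2 * s by rewrite /sqr_pos' max_r// ltW.
  have h : is_derive s 1 (fun t : R => t ^+ 2) (2 * s).
    apply: is_derive_eq; rewrite /GRing.scale /=. by ring.
  apply: near_eq_is_derive h.
  near=> t; have t0 : 0 < t by near: t; exact: lt_nbhsr.
  by rewrite /sqr_pos max_r// ltW.
- have -> : sqr_pos' 0 = 0 by rewrite /sqr_pos' maxxx mulr0.
  have h : (fun h : R => h^-1 *: (sqr_pos (h *: 1 + 0) - sqr_pos 0)) @ 0^' --> (0 : R).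
    apply/cvgrPdist_le => e e0; near=> h.
    have he : `|h| <= e by near: h; exact: dnbhs0_le.
    have h0 : h != 0 by near: h; exact: nbhs_dnbhs_neq.
    rewrite /sqr_pos maxxx expr0n /= subr0 addr0 sub0r normrN.
    rewrite /GRing.scale /= mulr1 normrM normfV ler_pdivrMl ?normr_gt0//.
    case: (leP 0 h) => h1; last by rewrite expr0n /= normr0 mulr_ge0// ltW.
    by rewrite normrX expr2 ler_wpM2l.
  by apply: DeriveDef; [apply/cvg_ex; exists 0|exact: cvg_lim h].
Unshelve. all: by end_near. Qed.

Lemma continuous_max0 : continuous (fun s : R => Num.max 0 s).
Proof.
move=> s; rewrite (_ : (fun s => _) = (cst 0 \max id))//.
by apply: continuous_max; [exact: cst_continuous|exact: cvg_id].
Qed.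

Lemma C1_with_sqr_pos {V : normedModType R} (f : V -> R) Df : C1_with f Df ->
  C1_with (fun x => sqr_pos (f x)) (fun x h => sqr_pos' (f x) * Df x h).
Proof.
apply: C1_with_comp1; first exact: is_derive_sqr_pos.
by move=> s; apply: cvgM; [exact: cvg_cst|exact: continuous_max0].
Qed.

Lemma sqr_pos_ge0 s : 0 <= sqr_pos s. Proof. exact: sqr_ge0. Qed.

Lemma sqr_pos_eq0 s : s <= 0 -> sqr_pos s = 0.
Proof. by move=> s0; rewrite /sqr_pos max_l ?expr0n. Qed.

Lemma sqr_pos_gt0 s : 0 < s -> 0 < sqr_pos s.
Proof. by move=> s0; rewrite /sqr_pos max_r ?exprn_gt0// ltW. Qed.

Lemma sqr_pos_homo : {homo sqr_pos : s t / s <= t}.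
Proof.
move=> s t st.
have h : Num.max 0 s <= Num.max 0 t by rewrite ge_max !le_max lexx st orbT.
by rewrite lerXn2r// nnegrE le_max lexx.
Qed.

(** Composing [sqr_pos] with its reflection gives a nondecreasing C^1 transition from 0 on [s <= 0]
    to 1 on [s >= 1]. *)
Definition smoothstep (s : R) : R := 1 - sqr_pos (1 - sqr_pos s).

Definition smoothstep' (s : R) : R :=
  4 * Num.max 0 (1 - sqr_pos s) * Num.max 0 s.

Lemma is_derive_smoothstep (s : R) : is_derive s 1 smoothstep (smoothstep' s).
Proof.
have h := C1_withD (C1_with_cst (1 : R)) (C1_withN (C1_with_sqr_pos
  (C1_withD (C1_with_cst (1 : R)) (C1_withN (C1_with_sqr_pos (@C1_with_id R R)))))).
have H := is_derive_diff (1 : R) (h.1 s).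
suff e : smoothstep' s = 0 - sqr_pos' (1 - sqr_pos s) * - (sqr_pos' s * 1) by rewrite e add0r; move: H; rewrite /= !add0r.
by rewrite /smoothstep' /sqr_pos' /=; ring.
Qed.

Lemma continuous_smoothstep' : continuous smoothstep'.
Proof.
have cp := C1_with_continuous (C1_with_sqr_pos (@C1_with_id R R)).
move=> s.
suff : {for s, continuous (fun s => 4 * Num.max 0 (1 - sqr_pos s) * Num.max 0 s)} by [].
apply: continuousM; last exact: continuous_max0.
apply: continuousM; first exact: cst_continuous.
have cB : {for s, continuous (fun s => 1 - sqr_pos s)}.
  by apply: continuousB; [exact: cst_continuous|exact: cp].
by have := continuous_max (@cst_continuous _ _ (0 : R) s) cB.
Qed.

Lemma C1_with_smoothstep {V : normedModType R} (f : V -> R) Df : C1_with f Df ->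
  C1_with (fun x => smoothstep (f x)) (fun x h => smoothstep' (f x) * Df x h).
Proof.
apply: C1_with_comp1; first exact: is_derive_smoothstep.
exact: continuous_smoothstep'.
Qed.

Lemma smoothstep0 s : s <= 0 -> smoothstep s = 0.
Proof.
by move=> s0; rewrite /smoothstep (sqr_pos_eq0 s0) subr0 /sqr_pos max_r// expr1n subrr.
Qed.

Lemma sqr_pos_ge1 s : 1 <= s -> 1 <= sqr_pos s.
Proof. by move=> s1; rewrite /sqr_pos max_r ?exprn_ege1// (le_trans _ s1). Qed.

Lemma smoothstep1 s : 1 <= s -> smoothstep s = 1.
Proof.
by move=> s1; rewrite /smoothstep [X in 1 - X]sqr_pos_eq0 ?subr0// subr_le0 sqr_pos_ge1.
Qed.

Lemma smoothstep_homo : {homo smoothstep : s t / s <= t}.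
Proof. by move=> s t st; rewrite lerB// sqr_pos_homo// lerB// sqr_pos_homo. Qed.

Lemma smoothstep_ge0 s : 0 <= smoothstep s.
Proof.
rewrite -(smoothstep0 (s := Num.min 0 s)) ?ge_min ?lexx//.
by rewrite smoothstep_homo// ge_min lexx orbT.
Qed.

Lemma smoothstep_le1 s : smoothstep s <= 1.
Proof.
rewrite -(smoothstep1 (s := Num.max 1 s)) ?le_max ?lexx//.
by rewrite smoothstep_homo// le_max lexx orbT.
Qed.

Lemma smoothstep'_ge0 s : 0 <= smoothstep' s.
Proof. by rewrite !mulr_ge0// le_max lexx. Qed.

Lemma smoothstep'_eq0 s : s <= 0 \/ 1 <= s -> smoothstep' s = 0.
Proof.
move=> [s0|s1]; rewrite /smoothstep'; first by rewrite [Num.max 0 s]max_l// mulr0.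
by rewrite [Num.max 0 (1 - _)]max_l ?mulr0 ?mul0r// subr_le0 sqr_pos_ge1.
Qed.

End Bump.

(** * Determination of finite measures by smooth functions *)

Section BorelMaps.
Context {R : realType}.

Lemma open_borel {T : ptopologicalType} (A : set T) :
  open A -> measurable (A : set (borel T)).
Proof. exact: sub_gen_smallest. Qed.

Lemma continuous_borel {T T' : ptopologicalType} (f : T -> T') :
  continuous f -> measurable_fun [set: borel T] (f : borel T -> borel T').
Proof.
move=> /continuousP cf; apply: (@measurability _ _ (borel T) (borel T') setT f (@open T')) => //.
by move=> _ [B oB <-]; rewrite setTI; apply: open_borel; exact: cf.
Qed.

Lemma continuous_borel_R {T : ptopologicalType} (f : T -> R) :
  continuous f -> measurable_fun [set: borel T] (f : borel T -> R).
Proof.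
move=> /continuousP cf; apply: (measurability _ (RGenOpens.measurableE R)).
move=> _ [_ [a [b ->] <-]]; rewrite setTI; apply: open_borel.
exact/cf/interval_open.
Qed.

End BorelMaps.

Section DensityPushforward.
Context d1 d2 (T1 : measurableType d1) (T2 : measurableType d2) (R : realType).
Variables (m : {measure set T1 -> \bar R}) (X : T1 -> T2) (k : T1 -> R).
Hypotheses (mX : measurable_fun setT X) (mk : measurable_fun setT k).
Hypothesis k0 : forall x, 0 <= k x.

Definition density_pushforward (A : set T2) : \bar R :=
  (\int[m]_(x in X @^-1` A) (k x)%:E)%E.

Let mXA A : measurable A -> measurable (X @^-1` A).
Proof. by move=> mA; rewrite -[X in measurable X]setTI; exact: mX. Qed.

Let dp0 : density_pushforward set0 = 0%E.
Proof. by rewrite /density_pushforward preimage_set0 integral_set0. Qed.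

Let dp_ge0 A : (0 <= density_pushforward A)%E.
Proof. by apply: integral_ge0 => x _; rewrite lee_fin. Qed.

Let dp_sigma_additive : semi_sigma_additive density_pushforward.
Proof.
move=> F mF tF mUF; rewrite /density_pushforward preimage_bigcup.
rewrite ge0_integral_bigcup.
- apply: is_cvg_nneseries => n _ _; exact: dp_ge0.
- by move=> n; exact: mXA.
- by apply/measurable_EFinP; exact: measurable_funTS.
- by move=> x _; rewrite lee_fin.
- apply/trivIsetP => /= i j _ _ ij; rewrite -preimage_setI.
  by move/trivIsetP : tF => /(_ _ _ _ _ ij) ->//; rewrite preimage_set0.
Qed.

HB.instance Definition _ := isMeasure.Build _ _ _
  density_pushforward dp0 dp_ge0 dp_sigma_additive.

Definition density_measure : {measure set T2 -> \bar R} := density_pushforward.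

Import HBNNSimple.

(** The formula passes from indicators to simple functions and then, by monotone convergence along
    [nnsfun_approx], to all non-negative measurable functions. *)
Lemma ge0_integral_density_pushforward (f : T2 -> \bar R) :
  measurable_fun setT f -> (forall y, 0 <= f y)%E ->
  (\int[density_pushforward]_y f y = \int[m]_x ((k x)%:E * f (X x)))%E.
Proof.
move=> mf f0; pose f_ := nnsfun_approx measurableT mf.
have f_cvg (y : T2) : (f_ n y)%:E @[n --> \oo] --> f y.
  by apply: cvg_nnsfun_approx => // z _; exact: f0.
have nd_f (y : T2) : {homo (fun n => f_ n y) : a b / (a <= b)%N >-> a <= b}.
  by move=> a b ab; exact/lefP/nd_nnsfun_approx.
have mkE : measurable_fun setT (EFin \o k) by exact/measurable_EFinP.
have mfX n : measurable_fun setT (fun x => (f_ n (X x))%:E).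
  by apply/measurable_EFinP; exact: measurableT_comp.
have -> : (\int[density_pushforward]_y f y =
    limn (fun n => \int[density_pushforward]_y (f_ n y)%:E))%E.
  rewrite -monotone_convergence//.
  - by apply: eq_integral => y _; apply/esym/cvg_lim => //; exact: f_cvg.
  - by move=> n; exact/measurable_EFinP.
  - by move=> n y _; rewrite lee_fin.
  - by move=> y _ a b ab; rewrite lee_fin; exact: nd_f.
have -> : (\int[m]_x ((k x)%:E * f (X x)) =
    limn (fun n => \int[m]_x ((k x)%:E * (f_ n (X x))%:E)))%E.
  rewrite -monotone_convergence//.
  - apply: eq_integral => x _; apply/esym/cvg_lim => //.
    by apply: cvgeZl => //; exact: f_cvg.
  - by move=> n; exact: emeasurable_funM.
  - by move=> n y _; rewrite mule_ge0// lee_fin.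
  - by move=> y _ a b ab; rewrite lee_wpmul2l// lee_fin//; exact: nd_f.
congr (limn _); apply/funext => n.
rewrite integral_nnsfun// patch_setT sintegralE.
transitivity (\int[m]_x (\sum_(r \in range (f_ n))
    (r%:E * ((k x)%:E * (\1_(f_ n @^-1` [set r]) (X x))%:E))))%E; last first.
  apply: eq_integral => x _; rewrite fimfunE -fsumEFin//.
  rewrite ge0_mule_fsumr; last first.
    by move=> r; rewrite nnfun_muleindic_ge0.
  by apply: eq_fsbigr => r _; rewrite EFinM muleCA.
have mind r : measurable_fun setT (fun x => (\1_(f_ n @^-1` [set r]) (X x))%:E).
  apply/measurable_EFinP; apply: (measurableT_comp _ mX).
  exact: measurable_indic.
rewrite ge0_integral_fsum//; last 2 first.
- by move=> r; apply: emeasurable_funM => //; exact: emeasurable_funM.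
- move=> r x _; rewrite muleCA; apply: mule_ge0; first by rewrite lee_fin.
  exact: nnfun_muleindic_ge0.
apply: eq_fsbigr => r; rewrite inE => -[y _ <-].
rewrite ge0_integralZl//; last 3 first.
- exact: emeasurable_funM.
- by move=> x _; rewrite mule_ge0// lee_fin.
- by rewrite lee_fin.
congr (_ * _)%E; rewrite [LHS]/= /density_pushforward [LHS]integral_mkcond.
apply: eq_integral => x _; rewrite patchE; case: ifPn => h.
  by rewrite indicE mem_set ?mule1//; rewrite inE in h.
by rewrite indicE memNset ?mule0// => Xx; move/negP : h; rewrite inE.
Qed.

End DensityPushforward.

Section OpenSetsByBumps.
Context {R : realType} {d : nat}.
Implicit Types (q x : 'rV[R]_d).

Definition sqdist q x : R := \sum_i (x 0 i - q 0 i) ^+ 2.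

Lemma C1_with_sqdist q :
  C1_with (sqdist q) (fun x h => \sum_i (2 * (x 0 i - q 0 i) * h 0 i)).
Proof.
apply: C1_with_sum => i.
have c := C1_withD (C1_with_coord 0 i (@C1_with_id R 'rV[R]_d)) (C1_with_cst (- q 0 i)).
apply: C1_with_ext (C1_withM c c) => [x|x h]; first by rewrite /= expr2.
by rewrite /= addr0; ring.
Qed.

Lemma norm_sqdist q x : `|x - q| ^+ 2 <= sqdist q x <= d%:R * `|x - q| ^+ 2.
Proof.
have -> : sqdist q x = \sum_i (x - q) 0 i ^+ 2.
  by apply: eq_bigr => i _; rewrite coordB.
by rewrite norm_sqr_le sum_sqr_le.
Qed.

Lemma sqdist_lt_norm q x e : 0 < e -> sqdist q x < e ^+ 2 -> `|x - q| < e.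
Proof.
move=> e0 h; rewrite -(@ltr_pXn2r _ 2)// ?nnegrE//; last exact: ltW.
by apply: le_lt_trans h; have /andP[] := norm_sqdist q x.
Qed.

Lemma rat_cover (O : set 'rV[R]_d) x : open O -> O x ->
  exists (q : 'rV[rat]_d) (n : nat),
    let p := map_mx (ratr : rat -> R) q in let e := n.+1%:R^-1 in
    sqdist p x < e ^+ 2 /\ forall y, sqdist p y < e ^+ 2 -> O y.
Proof.
move=> oO Ox; have /nbhs_ballP[e /= e0 eO] := open_nbhs_nbhs (conj oO Ox).
have [n ne] : exists n : nat, n.+1%:R^-1 < e / 2.
  have e20 : 0 < (e / 2)^-1 by rewrite invr_gt0 divr_gt0.
  exists (Num.truncn (e / 2)^-1); rewrite invf_plt ?posrE//; last by rewrite divr_gt0.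
  exact: truncnS_gt.
pose r : R := n.+1%:R^-1.
have r0 : 0 < r by rewrite invr_gt0.
(* Coordinates within [s] of rational ones give [sqdist <= d s^2 < r^2], because [d < (d + 1)^2]. *)
pose s := r / d.+1%:R.
have s0 : 0 < s by rewrite divr_gt0.
have H i : exists q : rat, ratr q \in `]x 0 i - s, x 0 i + s[.
  by apply: rat_in_itvoo; lra.
pose q : 'rV[rat]_d := \row_i sval (cid (H i)).
exists q, n; rewrite /= -/r; set p := map_mx _ q.
have xp : `|x - p| <= s.
  apply: rV_norm_le; first exact: ltW.
  move=> i; rewrite coordB !mxE; have := svalP (cid (H i)).
  by rewrite in_itv /= ler_distl => /andP[]; lra.
have /andP[_ h1] := norm_sqdist p x.
have h2 : sqdist p x < r ^+ 2.
  apply: le_lt_trans h1 _; apply: (@le_lt_trans _ _ (d%:R * s ^+ 2)).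
    by rewrite ler_wpM2l// lerXn2r ?nnegrE//; exact: ltW.
  rewrite /s expr_div_n mulrCA gtr_pMr ?exprn_gt0//.
  rewrite ltr_pdivrMr ?exprn_gt0// mul1r -natrX ltr_nat.
  by rewrite expnS expn1 mulSn ltn_addr// ltnS.
split=> // y yp; apply: eO; rewrite -ball_normE /ball_ /=.
have := sqdist_lt_norm r0 yp; have := sqdist_lt_norm r0 h2; rewrite distrC => h3 h4.
rewrite -(subrKA p) (le_lt_trans (ler_normD _ _))// distrC [`|p - y|]distrC.
by move: ne; rewrite -/r; lra.
Qed.

Definition bump q (e : R) x : R := sqr_pos (e ^+ 2 - sqdist q x).

Lemma C1_with_bump q e : exists Df, C1_with (bump q e) Df.
Proof.
eexists; apply: C1_with_sqr_pos.
exact: (C1_withD (C1_with_cst _) (C1_withN (C1_with_sqdist q))).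
Qed.

(** [O] is a union of countably many Euclidean balls with rational centres and radii [1 / (n + 1)],
    and each carries a C^1 bump. Multiplying the [n]-th partial sum by [n] before applying
    [smoothstep] drives every positive value eventually to 1, while monotonicity and bounded support
    survive. *)
Lemma open_approx (O : set 'rV[R]_d) : open O ->
  exists G : nat -> 'rV[R]_d -> R, [/\
    forall n, exists Df, C1_with (G n) Df,
    forall n, exists rho, forall x, rho < `|x| -> G n x = 0,
    forall n x, 0 <= G n x <= 1,
    forall x, {homo G^~ x : m n / (m <= n)%N >-> m <= n} &
    forall x, G n x @[n --> \oo] --> (\1_O x : R)].
Proof.
move=> oO.
pose T := ('rV[rat]_d * nat)%type.
pose ctr (c : T) : 'rV[R]_d := map_mx ratr c.1.
pose rad (c : T) : R := c.2.+1%:R^-1.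
pose good (c : T) := `[< forall y, sqdist (ctr c) y < rad c ^+ 2 -> O y >].
pose g k x : R := if unpickle k is Some c then
  if good c then bump (ctr c) (rad c) x else 0 else 0.
have g0 k x : 0 <= g k x.
  by rewrite /g; case: (unpickle k) => // c; case: ifP => // _; exact: sqr_pos_ge0.
have gO k x : ~ O x -> g k x = 0.
  move=> nOx; rewrite /g; case: (unpickle k) => // c; case: ifPn => // /asboolP h.
  rewrite /bump sqr_pos_eq0// subr_le0 leNgt; apply/negP => /h.
  exact: nOx.
have gpos x : O x -> exists k, 0 < g k x.
  move=> Ox; have [q [n [h1 h2]]] := rat_cover oO Ox.
  exists (pickle ((q, n) : T)); rewrite /g pickleK ifT; last exact/asboolP.
  by rewrite sqr_pos_gt0// subr_gt0.
have gC1 k : exists Df, C1_with (g k) Df.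
  rewrite /g; case: (unpickle k) => [c|]; last by eexists; exact: C1_with_cst.
  by case: (good c); [exact: C1_with_bump|eexists; exact: C1_with_cst].
have gsupp k : exists rho, forall x, rho < `|x| -> g k x = 0.
  rewrite /g; case: (unpickle k) => [c|]; last by exists 0.
  case: (good c); last by exists 0.
  exists (`|ctr c| + rad c) => x xr.
  have rad0 : 0 < rad c by rewrite invr_gt0.
  rewrite /bump sqr_pos_eq0// subr_le0 leNgt; apply/negP => /(sqdist_lt_norm rad0).
  move=> h; have := ler_normD (x - ctr c) (ctr c); rewrite subrK => h'.
  by have := lt_le_trans xr h'; lra.
pose h n x := \sum_(k < n) g k x.
have h0 n x : 0 <= h n x by apply: sumr_ge0.
have hmono x : {homo h^~ x : m n / (m <= n)%N >-> m <= n}.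
  move=> m n mn; rewrite /h -(subnKC mn) big_split_ord /= lerDl.
  exact: sumr_ge0.
exists (fun n x => smoothstep (n%:R * h n x)); split.
- move=> n; pose Dg k := sval (cid (gC1 k)).
  have := C1_with_sum (fun k : 'I_n => svalP (cid (gC1 k))).
  move=> /(C1_withM (C1_with_cst (n%:R : R))) /C1_with_smoothstep H.
  by eexists; exact: H.
- move=> n.
  have H : exists rho, forall x, rho < `|x| -> h n x = 0.
    elim: n => [|n [rho ih]]; first by exists 0 => x _; rewrite /h big_ord0.
    have [rho' ih'] := gsupp n; exists (Num.max rho rho') => x.
    rewrite gt_max => /andP[x1 x2].
    by rewrite /h big_ord_recr /= ih'// addr0; exact: ih.
  have [rho hr] := H; exists rho => x /hr ->.
  by rewrite mulr0 smoothstep0.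
- by move=> n x; rewrite smoothstep_ge0 smoothstep_le1.
- move=> x m n mn; apply: smoothstep_homo.
  by rewrite ler_pM// ?ler_nat//; exact: hmono.
- move=> x; have [Ox|nOx] := pselect (O x); last first.
    rewrite indicE memNset//=.
    have -> : (fun n => smoothstep (n%:R * h n x)) = (fun=> 0).
      apply/funext => n; rewrite /h big1 => [|k _]; last exact: gO.
      by rewrite mulr0 smoothstep0.
    exact: cvg_cst.
  rewrite indicE mem_set//=.
  have [k gk] := gpos _ Ox.
  apply: (@cvg_trans _ ((fun=> 1 : R) @ \oo)); last exact: cvg_cst.
  apply: near_eq_cvg; near=> n; apply/esym/smoothstep1.
  have kn : (k.+1 <= n)%N by near: n; exact: nbhs_infty_ge.
  have hk : g k x <= h n x.
    apply: le_trans (hmono x _ _ kn); rewrite /h big_ord_recr /= lerDr.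
    exact: sumr_ge0.
  have n1 : (g k x)^-1 <= n%:R by near: n; exact: nbhs_infty_ger.
  suff : (g k x)^-1 * g k x <= n%:R * h n x by rewrite mulVf// lt0r_neq0.
  by apply: ler_pM => //; rewrite ?invr_ge0// ltW.
Unshelve. all: by end_near. Qed.

End OpenSetsByBumps.

Section Determination.
Context {R : realType} {d : nat}.
Variables (m1 m0 : {finite_measure set (borel 'rV[R]_d) -> \bar R}).
Variables (X : 'rV[R]_d -> 'rV[R]_d) (k : 'rV[R]_d -> R).
Hypotheses (cX : continuous X) (ck : continuous k).
Hypothesis k0 : forall x, 0 <= k x.
Hypothesis test : forall (f : 'rV[R]_d -> R) Df rho, C1_with f Df ->
  (forall x, 0 <= f x <= 1) -> (forall x, rho < `|x| -> f x = 0) ->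
  (\int[m1]_x (f x)%:E = \int[m0]_x (k x * f (X x))%:E)%E.

(** By monotone convergence along [open_approx] the two measures agree on open sets, a pi-system
    generating the Borel sets; as [m1] is finite, they agree on all Borel sets. *)
Lemma ge0_integral_determined (F : borel 'rV[R]_d -> \bar R) :
  measurable_fun setT F -> (forall x, 0 <= F x)%E ->
  (\int[m1]_x F x = \int[m0]_x ((k x)%:E * F (X x)))%E.
Proof.
have mX := continuous_borel cX; have mk := continuous_borel_R ck.
pose m2 := density_measure m0 mX mk k0.
move=> mF F0; rewrite -(ge0_integral_density_pushforward m0 mX mk k0 mF F0).
apply: (@eq_measure_integral _ _ _ _ m2) => A mA _.
have opens (O : set 'rV[R]_d) : open O -> m1 O = m2 O.
  move=> oO; have [G [GC Gs G01 Gm Gc]] := open_approx oO.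
  have mG n : measurable_fun [set: borel 'rV[R]_d] (G n).
    by have [Df h] := GC n; apply: continuous_borel_R; exact: C1_with_continuous h.
  have mO : measurable (O : set (borel 'rV[R]_d)) by exact: open_borel.
  have e1 : m1 O = limn (fun n => \int[m1]_x (G n x)%:E)%E.
    rewrite -monotone_convergence//.
    - rewrite -[X in m1 X]setIT -integral_indic//; apply: eq_integral => x _.
      by apply/esym/cvg_lim => //; apply: cvg_EFin; [exact: nearW|exact: Gc].
    - by move=> n; exact/measurable_EFinP.
    - by move=> n x _; rewrite lee_fin; have /andP[] := G01 n x.
    - by move=> x _ a b ab; rewrite lee_fin; exact: Gm.
  have e2 : m2 O = limn (fun n => \int[m0]_x (k x * G n (X x))%:E)%E.
    rewrite -monotone_convergence//.
    - rewrite /m2 /density_measure /= /density_pushforward integral_mkcond.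
      apply: eq_integral => x _; apply/esym/cvg_lim => //.
      rewrite (_ : patch _ _ _ _ = (k x * \1_O (X x))%:E); last first.
        rewrite patchE indicE; case: ifPn => h.
          by rewrite mem_set ?mulr1//; rewrite inE in h.
        by rewrite memNset ?mulr0// => Xx; move/negP : h; rewrite inE.
      apply: cvg_EFin; first exact: nearW.
      by apply: cvgM; [exact: cvg_cst|exact: Gc].
    - move=> n; apply/measurable_EFinP; apply: measurable_funM => //.
      exact: (measurableT_comp (mG n) mX).
    - by move=> n x _; rewrite lee_fin mulr_ge0//; have /andP[] := G01 n (X x).
    - by move=> x _ a b ab; rewrite lee_fin ler_wpM2l//; exact: Gm.
  rewrite e1 e2; congr (limn _); apply/funext => n.
  have [Df h] := GC n; have [rho hr] := Gs n.
  exact: (test h (G01 n) hr).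
have I : setI_closed (@open 'rV[R]_d) by move=> B C; exact: openI.
have cov : \bigcup_(i : nat) [set: 'rV[R]_d] = setT by rewrite bigcup_const.
have fin (i : nat) : (m1 [set: borel 'rV[R]_d] < +oo)%E.
  by rewrite -ge0_fin_numE// fin_num_measure.
exact: (@measure_unique _ R (borel 'rV[R]_d) (@open 'rV[R]_d) (fun=> setT) erefl I
  (fun=> openT) cov m1 m2 opens fin A mA).
Qed.

End Determination.

(** * Fields on the closed slab *)

Lemma continuous_pairr {U V : topologicalType} (v : V) :
  continuous (fun u : U => (u, v)).
Proof.
move=> u; apply: (@continuous_pair _ _ _ id (fun=> v)); first exact: cvg_id.
exact: cst_continuous.
Qed.

Lemma continuous_pairl {U V : topologicalType} (u : U) :
  continuous (fun v : V => (u, v)).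
Proof.
move=> v; apply: (@continuous_pair _ _ _ (fun=> u) id); last exact: cvg_id.
exact: cst_continuous.
Qed.

Section CompactBounds.
Context {R : realType} {d : nat}.
Notation E := 'rV[R]_d.

Lemma compact_ball_rV (rho : R) : compact [set x : E | `|x| <= rho].
Proof.
apply: bounded_closed_compact.
  exists rho; split; first exact: num_real.
  by move=> r rr x /= /le_trans; apply; exact: ltW.
rewrite (_ : [set _ | _] = closed_ball_ (fun x : E => `|x|) 0 rho).
  exact: closed_closed_ball_.
by apply/seteqP; split=> x; rewrite /closed_ball_ /= sub0r normrN.
Qed.

Lemma cylinder_bound (g : R * E -> R) (rho : R) : continuous g ->
  exists2 M, 0 <= M & forall (t : R) (x : E), t \in `[0, 1] -> `|x| <= rho -> `|g (t, x)| <= M.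
Proof.
move=> cg.
pose I : set R := `[0, 1]%classic.
have cK : compact (I `*` [set x : E | `|x| <= rho]).
  by apply: compact_setX; [exact: segment_compact|exact: compact_ball_rV].
have := continuous_compact (continuous_subspaceT cg) cK.
move=> /(@compact_bounded R R^o)[M0 [_ hM]].
pose M := Num.max 0 (M0 + 1).
exists M => [|t x t01 xr]; first by rewrite le_max lexx.
apply: (hM M); last by exists (t, x).
by rewrite lt_max ltrDl ltr01 orbT.
Qed.

End CompactBounds.

Section SlabC1.
Context {R : realType} {d : nat}.
Notation E := 'rV[R]_d.

(** [f] is the field, arbitrary for times outside [[0, 1]]; [fb] is its extension frozen in time,
    and [Df] a continuous extension of the differential to all times. [Df] is claimed to be the
    differential only at interior times. *)
Definition slab_C1 {V : normedModType R} (f fb : R * E -> V)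
    (Df : R * E -> R * E -> V) :=
  [/\ continuous fb, forall (t : R) x, fb (t, x) = f (clamp01 t, x),
      forall h, continuous (fun p => Df p h) &
      forall (t : R) x, t \in `]0, 1[ -> is_diff (t, x) f (Df (t, x))].

Lemma within_slab_clamp {V : topologicalType} (f : R * E -> V) :
  {within @slab R d, continuous f} -> continuous (fun p => f (clamp01 p.1, p.2)).
Proof.
move=> cf; apply: (@continuous_comp_within _ _ _ (fun p : R * E => (clamp01 p.1, p.2)) _ _ cf).
  move=> p; apply: (@continuous_pair _ _ _ (fun p : R * E => clamp01 p.1) snd p _ cvg_snd).
  exact: (@continuous_compf _ _ _ (@clamp01 R) fst p (@continuous_clamp01 R _) cvg_fst).
by move=> p; rewrite /slab /=; exact: clamp01_in.
Qed.

Lemma C1_slabP {V : normedModType R} (f : R * E -> V) : C1_slab f ->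
  exists Df, slab_C1 f (fun p => f (clamp01 p.1, p.2)) Df.
Proof.
move=> [cf df Dg].
pose Df p h := sval (cid2 (Dg h)) (clamp01 p.1, p.2).
exists Df; split=> //.
- exact: within_slab_clamp.
- by move=> h; rewrite /Df; case: cid2 => g cg eg; exact: within_slab_clamp.
- move=> t x t01; have op : open_slab (t, x) by exact: t01.
  apply: DiffDef; first exact: df.
  apply/funext => h; rewrite /Df; case: cid2 => g cg eg /=.
  by rewrite eg// clamp01_id//; apply: subset_itv_oo_cc.
Qed.

Lemma slab_C1_coord {m n} (f fb : R * E -> 'M[R]_(m, n)) (Df : R * E -> R * E -> 'M[R]_(m, n)) i j :
  slab_C1 f fb Df ->
  slab_C1 (fun p => f p i j) (fun p => fb p i j) (fun p h => Df p h i j).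
Proof.
move=> [cf fE cD dD]; split.
- by move=> p; apply: continuous_coord; exact: cf.
- by move=> t x; rewrite fE.
- by move=> h p; apply: continuous_coord; exact: cD.
- by move=> t x t01; exact: is_diff_coord (dD t x t01).
Qed.

Lemma slab_C1_section {V : normedModType R} (f fb : R * E -> V) Df (t : R) :
  slab_C1 f fb Df -> t \in `]0, 1[ ->
  C1_with (fun x => f (t, x)) (fun x h => Df (t, x) (0, h)).
Proof.
move=> [cf fE cD dD] t01; split=> [x|h x]; first exact: is_diff_section (dD t x t01).
apply: (@continuous_compf _ _ _ (fun p => Df p (0, h)) (fun y : E => (t, y)) x (cD _ _)).
exact: continuous_pairl.
Qed.

Lemma slab_C1_time {V : normedModType R} (f fb : R * E -> V) Df (t : R) x :
  slab_C1 f fb Df -> t \in `]0, 1[ ->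
  is_derive t 1 (fun s => f (s, x)) (Df (t, x) (1, 0)).
Proof.
by move=> [_ _ _ dD] t01; exact: is_derive_graph (is_derive_cst x t 1) (dD t x t01).
Qed.

End SlabC1.

(** * Truncation of the fields in space *)

Section Truncation.
Context {R : realType} {d : nat}.
Notation E := 'rV[R]_d.

Definition cutoff (c : R) (x : E) : R := smoothstep (c - sqdist 0 x).

Implicit Types (c : R) (x : E).

Lemma cutoff01 c x : 0 <= cutoff c x <= 1.
Proof. by rewrite smoothstep_ge0 smoothstep_le1. Qed.

Lemma cutoff1 c x : d%:R * `|x| ^+ 2 + 1 <= c -> cutoff c x = 1.
Proof.
move=> h; rewrite /cutoff smoothstep1//; have := norm_sqdist 0 x.
by rewrite subr0 => /andP[_]; lra.
Qed.

(** The bound [|x| <= |x| ^ 2 + 1] lets the radius [c + 1] stand for the square root of [c]. *)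
Lemma cutoff_support c x : c + 1 < `|x| -> c - sqdist 0 x <= 0.
Proof.
move=> h; have := norm_sqdist 0 x; rewrite subr0 => /andP[+ _].
suff : `|x| < `|x| ^+ 2 + 1 by lra.
by have := sqr_ge0 (`|x| - 1); rewrite sqrrB expr1n mulr1; have := normr_ge0 x; nra.
Qed.

Lemma cutoff0 c x : c + 1 < `|x| -> cutoff c x = 0.
Proof. by move=> /cutoff_support h; rewrite /cutoff smoothstep0. Qed.

Definition Dcutoff (c : R) (x h : E) : R :=
  smoothstep' (c - sqdist 0 x) * - \sum_i (2 * x 0 i * h 0 i).

Lemma C1_with_cutoff c : C1_with (cutoff c) (Dcutoff c).
Proof.
have := C1_with_smoothstep (C1_withD (C1_with_cst (c : R)) (C1_withN (C1_with_sqdist (0 : E)))).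
apply: C1_with_ext => [//|x h]; rewrite /Dcutoff add0r.
by congr (_ * - _); apply: eq_bigr => i _; rewrite mxE subr0.
Qed.

Lemma Dcutoff0 c x h : c + 1 < `|x| -> Dcutoff c x h = 0.
Proof.
by move=> /cutoff_support xc; rewrite /Dcutoff smoothstep'_eq0 ?mul0r//; left.
Qed.

Lemma lin_bound (f : E -> R) (M : R) : (forall a u w, f (a *: u + w) = a * f u + f w) ->
  (forall i, `|f (evec i)| <= M) -> forall h, `|f h| <= d%:R * M * `|h|.
Proof.
move=> lf fM h.
have f0 : f 0 = 0.
  by have := lf (-1) 0 0; rewrite scaleN1r oppr0 addr0 mulN1r addNr.
have fs n (r : seq 'I_n) (F : 'I_n -> E) : f (\sum_(i <- r) F i) = \sum_(i <- r) f (F i).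
  elim: r => [|i r ih]; first by rewrite !big_nil f0.
  by rewrite !big_cons -[F i]scale1r lf ih scale1r mul1r.
rewrite [in f h](row_sum_delta h) fs (le_trans (ler_norm_sum _ _ _))//.
have -> : d%:R * M * `|h| = \sum_(i < d) M * `|h|.
  by rewrite sumr_const card_ord -mulrA mulr_natl.
apply: ler_sum => i _.
have -> : f (h 0 i *: delta_mx 0 i) = h 0 i * f (evec i).
  by have := lf (h 0 i) (evec i) 0; rewrite !addr0 f0 addr0.
by rewrite normrM mulrC ler_pM// coord_le_norm.
Qed.

(** The product vanishes for [|x| > c + 1], and over the compact set of times in [[0, 1]] and points
    with [|x| <= c + 1] the field and its derivatives are bounded; so local bounds become global.
    The Lipschitz bound in time reaches the endpoints by the mean value inequality, which uses
    derivatives at interior times only. *)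
Lemma truncation (f fb : R * E -> R) Df (c : R) : slab_C1 f fb Df ->
  exists2 C, 0 <= C &
  [/\ forall t x, `|cutoff c x * fb (t, x)| <= C,
      forall t : R, t \in `]0, 1[ -> exists2 Dg,
        C1_with (fun x => cutoff c x * fb (t, x)) Dg &
        forall x h, `|Dg x h| <= C * `|h| &
      forall (s t : R) x, s \in `[0, 1] -> t \in `[0, 1] ->
        `|cutoff c x * fb (s, x) - cutoff c x * fb (t, x)| <= C * `|s - t|].
Proof.
move=> sf; have [cf fE cD dD] := sf.
have fbE (t : R) x : t \in `[0, 1] -> fb (t, x) = f (t, x).
  by move=> t01; rewrite fE clamp01_id.
have [M0 M00 hM0] := cylinder_bound (c + 1) cf.
have [M1 M10 hM1] := cylinder_bound (c + 1) (cD (1, 0)).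
have [M2 M20 hM2] : exists2 M, 0 <= M & forall (t : R) (x : E) i, t \in `[0, 1] -> `|x| <= c + 1 ->
    `|Df (t, x) (0, evec i)| <= M.
  have [i M M' MM h t x t01 xr|i|M M00' hM] := @common_bound R d (fun i M =>
    forall (t : R) (x : E), t \in `[0, 1] -> `|x| <= c + 1 -> `|Df (t, x) (0, evec i)| <= M).
  - exact: le_trans (h t x t01 xr) MM.
  - exact: (cylinder_bound (c + 1) (cD (0, evec i))).
  - by exists M => // t x i; exact: hM.
have [M3 M30 hM3] : exists2 M, 0 <= M & forall i (x : E), `|x| <= c + 1 ->
    `|Dcutoff c x (evec i)| <= M.
  apply: common_bound => [i M M' MM h x xr|i]; first exact: le_trans (h x xr) MM.
  have ci : continuous (fun p : R * E => Dcutoff c p.2 (evec i)).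
    move=> p; apply: (@continuous_compf _ _ _ (fun x => Dcutoff c x (evec i)) snd p _ cvg_snd).
    exact: (C1_with_cutoff c).2.
  have [M M0' hM] := cylinder_bound (c + 1) ci; exists M => // x xr.
  by apply: (hM 0 x) => //; exact: itv01_0.
have cabs x : `|cutoff c x| <= 1.
  by have /andP[a b] := cutoff01 c x; rewrite ger0_norm.
(* Product rule: [M0] bounds the field, [M2] its partial derivatives in space and [M3] those of the
   cutoff. Passing from partial derivatives to the differential costs the factor [d]. *)
pose C2 := M2 + M0 * M3.
have C20 : 0 <= C2 by rewrite addr_ge0// mulr_ge0.
exists (M0 + M1 + d%:R * C2); first by rewrite !addr_ge0// mulr_ge0.
have dC2 : 0 <= d%:R * C2 by rewrite mulr_ge0.
split.
- move=> t x; have [xr|xr] := leP `|x| (c + 1); last first.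
    by rewrite cutoff0// mul0r normr0 !addr_ge0.
  rewrite normrM (@le_trans _ _ (1 * M0))//; last by rewrite mul1r -addrA lerDl addr_ge0.
  rewrite ler_pM// fE; have := hM0 _ x (clamp01_in t) xr.
  by rewrite fE clamp01_id// clamp01_in.
- move=> t t01.
  have t01' : t \in `[0, 1] by apply: subset_itv_oo_cc.
  have H := C1_withM (C1_with_cutoff c) (slab_C1_section sf t01).
  eexists.
    apply: C1_with_ext H; last by move=> x h; reflexivity.
    by move=> x /=; rewrite fbE.
  move=> x h; have [xr|xr] := leP `|x| (c + 1); last first.
    by rewrite /= cutoff0// Dcutoff0// mul0r mulr0 addr0 normr0 mulr_ge0// !addr_ge0.
  apply: (@le_trans _ _ (d%:R * C2 * `|h|)); last first.
    by rewrite ler_wpM2r// lerDr addr_ge0.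
  have lH := C1_with_lin H x.
  apply: (lin_bound (f := fun h => cutoff c x * Df (t, x) (0, h) + f (t, x) * Dcutoff c x h)).
    by move=> a u w; have := lH a u w.
  move=> i /=; rewrite (le_trans (ler_normD _ _))// lerD// normrM.
    by rewrite -[M2]mul1r ler_pM// hM2.
  by rewrite ler_pM// ?hM3// -fbE// hM0.
- move=> s t x; wlog st : s t / s <= t => [hw s01 t01|].
    have [st|/ltW ts] := leP s t; first exact: hw.
    by rewrite distrC [`|s - t|]distrC; exact: hw.
  move=> s01 t01; have [xr|xr] := leP `|x| (c + 1); last first.
    by rewrite cutoff0// !mul0r subrr normr0 mulr_ge0// !addr_ge0.
  rewrite -mulrBr normrM (@le_trans _ _ (1 * (M1 * `|s - t|)))//; last first.
    by rewrite mul1r ler_wpM2r// addrAC lerDr addr_ge0.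
  rewrite ler_pM// distrC [`|s - t|]distrC [`|t - s|]ger0_norm ?subr_ge0// mulrBr.
  have itv r : r \in `]s, t[ -> r \in `]0, 1[.
    move: s01 t01; rewrite !in_itv /= => /andP[s0 s1] /andP[t0 t1] /andP[sr rt].
    by rewrite (le_lt_trans s0 sr) (lt_le_trans rt t1).
  apply: (@norm_le_of_derive _ (fun r => fb (r, x)) (fun r => Df (r, x) (1, 0))
    (fun r => M1 * r) (fun=> M1)) => //.
  + apply: continuous_subspaceT => r.
    apply: (@continuous_compf _ _ _ fb (fun r => (r, x)) r (cf _)).
    exact: continuous_pairr.
  + by apply: continuous_subspaceT => r; apply: mulrl_continuous.
  + move=> r /itv r01; have := slab_C1_time x sf r01.
    apply: near_eq_is_derive; near=> r'; rewrite fbE//.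
    apply: subset_itv_oo_cc; near: r'; exact: near_in_itvoo.
  + by move=> r _; exact: is_derive_scale.
  + by move=> r /itv r01; apply: hM1 => //; exact: subset_itv_oo_cc.
Unshelve. all: by end_near. Qed.

End Truncation.

(** * Flow of the velocity field *)

Section LowerIntegral.
Context d (T : measurableType d) (R : realType).
Variable mu : {measure set T -> \bar R}.
Import HBNNSimple.

(* No measurability is required of f and g: the integral of a non-negative
   function is the supremum of the integrals of the simple functions below it. *)
Lemma ge0_le_integral_lower (D : set T) (f g : T -> \bar R) :
  (forall x, D x -> 0 <= f x)%E -> (forall x, D x -> f x <= g x)%E ->
  (\int[mu]_(x in D) f x <= \int[mu]_(x in D) g x)%E.
Proof.
move=> f0 fg; have g0 x : D x -> (0 <= g x)%E.
  by move=> Dx; apply: le_trans (f0 x Dx) (fg x Dx).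
rewrite !ge0_integralE//; apply: le_ereal_sup => _ [h hf <-]; exists h => // x.
apply: le_trans (hf x) _; rewrite !patchE; case: ifPn => // xD.
by apply: fg; rewrite inE in xD.
Qed.

End LowerIntegral.

Section TruncatedField.
Context {R : realType} {d : nat}.
Notation E := 'rV[R]_d.

Lemma is_derive_segment (x y : E) (s : R) :
  is_derive s 1 (fun s => y + s *: (x - y)) (x - y).
Proof.
have h := C1_withD (C1_with_cst (y : E)) (C1_withZl (x - y) (@C1_with_id R R)).
have := @is_derive_diff _ _ _ _ _ _ (1 : R) (h.1 s).
by rewrite add0r scale1r.
Qed.

Lemma C1_lipschitz {n} (g : E -> 'rV[R]_n) Dg (C : R) : C1_with g Dg ->
  (forall x h, `|Dg x h| <= C * `|h|) -> forall x y, `|g x - g y| <= C * `|x - y|.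
Proof.
move=> [dg _] gC x y.
have dgp (s : R) : is_derive s 1 (fun s => g (y + s *: (x - y)))
    (Dg (y + s *: (x - y)) (x - y)).
  exact: (is_diff_path (is_derive_segment x y s) (dg _)).
have dl (s : R) : is_derive s 1 (fun s : R => C * `|x - y| * s) (C * `|x - y|).
  exact: is_derive_scale.
have := rV_norm_le_of_derive ler01 (fun s _ => dgp s) (fun s _ => dl s).
rewrite scale1r scale0r addr0 mulr0 subr0 mulr1 [y + (x - y)]addrC subrK; apply.
by move=> s _; exact: gC.
Qed.

(** The domination [|w| <= |fb|] holds everywhere, so that the supremum of [|w_t|] is controlled by
    that of [|v_t|] whatever the radius. The bounded support of [w] keeps the support of an Euler
    step bounded. *)
Definition truncated (V : normedModType R) (fb w : R * E -> V) (rho C : R) :=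
  [/\ forall (t : R) x, t \in `[0, 1] -> `|w (t, x)| <= C,
      forall t : R, t \in `]0, 1[ -> exists2 Dg, C1_with (fun x => w (t, x)) Dg &
        forall x h, `|Dg x h| <= C * `|h|,
      forall (s t : R) x, s \in `[0, 1] -> t \in `[0, 1] ->
        `|w (s, x) - w (t, x)| <= C * `|s - t|,
      forall (t : R) x, `|x| <= rho -> w (t, x) = fb (t, x) &
      (forall (t : R) x, `|w (t, x)| <= `|fb (t, x)|) /\
      exists r, forall (t : R) x, r < `|x| -> w (t, x) = 0].

Lemma truncated_le (V : normedModType R) (fb w : R * E -> V) (rho C C' : R) :
  C <= C' -> truncated fb w rho C -> truncated fb w rho C'.
Proof.
move=> CC [h1 h2 h3 h4 h5]; split=> //.
- by move=> t x t01; apply: le_trans CC; exact: h1.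
- move=> t /h2[Dg cg gC]; exists Dg => // x h; apply: le_trans (gC x h) _.
  by rewrite ler_wpM2r.
- by move=> s t x s01 t01; apply: le_trans (h3 s t x s01 t01) _; rewrite ler_wpM2r.
Qed.

Lemma truncated_scalar (f fb : R * E -> R) Df (rho : R) : slab_C1 f fb Df ->
  exists w C, [/\ 0 <= C, continuous w & truncated fb w rho C].
Proof.
move=> sf; have [cf _ _ _] := sf.
pose c := d%:R * rho ^+ 2 + 1.
have [C C0 [h1 h2 h3]] := truncation c sf.
exists (fun p => cutoff c p.2 * fb p), C; split=> //.
  move=> p; apply: continuousM (cf p).
  apply: (@continuous_compf _ _ _ (cutoff c) snd p _ cvg_snd).
  exact: (C1_with_continuous (C1_with_cutoff c)).
split.
- by move=> t x _; exact: h1.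
- by move=> t /h2[Dg cg gC]; exists Dg.
- exact: h3.
- move=> t x xr; rewrite cutoff1 ?mul1r// lerD2r ler_wpM2l//.
  by rewrite lerXn2r// nnegrE// (le_trans _ xr).
- split=> [t x|].
    have /andP[a b] := cutoff01 c x.
    by rewrite normrM ger0_norm// ler_piMl.
  by exists (c + 1) => t x xc; rewrite cutoff0// mul0r.
Qed.

Lemma truncated_rV {n} (f fb : R * E -> 'rV[R]_n) (Df : R * E -> R * E -> 'rV[R]_n) (rho : R) :
  slab_C1 f fb Df -> exists w C, [/\ 0 <= C, continuous w & truncated fb w rho C].
Proof.
move=> sf.
have H i := truncated_scalar rho (slab_C1_coord 0 i sf).
pose wi i := sval (cid (H i)); pose Ci i := sval (cid (svalP (cid (H i)))).
have wC i : [/\ 0 <= Ci i, continuous (wi i) & truncated (fun p => fb p 0 i) (wi i) rho (Ci i)].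
  exact: (svalP (cid (svalP (cid (H i))))).
pose w p : 'rV[R]_n := \row_i wi i p.
pose C := \sum_i Ci i.
have C0 : 0 <= C by apply: sumr_ge0 => i _; have [] := wC i.
have CC i : Ci i <= C.
  by rewrite /C (bigD1 i)//= lerDl; apply: sumr_ge0 => j _; have [] := wC j.
have T i := truncated_le (CC i) (let: And3 _ _ t := wC i in t).
exists w, C; split=> //.
  move=> p; have cw : {for p, continuous (fun q => \sum_i wi i q *: evec i)}.
    apply: continuous_bigsum => i; apply: cvgZr_tmp.
    by have [_ cwi _] := wC i; exact: cwi.
  rewrite (_ : w = fun q => \sum_i wi i q *: evec i)//.
  apply/funext => q; rewrite [LHS]row_sum_delta; apply: eq_bigr => i _.
  by rewrite mxE.
have wE p i : w p 0 i = wi i p by rewrite mxE.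
split.
- move=> t x t01; apply: rV_norm_le => // i; rewrite wE.
  by have [h _ _ _ _] := T i; exact: h.
- move=> t t01.
  have D i : exists Dg, C1_with (fun x => wi i (t, x)) Dg /\
      forall x h, `|Dg x h| <= C * `|h|.
    by have [_ h _ _ _] := T i; have [Dg ? ?] := h t t01; exists Dg.
  exists (fun x h => \row_i sval (cid (D i)) x h).
    apply: C1_with_row => i; have [cD _] := svalP (cid (D i)).
    by apply: C1_with_ext cD => [x|x h]; rewrite mxE.
  move=> x h; apply: rV_norm_le; first by rewrite mulr_ge0.
  by move=> i; rewrite mxE; have [_] := svalP (cid (D i)); apply.
- move=> s t x s01 t01; apply: rV_norm_le; first by rewrite mulr_ge0.
  by move=> i; rewrite coordB !wE; have [_ _ h _ _] := T i; exact: h.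
- move=> t x xr; apply/rowP => i; rewrite wE.
  by have [_ _ _ h _] := T i; exact: h.
- split=> [t x|].
    apply: rV_norm_le => // i; rewrite wE; have [_ _ _ _ [h _]] := T i.
    by apply: le_trans (h t x) _; exact: coord_le_norm.
  have r i : exists r, forall (t : R) x, r < `|x| -> wi i (t, x) = 0.
    by have [_ _ _ _ []] := T i.
  exists (\sum_i `|sval (cid (r i))|) => t x xr; apply/rowP => i; rewrite wE mxE.
  apply: (svalP (cid (r i))); apply: le_lt_trans xr.
  rewrite (le_trans (ler_norm _))// (bigD1 i)//= lerDl; exact: sumr_ge0.
Qed.

(** At [t = 0] and [t = 1] no spatial derivative is available. The estimate is proved at an interior
    time [s] close to [t] and carried back by the Lipschitz bound in time, at an arbitrarily small
    cost. *)
Lemma truncated_lipschitz {n} (fb w : R * E -> 'rV[R]_n) rho C (t : R) x y : 0 <= C ->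
  truncated fb w rho C -> t \in `[0, 1] -> `|w (t, x) - w (t, y)| <= C * `|x - y|.
Proof.
move=> C0 [_ h2 h3 _ _] t01; apply/ler_addgt0Pr => e e0.
have [t0 t1] := itv01_bounds t01.
pose r := Num.min 1 (e / (1 + C)).
have C1 : 0 < 1 + C by rewrite ltr_wpDr.
have r0 : 0 < r by rewrite lt_min ltr01 divr_gt0.
have r1 : r <= 1 by rewrite ge_min lexx.
have rC : C * r <= e.
  have : r <= e / (1 + C) by rewrite ge_min lexx orbT.
  by rewrite ler_pdivlMr// mulrDr mulr1 [r * C]mulrC => h; rewrite (le_trans _ h)// lerDr ltW.
(* Moving [t] towards the midpoint lands in []0, 1[]. The displacement is at most [r / 2], and
   [C r <= e] leaves [e / 2] for each of [x] and [y]. *)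
pose s := t + r * (2^-1 - t).
have s01 : s \in `]0, 1[ by rewrite in_itv /= /s; apply/andP; split; nra.
have st : `|t - s| <= r / 2.
  have -> : t - s = - (r * (2^-1 - t)) by rewrite /s; ring.
  rewrite normrN normrM gtr0_norm// ler_pM2l//.
  by rewrite ler_norml; apply/andP; split; lra.
have [Dg cg gC] := h2 s s01.
have s01' : s \in `[0, 1] by exact: subset_itv_oo_cc.
have l1 := h3 t s x t01 s01'; have l2 := h3 t s y t01 s01'.
have l3 := C1_lipschitz cg gC x y.
have l4 : C * `|t - s| <= e / 2.
  by rewrite (le_trans (ler_wpM2l C0 st))// mulrA ler_pM2r.
have -> : w (t, x) - w (t, y) = (w (t, x) - w (s, x)) + (w (s, x) - w (s, y)) -
    (w (t, y) - w (s, y)).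
  by rewrite addrA subrK opprB [_ + (w (s, y) - _)]addrA subrK.
rewrite (le_trans (ler_normB _ _))//.
have := ler_normD (w (t, x) - w (s, x)) (w (s, x) - w (s, y)).
by lra.
Qed.

End TruncatedField.

Section Flow.
Context {R : realType} {d : nat}.
Notation E := 'rV[R]_d.
Variables (v : R * E -> E) (vb : R * E -> E) (Dv : R * E -> R * E -> E).
Hypothesis v_C1 : slab_C1 v vb Dv.
Variable (M : R).
Hypothesis M_ge0 : 0 <= M.
Hypothesis vM : (\int[lebR R]_(t in `[0%R, 1%R]) W1oo_norm (fun x => v (t, x)) <= M%:E)%E.

(** The supremum [g] over space of a truncated field inherits its Lipschitz bound in time, hence is
    continuous and has a primitive [G]. Since [|w| <= |vb|], the increase of [G] over [[0, 1]] is at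
    most the integral of the W^{1,oo} norm, which does not depend on the truncation. *)
Lemma displacement_majorant w rho C : 0 <= C -> truncated vb w rho C ->
  exists G g : R -> R, [/\
    forall t : R, t \in `[0, 1] -> is_derive t 1 G (g t),
    forall (t : R) x, t \in `[0, 1] -> `|w (t, x)| <= g t,
    forall s t : R, s \in `[0, 1] -> t \in `[0, 1] -> `|g s - g t| <= C * `|s - t| &
    G 1 - G 0 <= M].
Proof.
move=> C0 [h1 h2 h3 h4 [h5 _]].
pose S t := [set `|w (clamp01 t, x)| | x in [set: E]].
have ubS t : ubound (S t) C by move=> _ [x _ <-]; apply: h1; exact: clamp01_in.
have neS t : S t !=set0 by exists `|w (clamp01 t, 0)|; exists 0.
pose g t := sup (S t).
have wg t x : `|w (clamp01 t, x)| <= g t.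
  by apply: ub_le_sup; [exists C|exists x].
have gl s t : g s <= g t + C * `|clamp01 s - clamp01 t|.
  apply: ge_sup => // _ [x _ <-].
  have := h3 _ _ x (clamp01_in s) (clamp01_in t); have := wg t x.
  have := ler_normD (w (clamp01 t, x)) (w (clamp01 s, x) - w (clamp01 t, x)).
  by rewrite addrC subrK; lra.
have gC s t : `|g s - g t| <= C * `|clamp01 s - clamp01 t|.
  rewrite ler_norml; have := gl s t; have := gl t s.
  by rewrite [`|clamp01 t - _|]distrC => a b; apply/andP; split; lra.
have cg : continuous g.
  move=> t; apply/cvgrPdist_le => e e0.
  have C1 : 0 < C + 1 by rewrite ltr_wpDl.
  have /cvgrPdist_le/(_ _ (divr_gt0 e0 C1)) := @continuous_clamp01 R t.
  apply: filterS => s; rewrite ler_pdivlMr// mulrC => h.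
  apply: le_trans (gC _ _) (le_trans _ h).
  by rewrite ler_wpM2r// lerDl.
have [G G0 dG] := continuous_primitive cg.
exists G, g; split=> //.
- by move=> t x t01; have := wg t x; rewrite clamp01_id.
- by move=> s t s01 t01; have := gC s t; rewrite !clamp01_id.
have cG := within_continuous_derive dG.
have dGo : derivable_oo_LRcontinuous G 0 1.
  have /(continuous_within_itvP _ ltr01)[_ l r] := cG; split=> //.
  by move=> t t01; have [] := dG t (subset_itv_oo_cc t01).
have G'g : {in `]0, 1[, derive1 G =1 g}.
  by move=> t t01; rewrite derive1E; have [_ ->] := dG t (subset_itv_oo_cc t01).
have e := continuous_FTC2 ltr01 (continuous_subspaceT cg) dGo G'g.
rewrite -lee_fin EFinB -e; apply: le_trans vM; apply: ge0_le_integral_lower.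
  by move=> t t01; rewrite lee_fin; apply: le_trans (wg t 0).
move=> t t01; rewrite /W1oo_norm.
set A := ereal_sup _; set B := ereal_sup _.
have B0 : (0 <= B)%E.
  by apply: ereal_sup_ge; exists (`|'J (fun x => v (t, x)) 0|)%:E; [exists 0|rewrite lee_fin].
have Aw x : ((`|w (t, x)|)%:E <= A)%E.
  apply: (@le_trans _ _ (`|v (t, x)|)%:E); last by apply: ereal_sup_ubound; exists x.
  have [_ vE _ _] := v_C1; rewrite lee_fin (le_trans (h5 t x))// vE clamp01_id//.
apply: (@le_trans _ _ A); last by rewrite leeDl.
case: A Aw => [a| |] Aw; rewrite ?leey//.
  rewrite lee_fin; apply: ge_sup => // _ [x _ <-].
  by rewrite clamp01_id//; have := Aw x; rewrite lee_fin.
by have := Aw 0; rewrite leeNy_eq.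
Qed.

Lemma majorant_le (G g : R -> R) (s t : R) :
  (forall t : R, t \in `[0, 1] -> is_derive t 1 G (g t)) ->
  (forall t : R, t \in `[0, 1] -> 0 <= g t) ->
  s \in `[0, 1] -> t \in `[0, 1] -> s <= t -> G s <= G t.
Proof.
move=> dG g0; rewrite !in_itv /= => /andP[s0 s1] /andP[t0 t1] st.
have sub (r : R) : r \in `[s, t] -> r \in `[0, 1].
  by rewrite !in_itv /= => /andP[sr rt]; rewrite (le_trans s0 sr) (le_trans rt t1).
have dG' (r : R) : r \in `[s, t] -> is_derive r 1 G (g r) by move=> /sub /dG.
apply: (le_of_derive st (within_continuous_derive dG')
  (fun r h => dG' r (subset_itv_oo_cc h))).
by move=> r /subset_itv_oo_cc /sub /g0.
Qed.

(** Trajectories of every truncation move by at most the same [M], so a truncation radius can be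
    fixed before the trajectory is known. *)
Lemma displacement (Y : R -> E) (x : E) w rho C : 0 <= C -> truncated vb w rho C ->
  Y 0 = x -> (forall t : R, t \in `[0, 1] -> is_derive t 1 Y (w (t, Y t))) ->
  forall t : R, t \in `[0, 1] -> `|Y t - x| <= M.
Proof.
move=> C0 tw <- dY t t01.
have [G [g [dG wg _ GM]]] := displacement_majorant C0 tw.
have g0 (s : R) : s \in `[0, 1] -> 0 <= g s.
  by move=> s01; apply: le_trans (wg s 0 s01).
have [t0 t1] := itv01_bounds t01.
have sub := sub_itv01 t01.
have := rV_norm_le_of_derive t0 (fun s h => dY s (sub s h)) (fun s h => dG s (sub s h)).
move=> /(_ (fun s h => wg s _ (sub s h))) /le_trans; apply; apply: le_trans GM.
rewrite lerD2r; apply: majorant_le dG g0 t01 _ t1.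
by rewrite in_itv /= ler01 lexx.
Qed.

(** For the trajectory from [x] the field is truncated at radius [|x| + M]; the trajectory never
    leaves this ball and so solves the original equation. For the Lipschitz estimate, all
    trajectories from the ball of radius [rho] share the truncation at [rho + M], to which Gronwall
    applies. *)
Theorem flow_exists : exists X : R -> E -> E, [/\
  forall x, X 0 x = x,
  forall (t : R) x, t \in `[0, 1] -> is_derive t 1 (X^~ x) (vb (t, X t x)),
  forall (t : R) x, t \in `[0, 1] -> `|X t x - x| <= M &
  forall rho, exists2 K, 0 <= K & forall (t : R) x y, t \in `[0, 1] ->
    `|x| <= rho -> `|y| <= rho -> `|X t x - X t y| <= K * `|x - y|].
Proof.
have H x : {Y : R -> E | [/\ Y 0 = x,
    forall t : R, t \in `[0, 1] -> is_derive t 1 Y (vb (t, Y t)) &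
    forall t : R, t \in `[0, 1] -> `|Y t - x| <= M]}.
  apply: cid.
  have [w [C [C0 cw tw]]] := truncated_rV (`|x| + M) v_C1.
  have cw' : continuous (fun p : R * E => w (p.1, p.2)).
    by rewrite (_ : (fun _ => _) = w)//; apply/funext => -[].
  have [Y Y0 dY] := @picard_lindelof _ _ (fun t y => w (t, y)) C cw' C0
    (fun t y z h => truncated_lipschitz y z C0 tw h) x.
  have dM := displacement C0 tw Y0 dY.
  exists Y; split=> // t t01; have [_ _ _ h4 _] := tw; rewrite -h4; first exact: dY.
  rewrite -[Y t](subrK x) (le_trans (ler_normD _ _))// addrC lerD2l; exact: dM.
pose X t x := sval (H x) t.
have X0 x : X 0 x = x by have [] := svalP (H x).
have dX (t : R) x : t \in `[0, 1] -> is_derive t 1 (X^~ x) (vb (t, X t x)).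
  by move=> t01; have [_ h _] := svalP (H x); exact: h.
have XM (t : R) x : t \in `[0, 1] -> `|X t x - x| <= M.
  by have [_ _ h] := svalP (H x); exact: h.
exists X; split=> // rho.
have [w [C [C0 cw tw]]] := truncated_rV (rho + M) v_C1.
exists (Num.sqrt (d%:R * expR (2 * d%:R * C))); first exact: sqrtr_ge0.
move=> t x y t01 xr yr.
have ball (s : R) z : s \in `[0, 1] -> `|z| <= rho -> vb (s, X s z) = w (s, X s z).
  move=> s01 zr; have [_ _ _ h4 _] := tw; rewrite h4//.
  by rewrite -[X s z](subrK z) (le_trans (ler_normD _ _))// addrC lerD// XM.
have := gronwall C0 (fun s h => dX s x h) (fun s h => dX s y h).
move=> /(_ _ t t01); rewrite !X0 => h.
have h0 : 0 <= Num.sqrt (d%:R * expR (2 * d%:R * C)) * `|x - y|.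
  by rewrite mulr_ge0 ?sqrtr_ge0.
rewrite -(@ler_pXn2r _ 2)// ?nnegrE//.
rewrite exprMn sqr_sqrtr; last by rewrite mulr_ge0 ?expR_ge0.
apply: h => s s01; rewrite !ball//; exact: truncated_lipschitz tw s01.
Qed.

End Flow.

(** * The weak continuity equation *)

Section FiniteMeasureIntegrals.
Context {R : realType} {T : ptopologicalType}.
Implicit Types (m : {finite_measure set (borel T) -> \bar R}) (f : T -> R).

Lemma integrable_bounded_continuous m f (K : R) : continuous f ->
  (forall x, `|f x| <= K) -> m.-integrable setT (EFin \o (f : borel T -> R)).
Proof.
move=> cf fK; apply: measurable_bounded_integrable => //.
- by rewrite -ge0_fin_numE// fin_num_measure.
- exact: continuous_borel_R.
- exists K; split; first exact: num_real.
  by move=> r Kr x _ /=; apply: le_trans (fK x) (ltW Kr).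
Qed.

Lemma Rintegral_bound m f (K : R) : continuous f -> (forall x, `|f x| <= K) ->
  `|\int[m]_x f x| <= K * fine (m setT).
Proof.
move=> cf fK; have i := integrable_bounded_continuous m cf fK.
apply: le_trans (le_normr_Rintegral _ i) _ => //.
rewrite -Rintegral_cst//; apply: le_Rintegral => //.
- apply: (@integrable_bounded_continuous m (fun x => `|f x|) K).
    by move=> x; apply: cvg_norm; exact: cf.
  by move=> x; rewrite normr_id.
- apply: (@integrable_bounded_continuous m (fun=> K) `|K|) => //.
  by move=> x; exact: cst_continuous.
Qed.

End FiniteMeasureIntegrals.

Section UnitInterval.
Context {R : realType}.

Lemma integral_primitive01 (y F : R -> R) : continuous y ->
  (forall t : R, t \in `[0, 1] -> is_derive t 1 F (y t)) ->
  (\int[lebR R]_(t in `[0%R, 1%R]) (y t)%:E = (F 1 - F 0)%:E)%E.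
Proof.
move=> cy dF; have cF := within_continuous_derive dF.
have dFo : derivable_oo_LRcontinuous F 0 1.
  have /(continuous_within_itvP _ ltr01)[_ l r] := cF; split=> //.
  by move=> t t01; have [] := dF t (subset_itv_oo_cc t01).
have F'y : {in `]0, 1[, derive1 F =1 y}.
  by move=> t t01; rewrite derive1E; have [_ ->] := dF t (subset_itv_oo_cc t01).
by rewrite (continuous_FTC2 ltr01 (continuous_subspaceT cy) dFo F'y) EFinB.
Qed.

Lemma interior_near (t e : R) : t \in `[0, 1] -> 0 < e ->
  exists2 s : R, s \in `]0, 1[ & `|t - s| < e.
Proof.
move=> t01 e0; have [t0 t1] := itv01_bounds t01.
pose r := Num.min 1 e.
have r0 : 0 < r by rewrite lt_min ltr01.
have r1 : r <= 1 by rewrite ge_min lexx.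
have re : r <= e by rewrite ge_min lexx orbT.
exists (t + r * (2^-1 - t)); first by rewrite in_itv /=; apply/andP; split; nra.
have -> : t - (t + r * (2^-1 - t)) = - (r * (2^-1 - t)) by ring.
rewrite normrN normrM gtr0_norm// (@le_lt_trans _ _ (r * 2^-1))//; last by lra.
by rewrite ler_pM2l// ler_norml; apply/andP; split; lra.
Qed.

Lemma continuous_eq_interior (H : R -> R) (c : R) : continuous H ->
  (forall t : R, t \in `]0, 1[ -> H t = c) -> forall t : R, t \in `[0, 1] -> H t = c.
Proof.
move=> cH Hc t t01; apply/eqP; rewrite -subr_eq0 -normr_le0; apply/ler_addgt0Pr => e e0.
have /cvgrPdist_le/(_ _ e0) := cH t; rewrite add0r => /nbhs_ballP[r /= r0 h].
have [s s01 st] := interior_near t01 r0.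
by rewrite -(Hc s s01); apply: h; rewrite -ball_normE.
Qed.

(* du Bois-Reymond: testing against a smoothed indicator of [a, b]. *)
Lemma du_bois_reymond (H : R -> R) : continuous H ->
  (forall (eta eta' Z : R -> R) (c1 c2 : R), 0 < c1 -> c2 < 1 ->
    (forall t : R, is_derive t 1 eta (eta' t)) -> continuous eta' ->
    (forall t, t < c1 \/ c2 < t -> eta t = 0) ->
    (forall t : R, t \in `[0, 1] -> is_derive t 1 Z (eta' t * H t)) -> Z 1 = Z 0) ->
  forall a b : R, a \in `]0, 1[ -> b \in `]0, 1[ -> H a = H b.
Proof.
move=> cH tst.
suff main (a b : R) : a \in `]0, 1[ -> b \in `]0, 1[ -> a < b -> H a = H b.
  move=> a b a01 b01; have [ab|ba|->] := ltgtP a b => //; first exact: main.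
  by apply/esym; exact: main.
move=> a01 b01 ab; apply/eqP; rewrite -subr_eq0 -normr_le0; apply/ler_addgt0Pr => e e0.
have e20 : 0 < e / 2 by rewrite divr_gt0.
have [a0 a1] : 0 < a /\ a < 1 by move: a01; rewrite in_itv /= => /andP.
have [b0 b1] : 0 < b /\ b < 1 by move: b01; rewrite in_itv /= => /andP.
have /cvgrPdist_le/(_ _ e20)/nbhs_ballP[ra /= ra0 ha] := cH a.
have /cvgrPdist_le/(_ _ e20)/nbhs_ballP[rb /= rb0 hb] := cH b.
(* The windows [[a, a + dl]] and [[b, b + dl]] lie inside []0, 1[], and on each [H] stays within
   [e / 2] of its value at the left end. *)
pose dl := Num.min (Num.min ra rb) (1 - b) / 2.
have dl0 : 0 < dl by rewrite divr_gt0// !lt_min ra0 rb0 subr_gt0.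
have dlra : dl < ra.
  have : Num.min (Num.min ra rb) (1 - b) <= ra by rewrite !ge_min lexx.
  by move: dl0; rewrite /dl; lra.
have dlrb : dl < rb.
  have : Num.min (Num.min ra rb) (1 - b) <= rb by rewrite !ge_min lexx orbT.
  by move: dl0; rewrite /dl; lra.
have dlb : b + dl < 1.
  have : Num.min (Num.min ra rb) (1 - b) <= 1 - b by rewrite !ge_min lexx !orbT.
  by move: dl0; rewrite /dl; lra.
pose S (c t : R) : R := smoothstep ((t - c) / dl).
pose S' (c t : R) : R := smoothstep' ((t - c) / dl) / dl.
have dlin (c t : R) : is_derive t 1 (fun t => (t - c) / dl) dl^-1.
  have -> : (fun t => (t - c) / dl) = (fun t => dl^-1 *: (t - c)).
    by apply/funext => s; rewrite /GRing.scale /= mulrC.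
  apply: is_derive_eq (is_deriveZ _ (is_deriveB (is_derive_id _ _) (is_derive_cst c t 1))) _.
  by rewrite subr0 /GRing.scale /= mulr1.
have dS c (t : R) : is_derive t 1 (S c) (S' c t).
  have := is_diff_path (dlin c t) (is_diff_derive (is_derive_smoothstep ((t - c) / dl))).
  by rewrite [S' c t](_ : _ = dl^-1 * smoothstep' ((t - c) / dl))// /S' mulrC.
have cS' c : continuous (S' c).
  move=> t; apply: (@continuousM _ _ (fun t => smoothstep' ((t - c) / dl)) (fun=> dl^-1)).
    have cl : {for t, continuous (fun t => (t - c) / dl)}.
      by apply: differentiable_continuous; apply/derivable1_diffP; have [] := dlin c t.
    exact: (continuous_compf (@continuous_smoothstep' R _) cl).
  exact: cst_continuous.
have S'0 c t : 0 <= S' c t by rewrite divr_ge0 ?smoothstep'_ge0// ltW.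
have S0 c t : t <= c -> S c t = 0.
  by move=> tc; rewrite /S smoothstep0// pmulr_lle0 ?invr_gt0// subr_le0.
have S1 c t : c + dl <= t -> S c t = 1.
  by move=> tc; rewrite /S smoothstep1// ler_pdivlMr// mul1r lerBrDl.
have S'out c t : t <= c \/ c + dl <= t -> S' c t = 0.
  move=> [tc|tc]; rewrite /S' smoothstep'_eq0 ?mul0r//.
    by left; rewrite pmulr_lle0 ?invr_gt0// subr_le0.
  by right; rewrite ler_pdivlMr// mul1r lerBrDl.
(* [S' c] is a density of total mass 1 on [[c, c + dl]], so the increment of a primitive [Q] of
   [S' c * H] is an average of [H] over this window. *)
have avg (c : R) (Q : R -> R) : 0 < c -> c + dl < 1 ->
    (forall t, `|c - t| <= dl -> `|H c - H t| <= e / 2) ->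
    (forall t : R, t \in `[0, 1] -> is_derive t 1 Q (S' c t * H t)) ->
    `|Q 1 - Q 0 - H c| <= e / 2.
  move=> c0 c1 hc dQ.
  have dS01 (t : R) : t \in `[0, 1] -> is_derive t 1 (fun t => (e / 2) * S c t) ((e / 2) * S' c t).
    by move=> _; have ? := dS c t; apply: is_deriveZ.
  have dQS (t : R) : t \in `[0, 1] ->
      is_derive t 1 (fun t => Q t - H c * S c t) (S' c t * (H t - H c)).
    move=> t01; have d1 := dQ t t01; have d2 := is_deriveZ (H c) (dS c t).
    by apply: is_derive_eq (is_deriveB d1 d2) _; rewrite /GRing.scale /=; ring.
  have := norm_le_of_derive ler01 (within_continuous_derive dQS)
    (within_continuous_derive dS01) (fun t h => dQS t (subset_itv_oo_cc h))
    (fun t h => dS01 t (subset_itv_oo_cc h)).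
  rewrite (S1 c 1 (ltW c1)) (S0 c 0 (ltW c0)) !mulr1 !mulr0 !subr0.
  have -> : Q 1 - H c - Q 0 = Q 1 - Q 0 - H c by ring.
  apply=> t _; rewrite normrM ger0_norm// mulrC.
  have [tc|ct] := leP t c; first by rewrite S'out ?mulr0//; left.
  have [tc'|ct'] := leP (c + dl) t; first by rewrite S'out ?mulr0//; right.
  rewrite ler_wpM2r// distrC; apply: hc.
  by rewrite distrC ger0_norm ?subr_ge0 ltW// ltrBlDl.
pose eta t := S a t - S b t.
pose eta' t := S' a t - S' b t.
have prim c : exists2 Q : R -> R, Q 0 = 0 &
    forall t : R, t \in `[0, 1] -> is_derive t 1 Q (S' c t * H t).
  by apply: continuous_primitive => t; apply: continuousM; [exact: cS'|exact: cH].
have [Qa _ dQa] := prim a; have [Qb _ dQb] := prim b.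
have eZ : Qa 1 - Qb 1 = Qa 0 - Qb 0.
  apply: (tst eta eta' (fun t => Qa t - Qb t) a (b + dl) a0 dlb).
  - by move=> t; rewrite /eta'; apply: continuousB; exact: cS'.
  - move=> t [ta|tb]; rewrite /eta.
      by rewrite !S0 ?subrr ?ltW// (lt_trans ta).
    rewrite !S1 ?subrr// ltW// (le_lt_trans _ tb)// lerD2r ltW//.
  - move=> t t01; apply: is_derive_eq (is_deriveB (dQa t t01) (dQb t t01)) _.
    by rewrite /eta'; ring.
have A1 := avg a Qa a0 (lt_trans (ltr_leD ab (lexx dl)) dlb) _ dQa.
have A2 := avg b Qb b0 dlb _ dQb.
have {}A1 : `|Qa 1 - Qa 0 - H a| <= e / 2.
  by apply: A1 => t th; apply: ha; rewrite -ball_normE /ball_ /= (le_lt_trans th).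
have {}A2 : `|Qb 1 - Qb 0 - H b| <= e / 2.
  by apply: A2 => t th; apply: hb; rewrite -ball_normE /ball_ /= (le_lt_trans th).
have -> : H a - H b = (Qb 1 - Qb 0 - H b) - (Qa 1 - Qa 0 - H a).
  have -> : Qa 1 = Qa 0 - Qb 0 + Qb 1 by rewrite -eZ; ring.
  by ring.
by rewrite (le_trans (ler_normB _ _))//; lra.
Qed.

End UnitInterval.

Section NarrowContinuity.
Context {R : realType} {d : nat}.
Notation E := 'rV[R]_d.
Variable mu : R -> {finite_measure set (borel E) -> \bar R}.
Hypothesis mu_narrow : narrowly_continuous mu.

(** The total mass is the integral of the bounded continuous function 1, hence continuous on a
    compact interval. *)
Lemma mass_bound : exists2 m, 0 <= m &
  forall t : R, t \in `[0, 1] -> fine (mu t setT) <= m.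
Proof.
have c1 : continuous (fun _ : E => 1 : R) by move=> x; exact: cst_continuous.
have b1 : [bounded (1 : R) | x in [set: E]] by exact: bounded_cst.
have [c c01 cM] := EVT_max ler01 (mu_narrow c1 b1).
exists (fine (mu c setT)) => [|t t01]; first exact: fine_ge0.
by have := cM t t01; rewrite !Rintegral_cst// !mul1r.
Qed.

Variables (g : R * E -> R) (r : R).
Hypothesis g_cont : continuous g.
Hypothesis g_supp : forall (t : R) x, r < `|x| -> g (t, x) = 0.

Lemma section_continuous (t : R) : continuous (fun x => g (t, x)).
Proof.
move=> x; apply: (@continuous_compf _ _ _ g (fun x : E => (t, x)) x (@g_cont _)).
exact: continuous_pairl.
Qed.

Lemma supported_bound : exists2 K, 0 <= K &
  forall (t : R) x, t \in `[0, 1] -> `|g (t, x)| <= K.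
Proof.
have [K K0 hK] := cylinder_bound r g_cont; exists K => // t x t01.
have [xr|xr] := leP `|x| r; first exact: hK.
by rewrite g_supp// normr0.
Qed.

(** Measure and integrand move together. Narrow continuity handles the integrand frozen at [t]; the
    change of integrand is uniformly small on the ball [|x| <= r] by compactness, vanishes outside
    it, and is integrated against uniformly bounded masses. *)
Lemma continuous_integral :
  continuous (fun t => \int[mu (clamp01 t)]_x g (clamp01 t, x)).
Proof.
move=> t; apply/cvgrPdist_lt => e e0.
have [m m0 hm] := mass_bound.
have [K K0 hK] := supported_bound.
have m1 : 0 < 2 * (m + 1) by rewrite mulr_gt0// ltr_wpDl.
pose e' := e / (2 * (m + 1)).
have e'0 : 0 < e' by rewrite divr_gt0.
have cf0 := @section_continuous (clamp01 t).
have bf0 : [bounded g (clamp01 t, x) | x in [set: E]].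
  exists K; split; first exact: num_real.
  by move=> k Kk x _ /=; apply: le_trans (hK _ _ (clamp01_in t)) (ltW Kk).
have cI := continuous_comp_within (mu_narrow cf0 bf0) (@continuous_clamp01 R) (@clamp01_in R).
have e20 : 0 < e / 2 by rewrite divr_gt0.
have /cvgrPdist_lt/(_ _ e20) := cI t; rewrite /comp => H1.
pose P (s : R) (x : E) := `|g (clamp01 t, x) - g (clamp01 s, x)| < e'.
have H2 : \forall s \near t, [set x : E | `|x| <= r] `<=` P s.
  apply: ((compact_near_coveringP _).1 (@compact_ball_rV R d r) R (nbhs t) P).
  move=> x _.
  have ch : continuous (fun p : E * R => g (clamp01 t, p.1) - g (clamp01 p.2, p.1)).
    move=> p; apply: continuousB.
      exact: (@continuous_compf _ _ _ (fun x => g (clamp01 t, x)) fst p (cf0 _) cvg_fst).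
    apply: (@continuous_compf _ _ _ g (fun p : E * R => (clamp01 p.2, p.1)) p (@g_cont _)).
    apply: (@continuous_pair _ _ _ (fun p : E * R => clamp01 p.2) fst p _ cvg_fst).
    exact: (@continuous_compf _ _ _ (@clamp01 R) snd p (@continuous_clamp01 R _) cvg_snd).
  have /cvgrPdist_lt/(_ _ e'0) := ch (x, t); rewrite /= subrr => H.
  have {}H : \forall p \near (x, t), P p.2 p.1.
    by apply: filterS H => p /=; rewrite sub0r normrN.
  exact: H.
near=> s.
have h1 : `|\int[mu (clamp01 t)]_x g (clamp01 t, x) - \int[mu (clamp01 s)]_x g (clamp01 t, x)| < e / 2.
  by near: s; exact: H1.
have h2 : [set x : E | `|x| <= r] `<=` P s by near: s; exact: H2.
have cfs := @section_continuous (clamp01 s).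
have it : (mu (clamp01 s)).-integrable setT (EFin \o (fun x : borel E => g (clamp01 t, x))).
  by apply: (integrable_bounded_continuous _ cf0) => x; apply: hK; exact: clamp01_in.
have is' : (mu (clamp01 s)).-integrable setT (EFin \o (fun x : borel E => g (clamp01 s, x))).
  by apply: (integrable_bounded_continuous _ cfs) => x; apply: hK; exact: clamp01_in.
have h3 : `|\int[mu (clamp01 s)]_x g (clamp01 t, x) - \int[mu (clamp01 s)]_x g (clamp01 s, x)| <= e / 2.
  rewrite -RintegralB//.
  have cB : continuous (fun x => g (clamp01 t, x) - g (clamp01 s, x)).
    by move=> x; apply: continuousB; [exact: cf0|exact: cfs].
  apply: le_trans (@Rintegral_bound _ _ (mu (clamp01 s)) _ e' cB _) _.
  - move=> x; have [xr|xr] := leP `|x| r; first exact/ltW/h2.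
    by rewrite !g_supp// subrr normr0 ltW.
  - apply: (@le_trans _ _ (e' * (m + 1))).
      rewrite ler_wpM2l ?(ltW e'0)//; have := hm _ (clamp01_in s); lra.
    rewrite /e' invfM mulrA -mulrA mulVf ?mulr1// gt_eqF//; lra.
rewrite -(subrKA (\int[mu (clamp01 s)]_x g (clamp01 t, x))).
rewrite (le_lt_trans (ler_normD _ _))//; lra.
Unshelve. all: by end_near. Qed.

End NarrowContinuity.

Section SpaceTimeC1.
Context {R : realType} {d : nat}.
Notation E := 'rV[R]_d.

Lemma C1_with_zero {V W : normedModType R} (f : V -> W) Df x h :
  C1_with f Df -> (\near x, f x = 0) -> Df x h = 0.
Proof.
move=> [df _] f0.
have d1 := near_eq_is_derive f0 (is_derive_diff h (df x)).
have [_ <-] := d1; exact: derive_cst.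
Qed.

Lemma C1_with_zero_far {W : normedModType R} (f : E -> W) Df (r : R) x h :
  C1_with f Df -> (forall y, r < `|y| -> f y = 0) -> r < `|x| -> Df x h = 0.
Proof.
move=> cf fr xr; apply: (C1_with_zero h cf).
have o : open [set y : E | r < `|y|].
  apply: (@open_comp _ _ (fun y : E => `|y|) [set z | r < z]) => [y _|].
    exact: norm_continuous.
  exact: open_gt.
by apply: filterS (open_nbhs_nbhs (conj o xr)) => y; exact: fr.
Qed.

Variables (phi : R * E -> R) (Dphi : R * E -> R * E -> R).
Hypothesis cphi : C1_with phi Dphi.

Lemma C1_time (t : R) x : is_derive t 1 (fun s => phi (s, x)) (Dphi (t, x) (1, 0)).
Proof. exact: is_derive_graph (is_derive_cst x t 1) (cphi.1 (t, x)). Qed.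

Lemma C1_section (t : R) : C1_with (fun x => phi (t, x)) (fun x h => Dphi (t, x) (0, h)).
Proof.
have [dD cD] := cphi; split=> [x|h x]; first exact: is_diff_section (dD (t, x)).
apply: (@continuous_compf _ _ _ (fun p => Dphi p (0, h)) (fun y : E => (t, y)) x (cD _ _)).
exact: continuous_pairl.
Qed.

Lemma C1_pairE p (s : R) (u : E) :
  Dphi p (s, u) = s * Dphi p (1, 0) + \sum_i u 0 i * Dphi p (0, evec i).
Proof.
have l := C1_with_lin cphi p.
have -> : (s, u) = s *: (1, 0) + (0, u) :> R * E.
  rewrite -[RHS]/(s *: (1 : R) + 0, s *: (0 : E) + u).
  by rewrite addr0 scaler0 add0r /GRing.scale /= mulr1.
rewrite l; congr (_ + _); case: p l => t x l.
exact: (diff_rV_sum (C1_section t) x u).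
Qed.

End SpaceTimeC1.

Section WeakEquation.
Context {R : realType} {d : nat}.
Notation E := 'rV[R]_d.
Variables (mu : R -> {finite_measure set (borel E) -> \bar R}).
Variables (v : R -> E -> E) (alpha : R -> E -> R).
Hypothesis mu_narrow : narrowly_continuous mu.
Hypothesis mu_eq : continuity_equation mu v alpha.
Let vb (p : R * E) := v (clamp01 p.1) p.2.
Let ab (p : R * E) := alpha (clamp01 p.1) p.2.
Hypothesis cvb : continuous vb.
Hypothesis cab : continuous ab.

(** The adjoint operator of the continuity equation applied to [phi]; its first term is the
    derivative of [phi] in the space-time direction of a trajectory. *)
Definition residual (vb : R * E -> E) (ab phi : R * E -> R) (Dphi : R * E -> R * E -> R)
    (p : R * E) : R :=
  Dphi p (1, vb p) + 4 * ab p * phi p.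

Lemma residual_continuous phi Dphi : C1_with phi Dphi ->
  continuous (residual vb ab phi Dphi).
Proof.
move=> cphi; have cf := C1_with_continuous cphi; have [_ cD] := cphi.
pose F (p : R * E) : R := \sum_i vb p 0 i * Dphi p (0, evec i).
have cF : continuous F.
  move=> p; apply: continuous_bigsum => i; apply: continuousM; last exact: cD.
  by apply: continuous_coord; exact: cvb.
have cL : continuous (fun p => 4 * ab p).
  by move=> p; have := continuousM (@cst_continuous _ _ (4 : R) p) (@cab p).
have cG : continuous (fun p => 4 * ab p * phi p).
  by move=> p; have := continuousM (cL p) (cf p).
have cH : continuous (fun p => Dphi p (1, 0) + F p).
  by move=> p; have := continuousD (cD (1, 0) p) (cF p).
have -> : residual vb ab phi Dphi = fun p => Dphi p (1, 0) + F p + 4 * ab p * phi p.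
  by apply/funext => p; rewrite /residual (C1_pairE cphi) mul1r.
by move=> p; have := continuousD (cH p) (cG p).
Qed.

Variables (phi : R * E -> R) (Dphi : R * E -> R * E -> R) (r : R).
Hypothesis cphi : C1_with phi Dphi.
Hypothesis phi_supp : forall (t : R) x, r < `|x| -> phi (t, x) = 0.

Let J t : R := \int[mu (clamp01 t)]_x phi (clamp01 t, x).
Let e := residual vb ab phi Dphi.
Let K t : R := \int[mu (clamp01 t)]_x e (clamp01 t, x).

Let Dphi_supp (t : R) x h : r < `|x| -> Dphi (t, x) h = 0.
Proof.
move=> xr; case: h => s u; rewrite (C1_pairE cphi).
have -> : Dphi (t, x) (1, 0) = 0.
  have [_ <-] := C1_time cphi t x.
  rewrite (_ : (fun _ => _) = cst 0); first exact: derive_cst.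
  by apply/funext => s'; exact: phi_supp.
rewrite mulr0 add0r big1// => i _.
rewrite (C1_with_zero_far (evec i) (C1_section cphi t) (r := r)) ?mulr0//.
by move=> y; exact: phi_supp.
Qed.

Let e_supp (t : R) x : r < `|x| -> e (t, x) = 0.
Proof. by move=> xr; rewrite /e /residual Dphi_supp// phi_supp// mulr0 addr0. Qed.

Let cJ : continuous J.
Proof. exact: (continuous_integral mu_narrow (C1_with_continuous cphi) phi_supp). Qed.

Let cK : continuous K.
Proof. exact: (continuous_integral mu_narrow (residual_continuous cphi) e_supp). Qed.

(** The test function is the product of [eta t] and [phi], whose residual is [eta' phi + eta e]. The
    factor [eta] provides the compact support in time, and [phi] the one in space. *)
Lemma weak_equation_split (eta eta' : R -> R) (c1 c2 : R) : 0 < c1 -> c2 < 1 ->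
  (forall t : R, is_derive t 1 eta (eta' t)) -> continuous eta' ->
  (forall t, t < c1 \/ c2 < t -> eta t = 0) ->
  (\int[lebR R]_(t in `[0%R, 1%R]) (eta' t * J t + eta t * K t)%:E = 0)%E.
Proof.
move=> c10 c21 deta ceta' eta0.
have cPhi := C1_withM (C1_with_comp1 deta ceta' (@C1_with_fst _ R E)) cphi.
set Phi := (fun _ => _) in cPhi; set DPhi := (fun _ _ => _) in cPhi.
have tst : test_function Phi.
  split.
  - by move=> p; have [] := cPhi.1 p.
  - move=> h; rewrite (_ : (fun _ => _) = fun p => DPhi p h); first exact: cPhi.2.
    by apply/funext => p; have [_ ->] := cPhi.1 p.
  - pose I : set R := `[c1, c2]%classic.
    exists (I `*` [set x : E | `|x| <= r]); split.
    + by apply: compact_setX; [exact: segment_compact|exact: compact_ball_rV].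
    + move=> [t x] [/= + _]; rewrite /I /open_slab /= !in_itv /= => /andP[t1 t2].
      by rewrite (lt_le_trans c10 t1) (le_lt_trans t2 c21).
    + move=> [t x] nK; rewrite /Phi /=.
      have [xr|xr] := leP `|x| r; last by rewrite phi_supp// mulr0.
      rewrite eta0 ?mul0r//.
      have [tc1|c1t] := ltP t c1; first by left.
      right; rewrite ltNge; apply/negP => tc2; apply: nK; split=> //=.
      by rewrite /I /= in_itv /= c1t.
rewrite -(mu_eq tst); apply: eq_integral => t; rewrite inE /= => t01.
have [m m0 hm] := mass_bound mu_narrow.
have ct := clamp01_id t01.
have [K1 _ hK1] := supported_bound (C1_with_continuous cphi) phi_supp.
have [K2 _ hK2] := supported_bound (residual_continuous cphi) e_supp.
have i1 := integrable_bounded_continuous (mu t)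
  (section_continuous (C1_with_continuous cphi) (t := t)) (fun x => hK1 t x t01).
have i2 := integrable_bounded_continuous (mu t)
  (section_continuous (residual_continuous cphi) (t := t)) (fun x => hK2 t x t01).
have -> : eta' t * J t + eta t * K t =
    \int[mu t]_x (eta' t * phi (t, x) + eta t * e (t, x)).
  rewrite RintegralD//.
  - by rewrite !RintegralZl// /J /K ct.
  - by have := integrableZl measurableT (eta' t) i1.
  - by have := integrableZl measurableT (eta t) i2.
rewrite /Rintegral fineK.
  apply: eq_integral => x _; congr (_%:E).
  have -> : derive1 (fun s => Phi (s, x)) t = DPhi (t, x) (1, 0).
    by rewrite derive1E; have [_ ->] := C1_time cPhi t x.
  have -> : dotv (grad (fun y => Phi (t, y)) x) (v t x) =
      \sum_i v t x 0 i * DPhi (t, x) (0, evec i).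
    apply: eq_bigr => i _; rewrite mxE mulrC; congr (_ * _).
    by have [_ ->] := is_derive_diff (evec i) ((C1_section cPhi t).1 x).
  have := C1_pairE cPhi (t, x) 1 (v t x); rewrite mul1r => <-.
  rewrite /e /residual /vb /ab /DPhi /Phi /= ct; ring.
apply: integrable_fin_num => //.
have := integrableD measurableT (integrableZl measurableT (eta' t) i1)
  (integrableZl measurableT (eta t) i2).
by [].
Qed.

(** In the sense of distributions [J' = K]. Hence [J] minus a primitive [P] of [K] is constant,
    first inside []0, 1[] by du Bois-Reymond and then up to the endpoints by continuity, and the
    increment of [P] is bounded by that of a linear function. *)
Lemma integral_increment (m eps a b : R) : 0 <= a -> a <= b -> b <= 1 -> 0 <= eps ->
  (forall t : R, t \in `[0, 1] -> fine (mu t setT) <= m) ->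
  (forall (t : R) x, t \in `]a, b[ -> `|e (t, x)| <= eps) ->
  `|\int[mu b]_x phi (b, x) - \int[mu a]_x phi (a, x)| <= eps * m * (b - a).
Proof.
move=> a0 ab' b1 eps0 hm he.
have [P P0 dP] := continuous_primitive cK.
pose Pc t := P (clamp01 t).
have dPc (t : R) : t \in `[0, 1] -> {for t, continuous P}.
  move=> /dP [dd _]; apply: differentiable_continuous; exact/derivable1_diffP.
have cPc : continuous Pc.
  move=> t; apply: (@continuous_compf _ _ _ P (@clamp01 R) t _ (@continuous_clamp01 R t)).
  by apply: dPc; exact: clamp01_in.
pose H t := J t - Pc t.
have cH : continuous H by move=> t; apply: continuousB; [exact: cJ|exact: cPc].
have Hc : forall s t : R, s \in `]0, 1[ -> t \in `]0, 1[ -> H s = H t.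
  apply: du_bois_reymond => // eta eta' Z c1 c2 c10 c21 deta ceta' eta0 dZ.
  have eta00 : eta 0 = 0 by apply: eta0; left.
  have eta01 : eta 1 = 0 by apply: eta0; right.
  have cy : continuous (fun t => eta' t * J t + eta t * K t).
    have ceta t : {for t, continuous eta}.
      by apply: differentiable_continuous; apply/derivable1_diffP; have [] := deta t.
    move=> t.
    by have := continuousD (continuousM (ceta' t) (@cJ t)) (continuousM (ceta t) (@cK t)).
  (* With [Z' = eta' (J - P)] and [P' = K], this sum is a primitive of [eta' J + eta K]. As [eta]
     vanishes at 0 and 1, the split equation says exactly [Z 1 = Z 0]. *)
  have dF (t : R) : t \in `[0, 1] -> is_derive t 1 (fun t => Z t + eta t * P t)
      (eta' t * J t + eta t * K t).
    move=> t01; have d1 := dZ t t01; have d2 := dP t t01; have d3 := deta t.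
    apply: is_derive_eq (is_deriveD d1 (is_deriveM d3 d2)) _.
    by rewrite /H /Pc clamp01_id// /GRing.scale /=; ring.
  have := integral_primitive01 cy dF.
  rewrite (weak_equation_split c10 c21 deta ceta' eta0) eta00 eta01 !mul0r !addr0.
  by move=> h; apply: subr0_eq; apply: EFin_inj; rewrite -h.
have half : (2^-1 : R) \in `]0, 1[ by rewrite in_itv /=; apply/andP; split; lra.
have Hcst : forall t : R, t \in `[0, 1] -> H t = H 2^-1.
  by apply: continuous_eq_interior cH _ => t t01; exact: Hc.
have a01 : a \in `[0, 1] by rewrite in_itv /= a0 (le_trans ab').
have b01 : b \in `[0, 1] by rewrite in_itv /= b1 (le_trans a0).
have -> : \int[mu b]_x phi (b, x) - \int[mu a]_x phi (a, x) = P b - P a.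
  have := etrans (Hcst b b01) (esym (Hcst a a01)).
  rewrite /H /J /Pc !clamp01_id// => h.
  have -> : \int[mu b]_x phi (b, x) = P b + (\int[mu a]_x phi (a, x) - P a).
    by rewrite -h; ring.
  by ring.
have sub (t : R) : t \in `[a, b] -> t \in `[0, 1].
  rewrite !in_itv /= => /andP[at' tb].
  by rewrite (le_trans a0 at') (le_trans tb b1).
have dPab (t : R) : t \in `[a, b] -> is_derive t 1 P (K t) by move=> /sub /dP.
have dl (t : R) : t \in `[a, b] -> is_derive t 1 (fun t : R => eps * m * t) (eps * m).
  by move=> _; exact: is_derive_scale.
have := norm_le_of_derive ab' (within_continuous_derive dPab) (within_continuous_derive dl)
  (fun t h => dPab t (subset_itv_oo_cc h)) (fun t h => dl t (subset_itv_oo_cc h)).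
rewrite mulrBr; apply=> t tab; have t01 := sub t (subset_itv_oo_cc tab).
rewrite /K clamp01_id//.
apply: le_trans (@Rintegral_bound _ _ (mu t) _ eps _ _) _.
- exact: (section_continuous (residual_continuous cphi)).
- by move=> x; exact: he.
- by rewrite ler_wpM2l// hm.
Qed.

Variables (X : R -> E -> E) (A : R -> E -> R).
Hypothesis dX : forall (t : R) x, t \in `[0, 1] -> is_derive t 1 (X^~ x) (vb (t, X t x)).
Hypothesis dA : forall (t : R) x, t \in `[0, 1] -> is_derive t 1 (A^~ x) (ab (t, X t x)).

(** Since [X] follows [vb] and [A] has derivative [ab], the derivative of [exp (4 A) phi (t, X)] is
    [exp (4 A)] times the residual at [(t, X)]. One bound on the residual therefore controls both
    the pairing with [mu] and the pairing along the flow. *)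
Lemma flow_increment (B eps a b : R) x : 0 <= a -> a <= b -> b <= 1 -> 0 <= eps ->
  (forall t : R, t \in `[0, 1] -> A t x <= B) ->
  (forall (t : R) x, t \in `]a, b[ -> `|e (t, x)| <= eps) ->
  `|expR (4 * A b x) * phi (b, X b x) - expR (4 * A a x) * phi (a, X a x)| <=
  eps * expR (4 * B) * (b - a).
Proof.
move=> a0 ab' b1 eps0 AB he.
have sub (t : R) : t \in `[a, b] -> t \in `[0, 1].
  rewrite !in_itv /= => /andP[at' tb].
  by rewrite (le_trans a0 at') (le_trans tb b1).
pose u t := expR (4 * A t x) * phi (t, X t x).
pose u' t := expR (4 * A t x) * e (t, X t x).
have du (t : R) : t \in `[a, b] -> is_derive t 1 u (u' t).
  move=> /sub t01; have d1 := dX x t01; have d2 := dA x t01.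
  have d3 := is_derive_graph d1 (cphi.1 (t, X t x)).
  have d4 : is_derive t 1 (fun s => 4 * A s x) (4 * ab (t, X t x)).
    exact: is_deriveZ.
  have d5 : is_derive t 1 (fun s => expR (4 * A s x)) (4 * ab (t, X t x) * expR (4 * A t x)).
    have := is_diff_path d4 (is_diff_derive (is_derive_expR (4 * A t x))).
    by [].
  apply: is_derive_eq (is_deriveM d5 d3) _.
  by rewrite /u' /e /residual /GRing.scale /=; ring.
have dl (t : R) : t \in `[a, b] ->
    is_derive t 1 (fun t : R => eps * expR (4 * B) * t) (eps * expR (4 * B)).
  by move=> _; exact: is_derive_scale.
have := norm_le_of_derive ab' (within_continuous_derive du) (within_continuous_derive dl)
  (fun t h => du t (subset_itv_oo_cc h)) (fun t h => dl t (subset_itv_oo_cc h)).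
rewrite mulrBr; apply=> t tab; have t01 := sub t (subset_itv_oo_cc tab).
rewrite /u' normrM ger0_norm ?expR_ge0// mulrC; apply: ler_pM => //; last first.
  by rewrite ler_expR ler_pM2l// AB.
exact: he.
Qed.

End WeakEquation.

(** * Representation of the curve by the flow *)

Section EulerStep.
Context {R : realType} {d : nat}.
Notation E := 'rV[R]_d.
Variables (vb w : R * E -> E) (ab a : R * E -> R) (N C : R).
Hypothesis C_ge0 : 0 <= C.
Hypothesis tw : truncated vb w N C.
Hypothesis ta : truncated ab a N C.

(* One backward Euler step of the adjoint equation, frozen at the midpoint of
   [t0, t1], where the fields are known to be differentiable. *)
Definition euler (f : E -> R) (m t1 : R) (p : R * E) : R :=
  f (p.2 + (t1 - p.1) *: w (m, p.2)) * expR (4 * (t1 - p.1) * a (m, p.2)).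

Definition bounded_C1 (f : E -> R) Df (Q r : R) :=
  [/\ C1_with f Df, forall x, `|f x| <= Q, forall x h, `|Df x h| <= Q * `|h| &
      forall x, r < `|x| -> f x = 0].

Lemma euler_at_end f m t1 x : euler f m t1 (t1, x) = f x.
Proof. by rewrite /euler /= subrr scale0r addr0 mulr0 mul0r expR0 mulr1. Qed.

Lemma euler_step (f : E -> R) Df (Q r gm t0 t1 : R) : 0 <= t0 -> t0 < t1 -> t1 <= 1 ->
  let m := (t0 + t1) / 2 in let tau := t1 - t0 in
  bounded_C1 f Df Q r ->
  (forall x, `|w (m, x)| <= gm) -> r + tau * gm <= N ->
  exists Dphi Dg, [/\
    C1_with (euler f m t1) Dphi,
    exists r', forall (t : R) x, r' < `|x| -> euler f m t1 (t, x) = 0,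
    forall (t : R) x, t \in `]t0, t1[ ->
      `|residual vb ab (euler f m t1) Dphi (t, x)| <=
      expR (4 * C) * Q * (5 * (C + C ^+ 2)) * tau &
    bounded_C1 (fun x => euler f m t1 (t0, x)) Dg
      (Q * expR (9 * C * tau)) (r + tau * gm)].
Proof.
move=> t00 t01 t11 m tau [cf fQ DfQ fr] wm rN.
have tau0 : 0 < tau by rewrite subr_gt0.
have tau1 : tau <= 1 by rewrite /tau; lra.
have m01 : m \in `]0, 1[ by rewrite in_itv /= /m; apply/andP; split; lra.
have m01' : m \in `[0, 1] by exact: subset_itv_oo_cc.
have [w1 w2 w3 w4 _] := tw; have [a1 a2 a3 a4 _] := ta.
have [Dw cw DwC] := w2 m m01; have [Da ca DaC] := a2 m m01.
have Q0 : 0 <= Q by apply: le_trans (fQ 0).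
have cY : C1_with (fun p : R * E => p.2 + (t1 - p.1) *: w (m, p.2))
    (fun p h => h.2 + (t1 - p.1) *: Dw p.2 h.2 - h.1 *: w (m, p.2)).
  have cws : C1_with (fun p : R * E => w (m, p.2)) (fun p h => Dw p.2 h.2).
    apply: C1_with_row => i.
    exact: (C1_with_comp (C1_with_coord 0 i cw) (@C1_with_snd _ R E)).
  have := C1_withD (@C1_with_snd _ R E) (C1_withZ
    (C1_withD (C1_with_cst (t1 : R)) (C1_withN (@C1_with_fst _ R E))) cws).
  apply: C1_with_ext => // p h.
  by rewrite add0r scaleNr addrA.
have cL : C1_with (fun p : R * E => 4 * (t1 - p.1) * a (m, p.2))
    (fun p h => 4 * (t1 - p.1) * Da p.2 h.2 - 4 * h.1 * a (m, p.2)).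
  have := C1_withM (C1_withM (C1_with_cst (4 : R))
    (C1_withD (C1_with_cst (t1 : R)) (C1_withN (@C1_with_fst _ R E))))
    (C1_with_comp ca (@C1_with_snd _ R E)).
  by apply: C1_with_ext => // p h /=; ring.
pose Y (p : R * E) := p.2 + (t1 - p.1) *: w (m, p.2).
pose L (p : R * E) := 4 * (t1 - p.1) * a (m, p.2).
pose DY (p h : R * E) := h.2 + (t1 - p.1) *: Dw p.2 h.2 - h.1 *: w (m, p.2).
pose DL (p h : R * E) := 4 * (t1 - p.1) * Da p.2 h.2 - 4 * h.1 * a (m, p.2).
pose Dphi (p h : R * E) := expR (L p) * (f (Y p) * DL p h + Df (Y p) (DY p h)).
have cphi : C1_with (euler f m t1) Dphi.
  have := C1_withM (C1_with_comp cf cY) (C1_with_comp1 (@is_derive_expR R) (@continuous_expR R) cL).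
  apply: C1_with_ext => [p|p h]; first by rewrite /euler.
  by rewrite /Dphi /Y /L /DL /DY /=; ring.
have Yfar (t gap : R) x rr : `|(t1 - t) *: w (m, x)| <= gap -> rr + gap < `|x| -> rr < `|Y (t, x)|.
  move=> h1 h2; rewrite /Y /=.
  by have := lerB_normD x ((t1 - t) *: w (m, x)); lra.
have gm0 : 0 <= gm by apply: le_trans (wm 0).
have shift t x : t0 <= t -> t <= t1 -> `|(t1 - t) *: w (m, x)| <= tau * gm.
  move=> h1 h2; rewrite normrZ ger0_norm ?subr_ge0// ler_pM ?subr_ge0//.
  by rewrite /tau lerD2l lerN2.
have Ldev t x : t0 <= t -> t <= t1 -> L (t, x) <= 4 * C * tau.
  move=> h1 h2; have := a1 m x m01'; rewrite ler_norml => /andP[_ h3].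
  rewrite /L /= -[4 * C * tau]mulrA -mulrA ler_pM2l// mulrC.
  apply: (@le_trans _ _ (C * (t1 - t))); first by rewrite ler_wpM2r ?subr_ge0.
  by rewrite ler_wpM2l// /tau lerD2l lerN2.
have Ct : 0 <= C * tau by rewrite mulr_ge0// ltW.
exists Dphi, (fun x h => Dphi (t0, x) (0, h)); split=> //.
- have [_ _ _ _ [_ [rw wfar]]] := tw.
  exists (Num.max r rw) => t x; rewrite gt_max => /andP[xr xrw].
  by rewrite /euler /= wfar// scaler0 addr0 fr// mul0r.
- move=> t x; rewrite in_itv /= => /andP[tt0 tt1].
  have t01' : t \in `[0, 1] by rewrite in_itv /=; apply/andP; split; lra.
  (* Inside the ball of radius [N] the true fields are the truncated ones. Outside, where nothing
     bounds the true fields, the argument of [f] lies beyond its support, so the residual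
     vanishes. *)
  have [xN|xN] := leP `|x| N; last first.
    have Yr : r < `|Y (t, x)|.
      apply: (Yfar t (tau * gm)); first by apply: shift; exact: ltW.
      exact: le_lt_trans rN xN.
    rewrite /residual /euler -/(Y (t, x)) /Dphi !fr// (C1_with_zero_far _ cf fr Yr).
    rewrite !mul0r addr0 !mulr0 addr0 normr0.
    have CC0 : 0 <= 5 * (C + C ^+ 2) by rewrite mulr_ge0// addr_ge0// sqr_ge0.
    exact: (mulr_ge0 (mulr_ge0 (mulr_ge0 (expR_ge0 _) Q0) CC0) (ltW tau0)).
  have -> : residual vb ab (euler f m t1) Dphi (t, x) = expR (L (t, x)) *
     (f (Y (t, x)) * (DL (t, x) (1, w (t, x)) + 4 * a (t, x)) +
      Df (Y (t, x)) (DY (t, x) (1, w (t, x)))).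
    by rewrite /residual w4// a4// /euler /Dphi -/(Y (t, x)) -/(L (t, x)); ring.
  have dt : 0 <= t1 - t <= tau by rewrite /tau; apply/andP; split; lra.
  have tm : `|t - m| <= tau.
    by rewrite /m /tau ler_norml; apply/andP; split; lra.
  have wC : `|w (t, x)| <= C by exact: w1.
  have bDL : `|DL (t, x) (1, w (t, x)) + 4 * a (t, x)| <= 4 * (C + C ^+ 2) * tau.
    have -> : DL (t, x) (1, w (t, x)) + 4 * a (t, x) =
        4 * (t1 - t) * Da x (w (t, x)) + 4 * (a (t, x) - a (m, x)).
      by rewrite /DL /=; ring.
    apply: le_trans (ler_normD _ _) _.
    have h1 : `|4 * (t1 - t) * Da x (w (t, x))| <= 4 * (tau * C ^+ 2).
      have /andP[dt0 dt1] := dt.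
      rewrite -mulrA normrM ger0_norm// ler_pM2l// normrM ger0_norm// ler_pM//.
      by apply: le_trans (DaC _ _) _; rewrite expr2 ler_wpM2l.
    have h2 : `|4 * (a (t, x) - a (m, x))| <= 4 * (C * tau).
      rewrite normrM ger0_norm// ler_pM2l//; apply: le_trans (a3 t m x t01' m01') _.
      by rewrite ler_wpM2l.
    by lra.
  have bDY : `|DY (t, x) (1, w (t, x))| <= (C + C ^+ 2) * tau.
    rewrite /DY /= scale1r addrAC; apply: le_trans (ler_normD _ _) _.
    have h1 : `|w (t, x) - w (m, x)| <= C * tau.
      by apply: le_trans (w3 t m x t01' m01') _; rewrite ler_wpM2l.
    have h2 : `|(t1 - t) *: Dw x (w (t, x))| <= tau * C ^+ 2.
      have /andP[dt0 dt1] := dt.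
      rewrite normrZ ger0_norm// ler_pM//.
      by apply: le_trans (DwC _ _) _; rewrite expr2 ler_wpM2l.
    by lra.
  rewrite normrM ger0_norm ?expR_ge0//.
  have -> : expR (4 * C) * Q * (5 * (C + C ^+ 2)) * tau =
     expR (4 * C) * (Q * (4 * (C + C ^+ 2) * tau) + Q * ((C + C ^+ 2) * tau)) by ring.
  apply: ler_pM => //.
    rewrite ler_expR; apply: le_trans (Ldev t x (ltW tt0) (ltW tt1)) _.
    by rewrite ler_piMr// mulr_ge0.
  apply: le_trans (ler_normD _ _) _; rewrite lerD//.
    by rewrite normrM ler_pM.
  by apply: le_trans (DfQ _ _) _; rewrite ler_wpM2l.
- split.
  + exact: (C1_section cphi t0).
  + move=> x; rewrite /euler normrM (ger0_norm (expR_ge0 _)).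
    apply: ler_pM; [exact: normr_ge0|exact: expR_ge0|exact: fQ|].
    rewrite ler_expR; apply: le_trans (Ldev t0 x (lexx _) (ltW t01)) _.
    by rewrite -!mulrA ler_wpM2r// ler_nat.
  + move=> x h; rewrite /Dphi normrM ger0_norm ?expR_ge0//.
    have e1 : expR (9 * C * tau) = expR (4 * C * tau) * expR (5 * C * tau).
      by rewrite -expRD; congr expR; ring.
    have e2 : 1 + 5 * C * tau <= expR (5 * C * tau) by exact: expR_ge1Dx.
    apply: (@le_trans _ _ (expR (4 * C * tau) * (Q * (1 + 5 * C * tau) * `|h|))); last first.
      rewrite e1 [leRHS](_ : _ = expR (4 * C * tau) * (Q * expR (5 * C * tau) * `|h|)); last by ring.
      by rewrite ler_wpM2l ?expR_ge0// ler_wpM2r// ler_wpM2l.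
    apply: ler_pM => //.
      by rewrite ler_expR; apply: Ldev => //; exact: ltW.
    apply: le_trans (ler_normD _ _) _.
    have -> : Q * (1 + 5 * C * tau) * `|h| =
        Q * (4 * tau * (C * `|h|)) + Q * (`|h| + tau * (C * `|h|)) by ring.
    apply: lerD.
      rewrite normrM ler_pM// /DL /= !mulr0 mul0r subr0 normrM ler_pM//.
      by rewrite ger0_norm// mulr_ge0// ltW.
    apply: le_trans (DfQ _ _) _; rewrite ler_wpM2l// /DY /= scale0r subr0.
    apply: le_trans (ler_normD _ _) _; rewrite lerD2l -/tau normrZ (ger0_norm (ltW tau0)).
    by apply: ler_wpM2l; [exact: ltW|exact: DwC].
  + move=> x xr; rewrite /euler /= fr ?mul0r//.
    by apply: (Yfar t0 (tau * gm)) => //; apply: shift => //; exact: ltW.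
Qed.

Lemma bounded_C1_weaken f Df Q Q' r r' : Q <= Q' -> r <= r' ->
  bounded_C1 f Df Q r -> bounded_C1 f Df Q' r'.
Proof.
move=> QQ rr [c f1 f2 f3]; split=> //.
- by move=> x; exact: le_trans (f1 x) QQ.
- by move=> x h; apply: le_trans (f2 x h) _; rewrite ler_wpM2r.
- by move=> x xr; apply: f3; exact: le_lt_trans xr.
Qed.

End EulerStep.

Section Representation.
Context {R : realType} {d : nat}.
Notation E := 'rV[R]_d.
Variables (mu : R -> {finite_measure set (borel E) -> \bar R}).
Variables (v : R -> E -> E) (alpha : R -> E -> R).
Hypothesis mu_narrow : narrowly_continuous mu.
Hypothesis mu_eq : continuity_equation mu v alpha.
Let vb (p : R * E) := v (clamp01 p.1) p.2.
Let ab (p : R * E) := alpha (clamp01 p.1) p.2.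
Variables (Dv : R * E -> R * E -> E) (Da : R * E -> R * E -> R).
Hypothesis v_C1 : slab_C1 (fun p => v p.1 p.2) vb Dv.
Hypothesis a_C1 : slab_C1 (fun p => alpha p.1 p.2) ab Da.
Variables (M B : R).
Hypothesis M_ge0 : 0 <= M.
Hypothesis vM : (\int[lebR R]_(t in `[0%R, 1%R]) W1oo_norm (v t) <= M%:E)%E.
Variables (X : R -> E -> E) (A : R -> E -> R).
Hypothesis X0 : forall x, X 0 x = x.
Hypothesis A0 : forall x, A 0 x = 0.
Hypothesis dX : forall (t : R) x, t \in `[0, 1] -> is_derive t 1 (X^~ x) (vb (t, X t x)).
Hypothesis dA : forall (t : R) x, t \in `[0, 1] -> is_derive t 1 (A^~ x) (ab (t, X t x)).
Hypothesis AB : forall (t : R) x, t \in `[0, 1] -> A t x <= B.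
Hypothesis cX : forall t : R, t \in `[0, 1] -> continuous (X t).
Hypothesis cA : forall t : R, t \in `[0, 1] -> continuous (A t).

(** Each Euler step changes both pairings by at most [kappa tau^2], and there are [n] of them with
    [n tau = T <= 1]. The same output [f] is compared with [psi] through the integrals against
    [mu T] and [mu 0], and pointwise along the flow. *)
Lemma backward_iteration (psi : E -> R) Dpsi (Q rho mass T : R) :
  bounded_C1 psi Dpsi Q rho -> 0 < T -> T <= 1 ->
  (forall t : R, t \in `[0, 1] -> fine (mu t setT) <= mass) ->
  exists2 kappa, 0 <= kappa & exists C : R, forall n : nat, (0 < n)%N -> C <= n%:R ->
    exists2 f : E -> R, exists Df Qf rf, bounded_C1 f Df Qf rf &
      `|\int[mu T]_x psi x - \int[mu 0]_x f x| <= kappa / n%:R /\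
      forall x, `|expR (4 * A T x) * psi (X T x) - f x| <= kappa / n%:R.
Proof.
move=> psiQ T0 T1 hmass.
(* The supports grow by at most the increase of [G], hence by [M], plus accumulated midpoint errors,
   which total at most 1 once [C <= n]. *)
pose N := rho + M + 1.
have [w [Cw [Cw0 cw tw']]] := truncated_rV N v_C1.
have [a [Ca [Ca0 ca ta']]] := truncated_scalar N a_C1.
pose C := Num.max Cw Ca.
have C0 : 0 <= C by rewrite le_max Cw0.
have tw : truncated vb w N C by apply: truncated_le tw'; rewrite le_max lexx.
have ta : truncated ab a N C by apply: truncated_le ta'; rewrite le_max lexx orbT.
have [G [g [dG wg gC GM]]] := displacement_majorant v_C1 vM C0 tw.
have g0 (s : R) : s \in `[0, 1] -> 0 <= g s by move=> s01; apply: le_trans (wg s 0 s01).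
have mass0 : 0 <= mass.
  by apply: le_trans (hmass 0 _); [exact: fine_ge0|rewrite in_itv /= lexx ler01].
have Q0 : 0 <= Q by have [_ h _ _] := psiQ; apply: le_trans (h 0).
(* The residual constant of [euler_step] for [Q exp (9 C)], which bounds every iterate because
   [j tau <= 1]. *)
pose K0 := expR (4 * C) * (Q * expR (9 * C)) * (5 * (C + C ^+ 2)).
have CC0 : 0 <= C + C ^+ 2 by rewrite addr_ge0 ?sqr_ge0.
have K00 : 0 <= K0 by rewrite !mulr_ge0 ?expR_ge0.
(* [mass] weighs the residual in the weak equation, [exp (4 B)] along the flow. *)
pose kappa := K0 * (mass + expR (4 * B)).
have mB0 : 0 <= mass + expR (4 * B) by rewrite addr_ge0 ?expR_ge0.
have kappa0 : 0 <= kappa by rewrite mulr_ge0.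
exists kappa => //; exists C => n n0 Cn.
have n0' : 0 < n%:R :> R by rewrite ltr0n.
pose tau := T / n%:R.
have tau0 : 0 < tau by rewrite divr_gt0.
have taun : tau * n%:R = T by rewrite /tau divfK// gt_eqF.
have Ctau : C * tau <= 1.
  rewrite /tau mulrA ler_pdivrMr// mul1r; apply: le_trans Cn.
  by rewrite ler_piMr.
(* Time runs backwards: [tt 0 = T] and [tt n = 0]. *)
pose tt (j : nat) := T - j%:R * tau.
have tt_ge0 j : (j <= n)%N -> 0 <= tt j.
  move=> jn; rewrite subr_ge0 -taun mulrC ler_pM2l//; by rewrite ler_nat.
have tt_le j : tt j <= T by rewrite /tt lerBlDr lerDl mulr_ge0// ltW.
have tt01 j : (j <= n)%N -> tt j \in `[0, 1].
  by move=> jn; rewrite in_itv /= tt_ge0//= (le_trans (tt_le j)).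
have T01 : T \in `[0, 1] by rewrite in_itv /= (ltW T0).
have jtau j : (j <= n)%N -> j%:R * tau <= 1.
  by move=> jn; have := tt_ge0 j jn; rewrite /tt; lra.
pose rad j := rho + (G T - G (tt j)) + C * tau * (j%:R * tau).
have radN j : (j <= n)%N -> rad j <= N.
  move=> jn; rewrite /rad /N.
  have Gm1 : G T <= G 1.
    by apply: (majorant_le dG g0) => //; rewrite in_itv /= lexx ler01.
  have Gm0 : G 0 <= G (tt j).
    apply: (majorant_le dG g0) => //; [by rewrite in_itv /= lexx ler01|exact: tt01|exact: tt_ge0].
  have : C * tau * (j%:R * tau) <= 1.
    rewrite -[leRHS]mul1r ler_pM//; [by rewrite mulr_ge0// ltW|by rewrite mulr_ge0// ltW|exact: jtau].
  by lra.
have main j : (j <= n)%N -> exists2 f : E -> R,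
    exists Df, bounded_C1 f Df (Q * expR (9 * C * (j%:R * tau))) (rad j) &
    `|\int[mu T]_x psi x - \int[mu (tt j)]_x f x| <= kappa * tau * (j%:R * tau) /\
    forall x, `|expR (4 * A T x) * psi (X T x) - expR (4 * A (tt j) x) * f (X (tt j) x)| <=
      kappa * tau * (j%:R * tau).
  elim: j => [_|j ih jn].
    have tt0 : tt 0%N = T by rewrite /tt mul0r subr0.
    exists psi; last by rewrite tt0 mul0r mulr0; split=> [|x]; rewrite subrr normr0.
    exists Dpsi; rewrite /rad tt0 subrr !mul0r !mulr0 expR0 mulr1 !addr0; exact: psiQ.
  have [f [Df fQ] [If Ff]] := ih (ltnW jn).
  have t10 : tt j - tt j.+1 = tau by rewrite /tt -natr1; ring.
  have lt01 : tt j.+1 < tt j by rewrite -subr_gt0 t10.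
  have tj1 : tt j <= 1 by apply: le_trans (tt_le j) T1.
  pose m := (tt j.+1 + tt j) / 2.
  have m01 : m \in `[0, 1].
    have h := tt_ge0 _ jn; rewrite in_itv /= /m; by apply/andP; split; lra.
  (* [g] is [C]-Lipschitz, so its midpoint value times [tau] exceeds the increase of [G] over the
     step by at most [C tau^2]. *)
  have gmt : tau * g m <= G (tt j) - G (tt j.+1) + C * tau * tau.
    have sub (s : R) : s \in `[tt j.+1, tt j] -> s \in `[0, 1].
      rewrite !in_itv /= => /andP[s1 s2]; have := tt_ge0 _ jn.
      move=> h; by apply/andP; split; lra.
    have dH (s : R) : s \in `[tt j.+1, tt j] ->
        is_derive s 1 (fun s => G s + (C * tau - g m) * s) (g s + (C * tau - g m)).
      move=> /sub s01; have d1 := dG s s01.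
      have d2 : is_derive s 1 (fun s : R => (C * tau - g m) * s) (C * tau - g m).
        exact: is_derive_scale.
      exact: is_deriveD d1 d2.
    have := le_of_derive (ltW lt01) (within_continuous_derive dH)
      (fun s h => dH s (subset_itv_oo_cc h)).
    have H : forall s : R, s \in `]tt j.+1, tt j[ -> 0 <= g s + (C * tau - g m).
      move=> s h; have s01 := sub s (subset_itv_oo_cc h).
      have sm : `|m - s| <= tau.
        move: h; rewrite in_itv /= => /andP[h1 h2].
        by rewrite -t10 /m ler_norml; apply/andP; split; lra.
      have := gC m s m01 s01; rewrite ler_norml => /andP[_].
      have := ler_wpM2l C0 sm; by lra.
    move=> /(_ H) h.
    have -> : tau * g m = g m * (tt j - tt j.+1) by rewrite t10 mulrC.
    have -> : C * tau * tau = C * tau * (tt j - tt j.+1) by rewrite t10.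
    by move: h; lra.
  have rN : rad j + tau * g m <= rad j.+1.
    rewrite /rad.
    have -> : C * tau * (j.+1%:R * tau) = C * tau * (j%:R * tau) + C * tau * tau.
      by rewrite -natr1; ring.
    by move: gmt; lra.
  have rN' : rad j + (tt j - tt j.+1) * g m <= N.
    by rewrite t10; exact: le_trans rN (radN _ jn).
  have [Dphi [Dg [cphi supp res gQ]]] := euler_step C0 tw ta (tt_ge0 _ jn) lt01 tj1 fQ
    (fun x => wg m x m01) rN'.
  rewrite t10 in res gQ.
  pose phi := euler w a f m (tt j).
  pose Qj := Q * expR (9 * C * (j%:R * tau)).
  pose eps := expR (4 * C) * Qj * (5 * (C + C ^+ 2)) * tau.
  have Qj0 : 0 <= Qj by rewrite mulr_ge0 ?expR_ge0.
  have eps0 : 0 <= eps by rewrite !mulr_ge0 ?expR_ge0// ltW.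
  have epsK : eps <= K0 * tau.
    rewrite /eps /K0 ler_wpM2r ?(ltW tau0)// ler_wpM2r ?mulr_ge0//.
    rewrite ler_wpM2l ?expR_ge0// ler_wpM2l// ler_expR ler_piMr ?mulr_ge0//.
    exact: jtau (ltnW jn).
  have [cvb _ _ _] := v_C1; have [cab _ _ _] := a_C1.
  exists (fun x => phi (tt j.+1, x)).
    exists Dg; apply: bounded_C1_weaken gQ => //.
    have -> : 9 * C * (j.+1%:R * tau) = 9 * C * (j%:R * tau) + 9 * C * tau.
      by rewrite -[j.+1%:R]natr1; ring.
    by rewrite -mulrA -expRD.
  have [r' supp'] := supp.
  have eK (z : R) : 0 <= z -> z <= mass + expR (4 * B) -> eps * z * tau <= kappa * tau * tau.
    move=> z0 zm.
    have -> : kappa * tau * tau = K0 * tau * (mass + expR (4 * B)) * tau.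
      by rewrite /kappa; ring.
    by apply: ler_wpM2r; [exact: ltW|exact: ler_pM].
  have phiE x : phi (tt j, x) = f x by exact: euler_at_end.
  have Ie : `|\int[mu (tt j)]_x f x - \int[mu (tt j.+1)]_x phi (tt j.+1, x)| <=
      kappa * tau * tau.
    have := integral_increment mu_narrow mu_eq cvb cab cphi supp' (tt_ge0 _ jn)
      (ltW lt01) tj1 eps0 hmass res.
    rewrite t10 => h.
    have -> : \int[mu (tt j)]_x f x = \int[mu (tt j)]_x phi (tt j, x).
      by apply: eq_Rintegral => x _; rewrite phiE.
    by apply: le_trans h _; apply: eK => //; rewrite lerDl expR_ge0.
  have Fe x : `|expR (4 * A (tt j) x) * f (X (tt j) x) -
      expR (4 * A (tt j.+1) x) * phi (tt j.+1, X (tt j.+1) x)| <= kappa * tau * tau.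
    have := flow_increment cphi dX dA (tt_ge0 _ jn) (ltW lt01) tj1 eps0
      (fun t ht => AB x ht) res.
    rewrite t10 -/phi phiE => h.
    by apply: le_trans h _; apply: eK => //; rewrite ?expR_ge0// lerDr.
  have -> : kappa * tau * (j.+1%:R * tau) = kappa * tau * (j%:R * tau) + kappa * tau * tau.
    by rewrite -natr1; ring.
  split=> [|x].
    rewrite -(subrKA (\int[mu (tt j)]_x f x)) (le_trans (ler_normD _ _))//.
    exact: lerD.
  rewrite -(subrKA (expR (4 * A (tt j) x) * f (X (tt j) x))) (le_trans (ler_normD _ _))//.
  exact: lerD.
have [f [Df fQ] [If Ff]] := main n (leqnn n).
have ttn : tt n = 0 by rewrite /tt mulrC taun subrr.
have kn : kappa * tau * (n%:R * tau) <= kappa / n%:R.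
  rewrite [n%:R * _]mulrC taun -mulrA ler_wpM2l// /tau mulrAC.
  by rewrite ler_piMl ?invr_ge0 ?(ltW n0')// mulr_ile1// ltW.
exists f; first by exists Df; do 2 eexists; exact: fQ.
rewrite ttn in If Ff; split=> [|x]; first exact: le_trans If kn.
apply: le_trans kn; have := Ff x.
by rewrite A0 X0 mulr0 expR0 mul1r.
Qed.

Lemma test_representation (psi : E -> R) Dpsi (Q rho T : R) : T \in `[0, 1] ->
  bounded_C1 psi Dpsi Q rho ->
  \int[mu T]_x psi x = \int[mu 0]_x (expR (4 * A T x) * psi (X T x)).
Proof.
move=> T01 psiQ.
have [T0 T1] : 0 <= T /\ T <= 1 by move: T01; rewrite in_itv /= => /andP.
have [->|Tn0] := eqVneq T 0.
  by apply: eq_Rintegral => x _; rewrite A0 X0 mulr0 expR0 mul1r.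
have {T0 Tn0}T0 : 0 < T by rewrite lt_neqAle eq_sym Tn0.
have [mass mass0 hmass] := mass_bound mu_narrow.
have [kappa k0 [C main]] := backward_iteration psiQ T0 T1 hmass.
pose h x := expR (4 * A T x) * psi (X T x).
have [cpsi psib _ _] := psiQ; have cpsi' := C1_with_continuous cpsi.
have ch : continuous h.
  move=> x.
  have c1 : {for x, continuous (fun x => 4 * A T x)}.
    by have := continuousM (@cst_continuous _ _ (4 : R) x) (@cA T T01 x).
  have c2 : {for x, continuous (fun x => expR (4 * A T x))}.
    exact: (@continuous_compf _ _ _ (@expR R) (fun x => 4 * A T x) x (@continuous_expR R _) c1).
  have c3 : {for x, continuous (fun x => psi (X T x))}.
    exact: (@continuous_compf _ _ _ psi (X T) x (cpsi' _) (@cX T T01 x)).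
  by have := continuousM c2 c3.
have hb x : `|h x| <= expR (4 * B) * Q.
  rewrite normrM ger0_norm ?expR_ge0// ler_pM ?expR_ge0//.
  by rewrite ler_expR ler_pM2l// AB.
apply/eqP; rewrite -subr_eq0 -normr_le0; apply/ler_addgt0Pr => e e0.
(* The two errors are [kappa / n] between the integrals against [mu T] and [mu 0], and
   [kappa / n * mass] from the pointwise estimate integrated against [mu 0]. *)
pose Z := Num.max C (kappa * (1 + mass) / e).
pose n := (Num.truncn Z).+1.
have nZ : Z < n%:R by exact: truncnS_gt.
have nC : C <= n%:R by apply: le_trans (ltW nZ); rewrite le_max lexx.
have ne : kappa * (1 + mass) / n%:R <= e.
  have : kappa * (1 + mass) / e <= n%:R.
    by apply: le_trans (ltW nZ); rewrite le_max lexx orbT.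
  by rewrite ler_pdivrMr// => h'; rewrite ler_pdivrMr ?ltr0n// [e * _]mulrC.
have [f [Df [Qf [rf [cf fQ _ _]]]] [h1 h2]] := main n isT nC.
have cf' := C1_with_continuous cf.
have hf : `|\int[mu 0]_x f x - \int[mu 0]_x h x| <= kappa / n%:R * mass.
  rewrite distrC -RintegralB//.
  - have cB : continuous (fun x => h x - f x).
      by move=> x; have := continuousB (ch x) (cf' x).
    apply: le_trans (@Rintegral_bound _ _ (mu 0) _ (kappa / n%:R) cB _) _; first exact: h2.
    by rewrite ler_wpM2l ?divr_ge0// hmass// in_itv /= lexx ler01.
  - exact: integrable_bounded_continuous hb.
  - exact: integrable_bounded_continuous fQ.
rewrite -(subrKA (\int[mu 0]_x f x)) (le_trans (ler_normD _ _))// add0r.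
apply: le_trans (lerD h1 hf) (le_trans _ ne).
by have -> : kappa * (1 + mass) / n%:R = kappa / n%:R + kappa / n%:R * mass by ring.
Qed.

Lemma bounded_C1_supported (f : E -> R) Df (rho : R) : C1_with f Df ->
  (forall x, rho < `|x| -> f x = 0) -> exists Q, bounded_C1 f Df Q rho.
Proof.
move=> cf fr.
have bnd (g : E -> R) : continuous g -> (forall x, rho < `|x| -> g x = 0) ->
    exists2 K, 0 <= K & forall x, `|g x| <= K.
  move=> cg gr; have cg' : continuous (fun p : R * E => g p.2).
    by move=> p; apply: (@continuous_compf _ _ _ g snd p (cg _) cvg_snd).
  have [K K0 hK] := supported_bound (r := rho) cg' (fun _ x => gr x).
  by exists K => // x; apply: (hK 0 x); rewrite in_itv /= lexx ler01.
have [K1 K10 hK1] := bnd f (C1_with_continuous cf) fr.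
have [K2 K20 hK2] : exists2 K, 0 <= K & forall i x, `|Df x (evec i)| <= K.
  apply: common_bound => [i K K' KK h x|i]; first exact: le_trans (h x) KK.
  by apply: bnd; [exact: cf.2|move=> x; exact: C1_with_zero_far cf fr].
exists (K1 + d%:R * K2); split=> //.
- by move=> x; apply: le_trans (hK1 x) _; rewrite lerDl mulr_ge0.
- move=> x h; apply: (@le_trans _ _ (d%:R * K2 * `|h|)); last first.
    by rewrite ler_wpM2r// lerDr.
  apply: lin_bound => [a u z|i]; first exact: (C1_with_lin cf x a u z).
  exact: hK2.
Qed.

Theorem ge0_integral_representation (T : R) (F : borel E -> \bar R) : T \in `[0, 1] ->
  measurable_fun setT F -> (forall x, 0 <= F x)%E ->
  (\int[mu T]_x F x = \int[mu 0]_x ((expR (4 * A T x))%:E * F (X T x)))%E.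
Proof.
move=> T01 mF F0.
have ck : continuous (fun x => expR (4 * A T x)).
  move=> x.
  have c1 : {for x, continuous (fun x => 4 * A T x)}.
    by have := continuousM (@cst_continuous _ _ (4 : R) x) (@cA T T01 x).
  exact: (@continuous_compf _ _ _ (@expR R) (fun x => 4 * A T x) x (@continuous_expR R _) c1).
apply: (ge0_integral_determined (cX T01) ck) => // f Df rho cf f01 fr; have [Q fQ] := bounded_C1_supported cf fr.
have fb x : `|f x| <= 1 by have /andP[a b] := f01 x; rewrite ger0_norm.
have cf' := C1_with_continuous cf.
have ch : continuous (fun x => expR (4 * A T x) * f (X T x)).
  move=> x; have c3 : {for x, continuous (fun x => f (X T x))}.
    exact: (@continuous_compf _ _ _ f (X T) x (cf' _) (@cX T T01 x)).
  by have := continuousM (ck x) c3.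
have hb x : `|expR (4 * A T x) * f (X T x)| <= expR (4 * B).
  rewrite normrM ger0_norm ?expR_ge0// -[leRHS]mulr1 ler_pM ?expR_ge0//.
  by rewrite ler_expR ler_pM2l// AB.
have i1 := integrable_bounded_continuous (mu T) cf' fb.
have i2 := integrable_bounded_continuous (mu 0) ch hb.
rewrite -(fineK (integrable_fin_num measurableT i1)).
rewrite -[RHS](fineK (integrable_fin_num measurableT i2)).
by congr (_%:E); exact: test_representation T01 fQ.
Qed.

End Representation.

Section ScalarLipschitz.
Context {R : realType} {d : nat}.
Notation E := 'rV[R]_d.

Lemma norm_const_row (a : R) : `|const_mx a : 'rV[R]_1| = `|a|.
Proof.
apply/eqP; rewrite eq_le; apply/andP; split.
  by apply: rV_norm_le => // i; rewrite mxE.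
by have := coord_le_norm (const_mx a : 'rV[R]_1) 0; rewrite mxE.
Qed.

Lemma truncated_scalar_lipschitz (fb w : R * E -> R) rho C (t : R) x y : 0 <= C ->
  truncated fb w rho C -> t \in `[0, 1] -> `|w (t, x) - w (t, y)| <= C * `|x - y|.
Proof.
move=> C0 [h1 h2 h3 h4 [h5 [r h6]]] t01.
pose row (f : R * E -> R) p : 'rV[R]_1 := const_mx (f p).
have rowB (a b : R) : (const_mx a : 'rV[R]_1) - const_mx b = const_mx (a - b).
  by apply/rowP => i; rewrite !mxE.
have T : truncated (row fb) (row w) rho C.
  split; rewrite /row.
  - by move=> s z s01; rewrite norm_const_row; exact: h1.
  - move=> s s01; have [Dg cg gC] := h2 s s01.
    exists (fun z h => const_mx (Dg z h)); last by move=> z h; rewrite norm_const_row.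
    by apply: C1_with_row => i; apply: C1_with_ext cg => [z|z h]; rewrite mxE.
  - by move=> s s' z s01 s'01; rewrite rowB norm_const_row; exact: h3.
  - by move=> s z zr; rewrite h4.
  - split=> [s z|]; first by rewrite !norm_const_row.
    by exists r => s z zr; rewrite h6//; apply/rowP => i; rewrite !mxE.
by have := truncated_lipschitz x y C0 T t01; rewrite /row rowB norm_const_row.
Qed.

End ScalarLipschitz.

(** * Growth exponent along the flow *)

Section LogWeight.
Context {R : realType} {d : nat}.
Notation E := 'rV[R]_d.
Variables (a ab : R * E -> R) (Da : R * E -> R * E -> R).
Hypothesis a_C1 : slab_C1 a ab Da.
Variables (vb : R * E -> E) (X : R -> E -> E) (M : R).
Hypothesis dX : forall (t : R) x, t \in `[0, 1] -> is_derive t 1 (X^~ x) (vb (t, X t x)).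
Hypothesis XM : forall (t : R) x, t \in `[0, 1] -> `|X t x - x| <= M.
Hypothesis Xlip : forall rho, exists2 K, 0 <= K & forall (t : R) x y, t \in `[0, 1] ->
  `|x| <= rho -> `|y| <= rho -> `|X t x - X t y| <= K * `|x - y|.

Lemma locally_lipschitz_continuous {V : normedModType R} (f : E -> V) :
  (forall rho, exists2 K, 0 <= K & forall x y, `|x| <= rho -> `|y| <= rho ->
    `|f x - f y| <= K * `|x - y|) -> continuous f.
Proof.
move=> H x; have [K K0 HK] := H (`|x| + 1).
apply/(@cvgrPdist_le _ _ _ (nbhs x) (nbhs_filter x)) => e e0.
have K1 : 0 < K + 1 by rewrite ltr_wpDl.
have h1 : \forall y \near x, `|x - y| <= Num.min 1 (e / (K + 1)).
  have h0 : 0 < Num.min 1 (e / (K + 1)) by rewrite lt_min ltr01 divr_gt0.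
  have := nbhsx_ballx (x : E) _ h0; apply: (@filterS _ (nbhs x) (nbhs_filter x)) => y.
  by rewrite -ball_normE => /ltW.
apply: (@filterS _ (nbhs x) (nbhs_filter x)) h1 => y; rewrite le_min => /andP[y1 y2].
apply: le_trans (HK x y _ _) _.
- by rewrite lerDl.
- rewrite -[y](subrKC x) addrC; apply: le_trans (ler_normD _ _) _.
  by rewrite addrC lerD2l -normrN opprB.
- move: y2; rewrite ler_pdivlMr// => h; apply: le_trans h.
  by rewrite mulrC ler_wpM2l// lerDl.
Qed.

Lemma path_continuous (t : R) x : {for t, continuous (fun s => X (clamp01 s) x)}.
Proof.
apply: (@continuous_comp_within _ _ _ (@clamp01 R) `[0, 1]%classic (X^~ x)).
- apply: within_continuous_derive => s s01; exact: dX.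
- exact: continuous_clamp01.
- by move=> s; exact: clamp01_in.
Qed.

(** For starting points in a ball the trajectories stay in a fixed larger ball, where [ab] agrees
    with a Lipschitz truncation; with the Lipschitz estimate on [X] this makes [A t] Lipschitz on
    balls, hence continuous. *)
Lemma log_weight_exists : exists A : R -> E -> R, [/\
  forall x, A 0 x = 0,
  forall (t : R) x, t \in `[0, 1] -> is_derive t 1 (A^~ x) (ab (t, X t x)) &
  forall t : R, t \in `[0, 1] -> continuous (A t)].
Proof.
have [cab abE _ _] := a_C1.
have H x : {F : R -> R | F 0 = 0 &
    forall t : R, t \in `[0, 1] -> is_derive t 1 F (ab (t, X t x))}.
  apply: cid2.
  have cy : continuous (fun s => ab (s, X (clamp01 s) x)).
    move=> s.
    have cp : {for s, continuous (fun s => (s, X (clamp01 s) x))}.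
      have := @continuous_pair R R E id (fun s => X (clamp01 s) x) s.
      by apply; [exact: cvg_id|exact: path_continuous].
    exact: (@continuous_compf _ _ _ ab (fun s => (s, X (clamp01 s) x)) s (cab _) cp).
  have [F F0 dF] := continuous_primitive cy.
  by exists F => // t t01; have := dF t t01; rewrite clamp01_id.
pose A t x := s2val (H x) t.
have dA (t : R) x : t \in `[0, 1] -> is_derive t 1 (A^~ x) (ab (t, X t x)).
  exact: (s2valP' (H x)).
have A0 x : A 0 x = 0 by exact: (s2valP (H x)).
exists A; split=> // t t01; apply: locally_lipschitz_continuous => rho.
have [w [C [C0 cw tw]]] := truncated_scalar (rho + M) a_C1.
have [K K0 HK] := Xlip rho.
exists (C * K); first exact: mulr_ge0.
move=> x y xr yr.
have ball (s : R) z : s \in `[0, 1] -> `|z| <= rho -> ab (s, X s z) = w (s, X s z).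
  move=> s01 zr; have [_ _ _ h4 _] := tw; rewrite h4//.
  by rewrite -[X s z](subrK z) (le_trans (ler_normD _ _))// addrC lerD// XM.
have [t0 t1] := itv01_bounds t01.
have sub := sub_itv01 t01.
pose L := C * K * `|x - y|.
have L0 : 0 <= L by rewrite !mulr_ge0.
have dD (s : R) : s \in `[0, t] ->
    is_derive s 1 (fun s => A s x - A s y) (ab (s, X s x) - ab (s, X s y)).
  by move=> /sub s01; exact: is_deriveB (dA s x s01) (dA s y s01).
have dL (s : R) : s \in `[0, t] -> is_derive s 1 (fun s : R => L * s) L.
  by move=> _; exact: is_derive_scale.
have := norm_le_of_derive t0 (within_continuous_derive dD) (within_continuous_derive dL)
  (fun s h => dD s (subset_itv_oo_cc h)) (fun s h => dL s (subset_itv_oo_cc h)).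
have H1 : forall s : R, s \in `]0, t[ -> `|ab (s, X s x) - ab (s, X s y)| <= L.
  move=> s /subset_itv_oo_cc/sub s01; rewrite !ball//.
  apply: le_trans (truncated_scalar_lipschitz _ _ C0 tw s01) _.
  by rewrite /L -mulrA ler_wpM2l// HK.
move=> /(_ H1); rewrite !A0 subrr subr0 mulr0 subr0 => /le_trans; apply.
by rewrite ler_piMr.
Qed.

End LogWeight.

Section SmoothFlow.
Context {R : realType} {d : nat}.
Notation E := 'rV[R]_d.
Variables (v : R -> E -> E) (alpha : R -> E -> R).
Hypothesis smooth : sufficiently_smooth v alpha.

Definition clamped {V} (f : R -> E -> V) (p : R * E) : V := f (clamp01 p.1) p.2.

Theorem smooth_flow : exists Dv Da M B X A, [/\
  [/\ slab_C1 (fun p => v p.1 p.2) (clamped v) Dv,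
      slab_C1 (fun p => alpha p.1 p.2) (clamped alpha) Da,
      0 <= M & (\int[lebR R]_(t in `[0%R, 1%R]) W1oo_norm (v t) <= M%:E)%E],
  [/\ forall x, X 0 x = x,
      forall (t : R) x, t \in `[0, 1] -> is_derive t 1 (X^~ x) (clamped v (t, X t x)) &
      forall t : R, t \in `[0, 1] -> continuous (X t)] &
  [/\ forall x, A 0 x = 0,
      forall (t : R) x, t \in `[0, 1] -> is_derive t 1 (A^~ x) (clamped alpha (t, X t x)),
      forall (t : R) x, t \in `[0, 1] -> A t x <= B &
      forall t : R, t \in `[0, 1] -> continuous (A t)]].
Proof.
have [vfin [ca ba _] [/C1_slabP[Dv v_C1] /C1_slabP[Da a_C1]]] := smooth.
pose I := (\int[lebR R]_(t in `[0%R, 1%R]) W1oo_norm (v t))%E.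
have I0 : (0 <= I)%E.
  apply: integral_ge0 => t _; rewrite /W1oo_norm; apply: adde_ge0.
    by apply: ereal_sup_ge; exists (`|v t 0|)%:E; [exists 0|rewrite lee_fin].
  by apply: ereal_sup_ge; exists (`|'J (v t) 0|)%:E; [exists 0|rewrite lee_fin].
have M0 : 0 <= fine I by exact: fine_ge0.
have IM : (I <= (fine I)%:E)%E by rewrite fineK// ge0_fin_numE.
have [X [X0 dX XM Xlip]] := flow_exists v_C1 IM.
have {}dX : forall (t : R) x, t \in `[0, 1] -> is_derive t 1 (X^~ x) (clamped v (t, X t x)).
  exact: dX.
have [A [A0 dA cA]] := log_weight_exists a_C1 dX XM Xlip.
have [B [Breal HB]] := ba.
pose B' := Num.max 0 (B + 1).
have ab_le (t : R) x : t \in `[0, 1] -> `|alpha t x| <= B'.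
  move=> t01; apply: (HB B' _ (t, x)); last exact: t01.
  by rewrite /B' lt_max ltrDl ltr01 orbT.
have B'0 : 0 <= B' by rewrite le_max lexx.
exists Dv, Da, (fine I), B', X, A; split=> //.
  split=> // t t01; apply: locally_lipschitz_continuous => rho.
  by have [K K0 HK] := Xlip rho; exists K => // x y xr yr; exact: HK.
split=> // t x t01.
have [t0 t1] := itv01_bounds t01.
have sub := sub_itv01 t01.
have dL (s : R) : s \in `[0, t] -> is_derive s 1 (fun s : R => B' * s) B'.
  by move=> _; exact: is_derive_scale.
have dA' (s : R) : s \in `[0, t] -> is_derive s 1 (A^~ x) (clamped alpha (s, X s x)).
  by move=> /sub; exact: dA.
have := norm_le_of_derive t0 (within_continuous_derive dA') (within_continuous_derive dL)
  (fun s h => dA' s (subset_itv_oo_cc h)) (fun s h => dL s (subset_itv_oo_cc h)).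
have H1 : forall s : R, s \in `]0, t[ -> `|clamped alpha (s, X s x)| <= B'.
  by move=> s _; apply: ab_le; exact: clamp01_in.
move=> /(_ H1); rewrite A0 subr0 mulr0 subr0 => h.
by apply: le_trans (ler_norm _) (le_trans h _); rewrite ler_piMr.
Qed.

End SmoothFlow.

(** * The cone connection *)

Section ConeConnection.
Context {R : realType} {d : nat}.
Notation n := (d + 1)%N.
Implicit Types (p u w : 'rV[R]_n).

Lemma chart_xE u i : chart_x u 0 i = u 0 (lshift 1 i).
Proof. by rewrite /chart_x mxE. Qed.

Lemma chart_rE u : chart_r u = u 0 (rshift d 0).
Proof. by rewrite /chart_r mxE. Qed.

Lemma evecE m (i j : 'I_m) : (evec i : 'rV[R]_m) 0 j = (j == i)%:R.
Proof. by rewrite /evec mxE eqxx. Qed.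

Lemma sum_evec m (u : 'rV[R]_m) j : \sum_i u 0 i * (evec i : 'rV[R]_m) 0 j = u 0 j.
Proof.
rewrite (bigD1 j)//= evecE eqxx mulr1 big1 ?addr0// => i ij.
by rewrite evecE eq_sym (negbTE ij) mulr0.
Qed.

Lemma sum_chart_r u : \sum_i u 0 i * chart_r (evec i) = chart_r u.
Proof. by rewrite chart_rE -[RHS]sum_evec; apply: eq_bigr => i _; rewrite chart_rE. Qed.

Lemma sum_dot_chart u (w : 'rV[R]_d) :
  \sum_i u 0 i * dotv (chart_x (evec i)) w = dotv (chart_x u) w.
Proof.
rewrite /dotv; under eq_bigr do rewrite mulr_sumr.
rewrite exchange_big; apply: eq_bigr => k _ /=.
rewrite chart_xE -(sum_evec u (lshift 1 k)) mulr_suml; apply: eq_bigr => i _.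
by rewrite chart_xE mulrA.
Qed.

Lemma dotvC m (a b : 'rV[R]_m) : dotv a b = dotv b a.
Proof. by apply: eq_bigr => i _; rewrite mulrC. Qed.

Lemma gramE p i j : gram cone_metric p i j =
  chart_r p ^+ 2 * dotv (chart_x (evec i)) (chart_x (evec j)) +
  chart_r (evec i) * chart_r (evec j).
Proof. by rewrite mxE. Qed.

Lemma gram_block p : gram cone_metric p = block_mx ((chart_r p ^+ 2)%:M) 0 0 1%:M.
Proof.
have d1 (i j : 'I_d) : dotv (chart_x (evec (lshift 1 i) : 'rV[R]_n))
    (chart_x (evec (lshift 1 j) : 'rV[R]_n)) = (i == j)%:R.
  rewrite -[RHS]evecE -(sum_evec (evec j : 'rV[R]_d) i) dotvC; apply: eq_bigr => k _.
  rewrite !chart_xE !evecE !eq_lshift; case: (k =P i) => [->|ki]; rewrite ?eqxx//.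
  by case: (i =P k) => [ik|_]; rewrite ?mulr0//; rewrite ik in ki.
have d2 (u : 'rV[R]_d) i : dotv u (chart_x (evec (rshift d i) : 'rV[R]_n)) = 0.
  rewrite /dotv big1// => k _; rewrite chart_xE evecE.
  by rewrite eq_lrshift mulr0.
have r1 (i : 'I_d) : chart_r (evec (lshift 1 i) : 'rV[R]_n) = 0.
  by rewrite chart_rE evecE eq_rlshift.
have r2 (i : 'I_1) : chart_r (evec (rshift d i) : 'rV[R]_n) = 1.
  by rewrite chart_rE evecE eq_rshift !ord1 eqxx.
apply/matrixP => i j; rewrite gramE.
case: (split_ordP i) => i' ->; case: (split_ordP j) => j' ->.
- by rewrite block_mxEul d1 r1 mul0r addr0 !mxE mulr_natr.
- by rewrite block_mxEur d2 r1 mul0r mulr0 addr0 mxE.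
- by rewrite block_mxEdl dotvC d2 r1 !mulr0 addr0 mxE.
- by rewrite block_mxEdr d2 !r2 mulr0 add0r mulr1 !mxE !ord1 eqxx.
Qed.

Lemma gram_unit p : chart_r p != 0 -> gram cone_metric p \in unitmx.
Proof.
move=> p0; rewrite gram_block unitmxE det_ublock det_scalar det1 mulr1 unitfE.
by rewrite !expf_neq0.
Qed.

Lemma derive_gram p u i j : 'D_u (fun q => gram cone_metric q i j) p =
  2 * chart_r p * chart_r u * dotv (chart_x (evec i)) (chart_x (evec j)).
Proof.
pose D := dotv (chart_x (evec i)) (chart_x (evec j : 'rV[R]_n)).
pose k := chart_r (evec i) * chart_r (evec j : 'rV[R]_n).
have c := C1_with_coord 0 (rshift d 0) (@C1_with_id R 'rV[R]_n).
have := C1_withD (C1_withM (C1_withM c c) (C1_with_cst D)) (C1_with_cst k).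
move=> [/(_ p) h _]; have := @is_derive_diff _ _ _ _ _ _ u h.
rewrite (_ : (fun q => gram cone_metric q i j) =
  (fun q : 'rV[R]_n => q 0 (rshift d 0) * q 0 (rshift d 0) * D + k)).
  by move=> [_ ->]; rewrite !chart_rE /D; ring.
by apply/funext => q; rewrite gramE chart_rE expr2.
Qed.

(** Instead of computing the inverse of the Gram matrix, the announced vector [z] is shown to
    satisfy [G z = w], with [w] the contraction of the Christoffel symbols lowered by the metric;
    applying the inverse of [G] then gives the claim. *)
Lemma christoffel_cone p u k : chart_r p != 0 ->
  \sum_i \sum_j christoffel cone_metric p k i j * u 0 i * u 0 j =
  row_mx ((2 * chart_r u / chart_r p) *: chart_x u)
    (const_mx (- chart_r p * dotv (chart_x u) (chart_x u)) : 'rV[R]_1) 0 k.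
Proof.
move=> p0; set z := row_mx _ _.
pose G := gram cone_metric p.
pose w l := chart_r p * (2 * chart_r u * dotv (chart_x u) (chart_x (evec l : 'rV[R]_n))
   - chart_r (evec l : 'rV[R]_n) * dotv (chart_x u) (chart_x u)).
pose c i := chart_r (evec i : 'rV[R]_n).
pose D i j := dotv (chart_x (evec i)) (chart_x (evec j : 'rV[R]_n)).
have Gz l : (G *m z^T) l 0 = w l.
  have -> : (G *m z^T) l 0 = cone_metric p (evec l) z.
    rewrite /cone_metric mxE dotvC -(sum_dot_chart z) -(sum_chart_r z) !mulr_sumr -big_split /=.
    by apply: eq_bigr => j _; rewrite gramE mxE dotvC; ring.
  have zx : chart_x z = (2 * chart_r u / chart_r p) *: chart_x u by rewrite /chart_x row_mxKl.
  have zr : chart_r z = - chart_r p * dotv (chart_x u) (chart_x u).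
    by rewrite /chart_r row_mxKr mxE.
  rewrite /cone_metric zr zx /w.
  have -> : dotv (chart_x (evec l)) ((2 * chart_r u / chart_r p) *: chart_x u) =
      (2 * chart_r u / chart_r p) * dotv (chart_x u) (chart_x (evec l)).
    rewrite dotvC /dotv mulr_sumr; apply: eq_bigr => i _.
    by rewrite mulrA; congr (_ * _); rewrite mxE.
  by field.
have -> : z 0 k = \sum_l invmx G k l * w l.
  have -> : z 0 k = (invmx G *m (G *m z^T)) k 0.
    by rewrite (mulKmx (gram_unit p0)) [RHS]mxE.
  by rewrite mxE; apply: eq_bigr => l _; rewrite Gz.
(* Only [r^2] varies in the metric, so each derivative of the Gram matrix is [2 r] times a radial
   component [c] times a horizontal inner product [D]; half their signed sum is the symbol of the
   first kind. *)
have ww l : w l = \sum_i \sum_j chart_r p * (c i * D j l + c j * D i l - c l * D i j) * u 0 i * u 0 j.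
  have e1 : \sum_i \sum_j (u 0 i * c i) * (u 0 j * D j l) = chart_r u * dotv (chart_x u) (chart_x (evec l)).
    under eq_bigr do rewrite -mulr_sumr sum_dot_chart.
    by rewrite -mulr_suml sum_chart_r.
  have e2 : \sum_i \sum_j (u 0 i * D i l) * (u 0 j * c j) = chart_r u * dotv (chart_x u) (chart_x (evec l)).
    under eq_bigr do rewrite -mulr_sumr sum_chart_r.
    by rewrite -mulr_suml sum_dot_chart mulrC.
  have e3 : \sum_i \sum_j (u 0 i * (u 0 j * D j i)) = dotv (chart_x u) (chart_x u).
    under eq_bigr do rewrite -mulr_sumr sum_dot_chart dotvC.
    by rewrite sum_dot_chart.
  have Dc i j : D j i = D i j by exact: dotvC.
  rewrite /w -mulrA mulrBr.
  have -> : chart_r p * (2 * (chart_r u * dotv (chart_x u) (chart_x (evec l)))) =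
     chart_r p * (\sum_i \sum_j (u 0 i * c i) * (u 0 j * D j l)) +
     chart_r p * (\sum_i \sum_j (u 0 i * D i l) * (u 0 j * c j)) by rewrite e1 e2; ring.
  clearbody D; rewrite -e3 -/(c l) mulrA !mulr_sumr -big_split -sumrB /=; apply: eq_bigr => i _.
  rewrite !mulr_sumr -big_split -sumrB /=; apply: eq_bigr => j _.
  by rewrite (Dc i j); ring.
transitivity (\sum_i \sum_j \sum_l invmx G k l *
    (chart_r p * (c i * D j l + c j * D i l - c l * D i j) * u 0 i * u 0 j)).
  apply: eq_bigr => i _; apply: eq_bigr => j _.
  rewrite /christoffel -mulrA -mulrA mulr_suml mulr_sumr; apply: eq_bigr => l _.
  rewrite !derive_gram -/(c i) -/(c j) -/(c l) -/(D j l) -/(D i l) -/(D i j) -/G.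
  by field.
under eq_bigr do rewrite exchange_big /=.
rewrite exchange_big /=; apply: eq_bigr => l _; rewrite ww mulr_sumr.
by apply: eq_bigr => i _; rewrite mulr_sumr.
Qed.

Lemma is_derive_row_mx (x : R -> 'rV[R]_d) (r : R -> R) (t : R) V s :
  is_derive t 1 x V -> is_derive t 1 r s ->
  is_derive t 1 (fun t => row_mx (x t) (const_mx (r t) : 'rV[R]_1)) (row_mx V (const_mx s)).
Proof.
move=> dx dr; apply: is_derive_row => i.
case: (split_ordP i) => j ->.
  rewrite row_mxEl; have := is_derive_coord j dx.
  by congr is_derive; apply/funext => u; rewrite row_mxEl.
rewrite row_mxEr mxE; move: dr; congr is_derive.
by apply/funext => u; rewrite row_mxEr mxE.
Qed.

(** The derivatives of [x] and [r] are given near [t], not only at [t], because [covariant_accel]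
    differentiates [derive1 q]. *)
Lemma covariant_accel_cone (x V : R -> 'rV[R]_d) (r s : R -> R) (t : R) V' s' :
  r t != 0 ->
  (\forall y \near t, is_derive (y : R) 1 x (V y)) -> (\forall y \near t, is_derive (y : R) 1 r (s y)) ->
  is_derive t 1 V V' -> is_derive t 1 s s' ->
  let q y := row_mx (x y) (const_mx (r y) : 'rV[R]_1) in
  covariant_accel cone_metric q t =
  row_mx (V' + (2 * s t / r t) *: V t)
         (const_mx (s' - r t * dotv (V t) (V t)) : 'rV[R]_1).
Proof.
move=> r0 dx dr dV ds q.
have dq : \forall u \near t, derive1 q u = row_mx (V u) (const_mx (s u) : 'rV[R]_1).
  apply: filterS2 dx dr => u dxu dru.
  by rewrite derive1E; have [_ ->] := is_derive_row_mx dxu dru.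
have dqt : derive1 q t = row_mx (V t) (const_mx (s t) : 'rV[R]_1) by exact: nbhs_singleton dq.
have ddq : derive1 (derive1 q) t = row_mx V' (const_mx s' : 'rV[R]_1).
  rewrite derive1E (near_eq_derive _ dq).
  by have [_ ->] := is_derive_row_mx dV ds.
have rq : chart_r (q t) = r t by rewrite /chart_r row_mxKr mxE.
have rq0 : chart_r (q t) != 0 by rewrite rq.
apply/rowP => k; rewrite mxE ddq (christoffel_cone _ _ rq0) dqt rq.
rewrite [chart_x _]row_mxKl [chart_r (row_mx _ _)]mxE row_mxEr [const_mx _ 0 _]mxE.
case: (split_ordP k) => j ->; rewrite ?row_mxEl ?row_mxEr.
  by rewrite [RHS]mxE.
by rewrite !mxE mulNr.
Qed.

End ConeConnection.

(** * Coordinates and maps of the cone *)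

Section ConePoints.
Context {R : realType} {d : nat}.
Notation E := 'rV[R]_d.
Notation cone := (cone R d).
Implicit Types (c : cone) (x : E) (r : {nonneg R}).

Lemma cone_relP (p q : half_space R d) : reflect (\pi_cone p = \pi_cone q :> cone)
  ((p == q) || ((p.2%:num == 0) && (q.2%:num == 0))).
Proof. exact: (@eqmodP _ (cone_rel R d) p q). Qed.

Lemma cone_mk_repr c : cone_mk (cone_x c) (repr c).2 = c.
Proof.
rewrite /cone_mk /cone_x -[RHS]reprK; congr (\pi_cone _).
by case: (repr c).
Qed.

Lemma cone_mkP x r : cone_r (cone_mk x r) = r%:num /\
  (r%:num != 0 -> cone_x (cone_mk x r) = x).
Proof.
have /cone_relP := reprK (cone_mk x r); rewrite /cone_r /cone_x.
by move=> /orP[/eqP ->//|/andP[/eqP -> /eqP /= ->]]; rewrite eqxx.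
Qed.

Lemma cone_mk_r x r : cone_r (cone_mk x r) = r%:num. Proof. by have [] := cone_mkP x r. Qed.

Lemma cone_mk_x x r : r%:num != 0 -> cone_x (cone_mk x r) = x.
Proof. by have [] := cone_mkP x r. Qed.

Lemma cone_mk0 x y r s : r%:num = 0 -> s%:num = 0 -> cone_mk x r = cone_mk y s.
Proof. by move=> r0 s0; apply/cone_relP; rewrite /= r0 s0 eqxx orbT. Qed.

Lemma vertexE c : (c == vertex R d) = (cone_r c == 0).
Proof.
rewrite -[in LHS](cone_mk_repr c); apply/eqP/eqP => [h|h]; last exact: cone_mk0.
by rewrite -(cone_mk_repr c) h cone_mk_r.
Qed.

(** Unlike the coordinates of [cone_x], these products are continuous across the vertex; together
    with [cone_r] they separate the points of the cone. *)
Definition cone_moment i c : R := cone_r c * cone_x c 0 i.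

Lemma cone_mk_moment x r i : cone_moment i (cone_mk x r) = r%:num * x 0 i.
Proof.
rewrite /cone_moment cone_mk_r; have [->|r0] := eqVneq r%:num 0.
  by rewrite !mul0r.
by rewrite cone_mk_x.
Qed.

Lemma cone_eq c c' : cone_r c = cone_r c' ->
  (forall i, cone_moment i c = cone_moment i c') -> c = c'.
Proof.
rewrite -(cone_mk_repr c) -(cone_mk_repr c') !cone_mk_r => rr h.
have [r0|r0] := eqVneq (repr c).2%:num 0; first by apply: cone_mk0; rewrite -?rr.
have -> : (repr c).2 = (repr c').2 by exact: val_inj.
congr cone_mk; apply/rowP => i; have := h i; rewrite !cone_mk_moment rr.
by apply: mulfI; rewrite -rr.
Qed.

Lemma half_space_fst_continuous : continuous (fun h : half_space R d => h.1 : E).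
Proof.
move=> h; apply: (@continuous_compf _ _ _ fst
  (fun h : half_space R d => (h.1 : E, h.2%:num : R)) h cvg_fst).
exact: initial_continuous.
Qed.

Lemma half_space_snd_continuous : continuous (fun h : half_space R d => h.2%:num : R).
Proof.
move=> h; apply: (@continuous_compf _ _ _ snd
  (fun h : half_space R d => (h.1 : E, h.2%:num : R)) h cvg_snd).
exact: initial_continuous.
Qed.

Lemma half_space_continuous {T : topologicalType} (f : T -> half_space R d) :
  continuous (fun t => (f t).1 : E) -> continuous (fun t => (f t).2%:num : R) -> continuous f.
Proof.
move=> c1 c2; apply/continuousP => A [B oB <-].
have c : continuous (fun t => ((f t).1 : E, (f t).2%:num : R)).
  by move=> t; exact: continuous_pair (c1 t) (c2 t).
by move/continuousP/(_ B oB): c.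
Qed.

Lemma cone_r_continuous : continuous (@cone_r R d).
Proof.
apply/quotient_continuous.
rewrite (_ : _ \o _ = fun h : half_space R d => h.2%:num : R).
  exact: half_space_snd_continuous.
by apply/funext => -[x r]; exact: cone_mk_r.
Qed.

Lemma cone_moment_continuous i : continuous (cone_moment i).
Proof.
apply/quotient_continuous.
rewrite (_ : _ \o _ = fun h : half_space R d => h.2%:num * (h.1 : E) 0 i).
  move=> h; have := continuousM (half_space_snd_continuous (x := h))
    (@continuous_coord _ _ _ _ _ h 0 i (half_space_fst_continuous (x := h))).
  by [].
by apply/funext => -[x r]; exact: cone_mk_moment.
Qed.

Definition scale_nng (k : {posnum R}) (r : {nonneg R}) : {nonneg R} :=
  (k%:num * r%:num)%:nng.

Definition map_cone (f : E -> E) (k : E -> {posnum R}) c : cone :=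
  cone_mk (f (cone_x c)) (scale_nng (k (cone_x c)) (repr c).2).

Lemma map_cone_mk f k x r :
  map_cone f k (cone_mk x r) = cone_mk (f x) (scale_nng (k x) r).
Proof.
have r2 : (repr (cone_mk x r)).2%:num = r%:num by exact: cone_mk_r.
rewrite /map_cone; have [r0|r0] := eqVneq r%:num 0.
  by apply: cone_mk0; rewrite /= ?r2 r0 mulr0.
by rewrite cone_mk_x//; congr cone_mk; apply: val_inj; rewrite /= r2.
Qed.

Lemma map_cone_continuous f k : continuous f -> continuous (fun x => (k x)%:num) ->
  continuous (map_cone f k).
Proof.
move=> cf ck; apply/quotient_continuous.
pose g (h : half_space R d) : half_space R d :=
  (f h.1, scale_nng (k h.1) h.2).
rewrite (_ : _ \o _ = \pi_cone \o g); last by apply/funext => -[x r]; exact: map_cone_mk.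
have cg : continuous g.
  apply: half_space_continuous => h.
    exact: (@continuous_compf _ _ _ f _ h (cf _) (half_space_fst_continuous (x := h))).
  have c1 : {for h, continuous (fun h : half_space R d => (k h.1)%:num)}.
    exact: (@continuous_compf _ _ _ (fun x => (k x)%:num) _ h (ck _) (half_space_fst_continuous (x := h))).
  by have := continuousM c1 (half_space_snd_continuous (x := h)).
move=> h; apply: (@continuous_compf _ _ _ \pi_cone g h _ (cg h)); exact: pi_continuous.
Qed.

Lemma cone_mk_continuous r : continuous (fun x => cone_mk x r).
Proof.
have cg : continuous (fun x : E => (x, r) : half_space R d).
  by apply: half_space_continuous => x; [exact: cvg_id|exact: cst_continuous].
move=> x; apply: (@continuous_compf _ _ _ \pi_cone _ x _ (cg x)); exact: pi_continuous.
Qed.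

(** [cone_x] need not be continuous at the vertex, where its value is arbitrary. The preimage of an
    open set is an open set off the vertex, joined by the measurable set [r = 0] exactly when that
    value belongs to the open set. *)
Lemma measurable_cone_x :
  measurable_fun [set: borel cone] (@cone_x R d : borel cone -> borel E).
Proof.
apply: (@measurability _ _ (borel cone) (borel E) setT (@cone_x R d) (@open E)) => //.
move=> _ [U oU <-]; rewrite setTI.
have mO : measurable ([set c | cone_r c != 0 /\ U (cone_x c)] : set (borel cone)).
  apply: open_borel; rewrite /open /= /quotient_open.
  rewrite (_ : _ @^-1` _ = (fun h : half_space R d => h.2%:num : R) @^-1` [set s : R | s != 0] `&`
     (fun h : half_space R d => h.1 : E) @^-1` U).
    apply: openI.
      by apply: open_comp (@open_neq R 0) => h _; exact: half_space_snd_continuous.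
    by apply: open_comp oU => h _; exact: half_space_fst_continuous.
  apply/seteqP; split=> -[x r] /=; rewrite -/(cone_mk x r) cone_mk_r.
    by move=> [r0]; rewrite cone_mk_x.
  by move=> [r0 ?]; rewrite cone_mk_x.
have m0 : measurable (@cone_r R d @^-1` [set 0] : set (borel cone)).
  by rewrite -[X in measurable X]setTI; apply: (continuous_borel_R cone_r_continuous).
have [Uv|Uv] := pselect (U (cone_x (vertex R d))).
  rewrite (_ : _ @^-1` _ = [set c | cone_r c != 0 /\ U (cone_x c)] `|` (@cone_r R d @^-1` [set 0])).
    exact: measurableU.
  apply/seteqP; split=> c /=.
    by move=> Uc; have [->|c0] := eqVneq (cone_r c) 0; [right|left].
  by move=> [[]//|/eqP]; rewrite -vertexE => /eqP ->.
rewrite (_ : _ @^-1` _ = [set c | cone_r c != 0 /\ U (cone_x c)])//.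
apply/seteqP; split=> c /=; last by case.
move=> Uc; split=> //; apply/negP; rewrite -vertexE => /eqP cv.
by apply: Uv; rewrite -cv.
Qed.

End ConePoints.

(** * Acceleration along the flow *)

Section SlabPaths.
Context {R : realType} {d : nat} {V : normedModType R}.
Notation E := 'rV[R]_d.
Variables (f : R -> E -> V) (Df : R * E -> R * E -> V).
Hypothesis f_C1 : slab_C1 (fun p => f p.1 p.2) (clamped f) Df.

Lemma near_interior (t : R) : t \in `]0, 1[ -> \forall s \near t, (s : R) \in `]0, 1[.
Proof. by move=> t01; apply: near_in_itvoo. Qed.

Lemma slab_C1_path (y : R -> E) (t : R) dy : t \in `]0, 1[ -> is_derive t 1 y dy ->
  is_derive t 1 (fun s => clamped f (s, y s)) (Df (t, y t) (1, dy)).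
Proof.
move=> t01 dyt; have [_ _ _ dD] := f_C1.
apply: near_eq_is_derive (is_derive_graph dyt (dD t (y t) t01)); apply: filterS (near_interior t01) => s s01.
by rewrite /clamped /= clamp01_id//; exact: subset_itv_oo_cc.
Qed.

Lemma slab_C1_pair (t : R) x w : t \in `]0, 1[ ->
  Df (t, x) (1, w) = Df (t, x) (1, 0) + Df (t, x) (0, w).
Proof.
move=> t01; have [_ _ _ /(_ t x t01)[_ <-]] := f_C1.
by rewrite -linearD; congr ('d _ _ _); congr pair; rewrite ?addr0 ?add0r.
Qed.

End SlabPaths.

Section Accelerations.
Context {R : realType} {d : nat}.
Notation E := 'rV[R]_d.
Variables (v : R -> E -> E) (alpha : R -> E -> R).
Variables (Dv : R * E -> R * E -> E) (Da : R * E -> R * E -> R).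
Hypothesis v_C1 : slab_C1 (fun p => v p.1 p.2) (clamped v) Dv.
Hypothesis a_C1 : slab_C1 (fun p => alpha p.1 p.2) (clamped alpha) Da.
Hypothesis v_grad : forall (t : R) x, t \in `[0, 1] -> v t x = grad (alpha t) x.

Definition accel_density (t : R) x : R :=
  dotv (accel_v v alpha t x) (accel_v v alpha t x) + 4 * accel_alpha alpha t x ^+ 2.

(** The derivatives in the acceleration are replaced by the extensions [Dv] and [Da], which agree
    with them at interior times. The result is continuous in space-time, which serves the joint
    measurability of the cost density. *)
Definition accel_v_ext p : E := Dv p (1, 0) +
  \sum_i clamped v p 0 i *: Dv p (0, evec i) + (4 * clamped alpha p) *: clamped v p.

Definition accel_alpha_ext p : R := Da p (1, 0) +
  2^-1 * dotv (clamped v p) (clamped v p) + 2 * clamped alpha p ^+ 2.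

Definition density_ext p : R :=
  dotv (accel_v_ext p) (accel_v_ext p) + 4 * accel_alpha_ext p ^+ 2.

Lemma clampedE {V} (f : R -> E -> V) (t : R) x : t \in `]0, 1[ -> clamped f (t, x) = f t x.
Proof. by move=> t01; rewrite /clamped /= clamp01_id//; exact: subset_itv_oo_cc. Qed.

Lemma v_diffE (t : R) x w : t \in `]0, 1[ -> Dv (t, x) (0, w) = w *m 'J (v t) x.
Proof.
move=> t01; have [/(_ x) h _] := slab_C1_section v_C1 t01; have [dif _] := h.
by rewrite -deriveEjacobian//; have [_ ->] := is_derive_diff w h.
Qed.

Lemma a_diffE (t : R) x w : t \in `]0, 1[ -> Da (t, x) (0, w) = dotv (v t x) w.
Proof.
move=> t01; have c := slab_C1_section a_C1 t01.
rewrite (diff_rV_sum c) /dotv; apply: eq_bigr => i _.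
rewrite v_grad; last exact: subset_itv_oo_cc.
by rewrite mxE mulrC; have [_ ->] := is_derive_diff (evec i) (c.1 x).
Qed.

Lemma accel_v_extE (t : R) x : t \in `]0, 1[ -> accel_v_ext (t, x) = accel_v v alpha t x.
Proof.
move=> t01; rewrite /accel_v_ext /accel_v !clampedE//.
have := slab_C1_time x v_C1 t01; rewrite derive1E => -[_ ->].
by rewrite -v_diffE// (diff_rV_sum (slab_C1_section v_C1 t01)).
Qed.

Lemma accel_alpha_extE (t : R) x : t \in `]0, 1[ ->
  accel_alpha_ext (t, x) = accel_alpha alpha t x.
Proof.
move=> t01; rewrite /accel_alpha_ext /accel_alpha !clampedE//.
have := slab_C1_time x a_C1 t01; rewrite derive1E => -[_ ->].
by rewrite v_grad//; exact: subset_itv_oo_cc.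
Qed.

Lemma density_extE (t : R) x : t \in `]0, 1[ -> density_ext (t, x) = accel_density t x.
Proof. by move=> t01; rewrite /density_ext accel_v_extE// accel_alpha_extE. Qed.

Lemma continuous_dotv {T : topologicalType} n (f g : T -> 'rV[R]_n) :
  continuous f -> continuous g -> continuous (fun t => dotv (f t) (g t)).
Proof.
move=> cf cg t; apply: continuous_bigsum => i.
by have := continuousM (@continuous_coord _ _ _ _ f t 0 i (cf t)) (@continuous_coord _ _ _ _ g t 0 i (cg t)).
Qed.

Lemma accel_v_ext_continuous : continuous accel_v_ext.
Proof.
have [cv _ cDv _] := v_C1; have [ca _ _ _] := a_C1.
move=> p.
have c2 : {for p, continuous (fun p => \sum_i clamped v p 0 i *: Dv p (0, evec i))}.
  apply: continuous_bigsum => i.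
  by have := continuousZ (@continuous_coord _ _ _ _ (clamped v) p 0 i (cv p)) (cDv (0, evec i) p).
have c3 := continuousZ (continuousM (@cst_continuous _ _ (4 : R) p) (ca p)) (cv p).
by have := continuousD (continuousD (cDv (1, 0) p) c2) c3.
Qed.

Lemma accel_alpha_ext_continuous : continuous accel_alpha_ext.
Proof.
have [cv _ _ _] := v_C1; have [ca _ cDa _] := a_C1.
move=> p.
have c1 := continuousM (@cst_continuous _ _ (2^-1 : R) p) (continuous_dotv cv cv (x := p)).
have c2 := continuousM (@cst_continuous _ _ (2 : R) p) (continuousM (ca p) (ca p)).
by have := continuousD (continuousD (cDa (1, 0) p) c1) c2.
Qed.

Lemma density_ext_continuous : continuous density_ext.
Proof.
move=> p.
have c1 := continuous_dotv accel_v_ext_continuous accel_v_ext_continuous (x := p).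
have c := accel_alpha_ext_continuous (x := p).
by have := continuousD c1 (continuousM (@cst_continuous _ _ (4 : R) p) (continuousM c c)).
Qed.

Variables (X : R -> E -> E) (A : R -> E -> R).
Hypothesis dX : forall (t : R) x, t \in `[0, 1] -> is_derive t 1 (X^~ x) (clamped v (t, X t x)).
Hypothesis dA : forall (t : R) x, t \in `[0, 1] -> is_derive t 1 (A^~ x) (clamped alpha (t, X t x)).

Lemma is_derive_expRA (t c : R) x : t \in `[0, 1] ->
  is_derive t 1 (fun s => expR (2 * A s x) * c)
    (2 * clamped alpha (t, X t x) * (expR (2 * A t x) * c)).
Proof.
move=> t01.
have d4 : is_derive t 1 (fun s => 2 * A s x) (2 * clamped alpha (t, X t x)).
  by have := dA x t01; exact: is_deriveZ.
have d5 : is_derive t 1 (fun s => expR (2 * A s x))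
    (2 * clamped alpha (t, X t x) * expR (2 * A t x)).
  by have := is_diff_path d4 (is_diff_derive (is_derive_expR (2 * A t x))).
apply: is_derive_eq (is_deriveM d5 (is_derive_cst c t 1)) _.
by rewrite /GRing.scale /=; ring.
Qed.

Let V x (s : R) : E := clamped v (s, X s x).
Let rad c x (s : R) := expR (2 * A s x) * c.
Let S c x (s : R) := 2 * clamped alpha (s, X s x) * rad c x s.

Lemma is_derive_velocity (t : R) x : t \in `]0, 1[ ->
  is_derive t 1 (V x) (Dv (t, X t x) (1, V x t)).
Proof.
by move=> t01; have := slab_C1_path v_C1 t01 (dX x (subset_itv_oo_cc t01)).
Qed.

Lemma is_derive_radial (t c : R) x : t \in `]0, 1[ ->
  is_derive t 1 (S c x) (2 * Da (t, X t x) (1, V x t) * rad c x t +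
    2 * clamped alpha (t, X t x) * S c x t).
Proof.
move=> t01; have t01' := subset_itv_oo_cc t01.
have d1 := slab_C1_path a_C1 t01 (dX x t01').
have d2 : is_derive t 1 (fun s => 2 * clamped alpha (s, X s x)) (2 * Da (t, X t x) (1, V x t)).
  by have := d1; exact: is_deriveZ.
apply: is_derive_eq (is_deriveM d2 (is_derive_expRA c x t01')) _.
by rewrite /S /rad /GRing.scale /=; ring.
Qed.

(** Along the flow [r' = 2 alpha r], so [2 r' / r] supplies the term [4 alpha v]. Since
    [v = grad alpha], the derivative of [alpha] along [v] is [|v|^2]; thus [r''] contains
    [2 r |v|^2], and subtracting [r |v|^2] leaves [2 r accel_alpha]. *)
Lemma flow_acceleration (t c : R) x : t \in `]0, 1[ -> 0 < c ->
  let q s := row_mx (X s x) (const_mx (rad c x s) : 'rV[R]_1) in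
  let a := covariant_accel cone_metric q t in
  cone_metric (q t) a a = rad c x t ^+ 2 * accel_density t (X t x).
Proof.
move=> t01 c0 q a.
have r0 : rad c x t != 0 by rewrite mulf_neq0 ?gt_eqF ?expR_gt0.
have dXn : \forall s \near t, is_derive (s : R) 1 (X^~ x) (V x s).
  by apply: filterS (near_interior t01) => s s01; apply: dX; exact: subset_itv_oo_cc.
have drn : \forall s \near t, is_derive (s : R) 1 (rad c x) (S c x s).
  by apply: filterS (near_interior t01) => s s01; apply: is_derive_expRA; exact: subset_itv_oo_cc.
have aE := covariant_accel_cone r0 dXn drn (is_derive_velocity x t01) (is_derive_radial c x t01).
have e1 : Dv (t, X t x) (1, V x t) + (2 * S c x t / rad c x t) *: V x t = accel_v v alpha t (X t x).
  rewrite (slab_C1_pair v_C1)// /accel_v v_diffE//.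
  have := slab_C1_time (X t x) v_C1 t01; rewrite derive1E => -[_ ->].
  rewrite /V !clampedE//; congr (_ + _ *: _).
  by rewrite /S clampedE//; field.
have e2 : 2 * Da (t, X t x) (1, V x t) * rad c x t + 2 * clamped alpha (t, X t x) * S c x t -
    rad c x t * dotv (V x t) (V x t) = 2 * rad c x t * accel_alpha alpha t (X t x).
  rewrite (slab_C1_pair a_C1)// a_diffE// /accel_alpha -v_grad; last exact: subset_itv_oo_cc.
  have := slab_C1_time (X t x) a_C1 t01; rewrite derive1E => -[_ ->].
  by rewrite /S /V !clampedE//; field.
have {}aE : a = row_mx (accel_v v alpha t (X t x))
    (const_mx (2 * rad c x t * accel_alpha alpha t (X t x)) : 'rV[R]_1).
  by rewrite -e1 -e2; exact: aE.
rewrite aE /cone_metric /chart_r /chart_x row_mxKl !row_mxKr !mxE /accel_density.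
by ring.
Qed.

End Accelerations.

Section LipschitzAC.
Context {R : realType}.

Lemma lipschitz_abs_continuous {V : normedModType R} (f : R -> V) (L : R) : 0 <= L ->
  (forall s t : R, s \in `[0, 1] -> t \in `[0, 1] -> s <= t -> `|f t - f s| <= L * (t - s)) ->
  abs_continuous 0 1 f.
Proof.
move=> L0 fL e e0; have L1 : 0 < L + 1 by rewrite ltr_wpDl.
exists (e / (L + 1)); first by rewrite divr_gt0.
move=> n s t st _ /[!ltr_pdivlMr]// h; apply: le_lt_trans h.
apply: (@le_trans _ _ (\sum_i L * (t i - s i))).
  apply: ler_sum => i _; have [s0 [sti t1]] := st i.
  by apply: fL => //; rewrite in_itv /= ?s0 ?t1 ?(le_trans s0) ?(le_trans sti).
rewrite -mulr_sumr mulrC ler_wpM2l//; last by rewrite lerDl.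
by apply: sumr_ge0 => i _; rewrite subr_ge0; have [_ []] := st i.
Qed.

Lemma lipschitz01 (f g : R -> R) : continuous (f \o clamp01) -> continuous (g \o clamp01) ->
  (forall t : R, t \in `]0, 1[ -> is_derive t 1 f (g t)) ->
  exists2 L, 0 <= L & forall s t : R, s \in `[0, 1] -> t \in `[0, 1] -> s <= t ->
    `|f t - f s| <= L * (t - s).
Proof.
move=> cf cg df.
(* In dimension 0 the cylinder over [[0, 1]] is [[0, 1]] itself, so [cylinder_bound] bounds [g]
   there. *)
have cg2 : continuous (fun p : R * 'rV[R]_0 => g (clamp01 p.1)).
  by move=> p; exact: (@continuous_compf _ _ _ (g \o clamp01) fst p (cg _) cvg_fst).
have [L L0 HL] := cylinder_bound 0 cg2.
exists L => // s t s01 t01 st.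
have sub (u : R) : u \in `]s, t[ -> u \in `]0, 1[.
  move: s01 t01; rewrite !in_itv /= => /andP[s0 _] /andP[_ t1] /andP[su ut].
  by rewrite (le_lt_trans s0 su) (lt_le_trans ut t1).
have dF (u : R) : u \in `]s, t[ -> is_derive u 1 (f \o clamp01) (g u).
  move=> /sub u01; apply: near_eq_is_derive (df u u01).
  apply: filterS (near_interior u01) => w w01.
  by rewrite /= clamp01_id//; exact: subset_itv_oo_cc.
have dl (u : R) : is_derive u 1 (fun u : R => L * u) L.
  exact: is_derive_scale.
have := norm_le_of_derive st (continuous_subspaceT cf)
  (within_continuous_derive (fun u _ => dl u)) dF (fun u _ => dl u).
rewrite /= !clamp01_id// mulrBr; apply=> u /sub u01.
have := HL u 0 (subset_itv_oo_cc u01); rewrite /= clamp01_id ?normr0//.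
  by apply.
exact: subset_itv_oo_cc.
Qed.

Lemma lipschitz01_row n (f g : R -> 'rV[R]_n) :
  continuous (f \o clamp01) -> continuous (g \o clamp01) ->
  (forall t : R, t \in `]0, 1[ -> is_derive t 1 f (g t)) ->
  exists2 L, 0 <= L & forall s t : R, s \in `[0, 1] -> t \in `[0, 1] -> s <= t ->
    `|f t - f s| <= L * (t - s).
Proof.
move=> cf cg df.
have [i L L' LL h s t s01 t01 st|i|L L0 hL] := @common_bound R n (fun i L =>
  forall s t : R, s \in `[0, 1] -> t \in `[0, 1] -> s <= t -> `|f t 0 i - f s 0 i| <= L * (t - s)).
- by apply: le_trans (h s t s01 t01 st) _; rewrite ler_wpM2r ?subr_ge0.
- apply: (@lipschitz01 (fun s => f s 0 i) (fun s => g s 0 i)).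
  + by move=> t; exact: (@continuous_coord _ _ _ _ (f \o clamp01) t 0 i (cf t)).
  + by move=> t; exact: (@continuous_coord _ _ _ _ (g \o clamp01) t 0 i (cg t)).
  + by move=> t t01; exact: is_derive_coord (df t t01).
- exists L => // s t s01 t01 st; apply: rV_norm_le; first by rewrite mulr_ge0 ?subr_ge0.
  by move=> i; rewrite coordB; exact: hL.
Qed.

Lemma covariant_accel_near n g (q q' : R -> 'rV[R]_n) (t : R) :
  (\forall s \near t, q s = q' s) -> covariant_accel g q t = covariant_accel g q' t.
Proof.
move=> qq; have d1 : \forall s \near t, derive1 q s = derive1 q' s.
  apply: filterS (nbhs_interior qq) => s h.
  by rewrite !derive1E; exact: near_eq_derive.
rewrite /covariant_accel (nbhs_singleton qq) (nbhs_singleton d1).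
by rewrite [derive1 (derive1 q) t]derive1E (near_eq_derive _ d1) -derive1E.
Qed.

End LipschitzAC.

(** * The flow as a map from the cone to paths *)

Section FlowPaths.
Context {R : realType} {d : nat}.
Notation E := 'rV[R]_d.
Variables (v : R -> E -> E) (alpha : R -> E -> R).
Variables (Dv : R * E -> R * E -> E) (Da : R * E -> R * E -> R).
Hypothesis v_C1 : slab_C1 (fun p => v p.1 p.2) (clamped v) Dv.
Hypothesis a_C1 : slab_C1 (fun p => alpha p.1 p.2) (clamped alpha) Da.
Hypothesis v_grad : forall (t : R) x, t \in `[0, 1] -> v t x = grad (alpha t) x.
Variables (X : R -> E -> E) (A : R -> E -> R).
Hypothesis dX : forall (t : R) x, t \in `[0, 1] -> is_derive t 1 (X^~ x) (clamped v (t, X t x)).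
Hypothesis dA : forall (t : R) x, t \in `[0, 1] -> is_derive t 1 (A^~ x) (clamped alpha (t, X t x)).
Hypothesis cX : forall t : R, t \in `[0, 1] -> continuous (X t).
Hypothesis cA : forall t : R, t \in `[0, 1] -> continuous (A t).

Definition flow_radius (t : R) x : {posnum R} := PosNum (expR_gt0 (2 * A t x)).

Lemma flow_radiusE (t : R) x : (flow_radius t x)%:num = expR (2 * A t x).
Proof. by []. Qed.

Lemma clamped_path_continuous x : continuous (fun s : R => (clamp01 s, X (clamp01 s) x)).
Proof. move=> s; apply: (@continuous_pair _ _ _ (@clamp01 R) (fun s => X (clamp01 s) x) s).
  exact: continuous_clamp01.
exact: (path_continuous dX).
Qed.

Lemma clamped_weight_continuous x : continuous (fun s : R => A (clamp01 s) x).
Proof.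
apply: (@continuous_comp_within _ _ _ (@clamp01 R) `[0, 1]%classic (A^~ x)).
- apply: within_continuous_derive => s s01; exact: dA.
- exact: continuous_clamp01.
- by move=> s; exact: clamp01_in.
Qed.

(** The velocity along a trajectory has derivative [W] at interior times, and [W] is continuous up
    to the endpoints; so the velocity is Lipschitz on [[0, 1]], hence absolutely continuous. *)
Lemma flow_AC x : has_AC_derivative (X^~ x).
Proof.
have cy := @clamped_path_continuous x; have [cv _ cDv _] := v_C1.
split; first by apply: within_continuous_derive => s s01; exact: dX.
exists (fun s => clamped v (s, X s x)); last first.
  by move=> s s01; apply: dX; exact: subset_itv_oo_cc.
pose V (s : R) := clamped v (s, X s x).
pose W (s : R) := Dv (s, X s x) (1, 0) + \sum_i V s 0 i *: Dv (s, X s x) (0, evec i).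
have cV : continuous (V \o clamp01).
  move=> s; exact: (@continuous_compf _ _ _ (clamped v) (fun s => (clamp01 s, X (clamp01 s) x)) s (cv _) (cy s)).
have cD h : continuous (fun s : R => Dv (clamp01 s, X (clamp01 s) x) h).
  move=> s; exact: (@continuous_compf _ _ _ (Dv^~ h) (fun s => (clamp01 s, X (clamp01 s) x)) s (cDv h _) (cy s)).
have cW : continuous (W \o clamp01).
  move=> s.
  have c2 : {for s, continuous (fun s => \sum_i (V \o clamp01) s 0 i *:
      Dv (clamp01 s, X (clamp01 s) x) (0, evec i))}.
    apply: continuous_bigsum => i.
    by have := continuousZ (@continuous_coord _ _ _ _ (V \o clamp01) s 0 i (cV s)) (cD (0, evec i) s).
  by have := continuousD (cD (1, 0) s) c2.
have dV (s : R) : s \in `]0, 1[ -> is_derive s 1 V (W s).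
  move=> s01; apply: is_derive_eq (is_derive_velocity v_C1 dX x s01) _.
  by rewrite (slab_C1_pair v_C1)// (diff_rV_sum (slab_C1_section v_C1 s01)).
have [L L0 HL] := lipschitz01_row cV cW dV.
exact: lipschitz_abs_continuous L0 HL.
Qed.

Lemma radius_AC x (c : R) : has_AC_derivative (fun s => expR (2 * A s x) * c).
Proof.
have cy := @clamped_path_continuous x; have [cv _ _ _] := v_C1; have [ca _ cDa _] := a_C1.
have dr (s : R) : s \in `[0, 1] -> is_derive s 1 (fun s => expR (2 * A s x) * c)
    (2 * clamped alpha (s, X s x) * (expR (2 * A s x) * c)).
  exact: is_derive_expRA.
split; first by apply: within_continuous_derive => s s01; exact: dr.
exists (fun s => 2 * clamped alpha (s, X s x) * (expR (2 * A s x) * c)); last first.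
  by move=> s s01; apply: dr; exact: subset_itv_oo_cc.
pose a (s : R) := 2 * clamped alpha (s, X s x).
pose r (s : R) := expR (2 * A s x) * c.
pose V (s : R) := clamped v (s, X s x).
pose a' (s : R) := 2 * (Da (s, X s x) (1, 0) + \sum_i V s 0 i *: Da (s, X s x) (0, evec i)).
have ca' : continuous (a \o clamp01).
  move=> s; have c1 := @continuous_compf _ _ _ (clamped alpha) (fun s => (clamp01 s, X (clamp01 s) x)) s (ca _) (cy s).
  by have := continuousM (@cst_continuous _ _ (2 : R) s) c1.
have cr : continuous (r \o clamp01).
  move=> s; have c1 := continuousM (@cst_continuous _ _ (2 : R) s) (@clamped_weight_continuous x s).
  have c2 := @continuous_compf _ _ _ (@expR R) (fun s => 2 * A (clamp01 s) x) s (@continuous_expR R _) c1.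
  by have := continuousM c2 (@cst_continuous _ _ (c : R) s).
have cD h : continuous (fun s : R => Da (clamp01 s, X (clamp01 s) x) h).
  move=> s; exact: (@continuous_compf _ _ _ (Da^~ h) (fun s => (clamp01 s, X (clamp01 s) x)) s (cDa h _) (cy s)).
have cV : continuous (V \o clamp01).
  move=> s; exact: (@continuous_compf _ _ _ (clamped v) (fun s => (clamp01 s, X (clamp01 s) x)) s (cv _) (cy s)).
have ca2 : continuous (a' \o clamp01).
  move=> s.
  have c2 : {for s, continuous (fun s => \sum_i (V \o clamp01) s 0 i *:
      Da (clamp01 s, X (clamp01 s) x) (0, evec i))}.
    apply: continuous_bigsum => i.
    by have := continuousM (@continuous_coord _ _ _ _ (V \o clamp01) s 0 i (cV s)) (cD (0, evec i) s).
  by have := continuousM (@cst_continuous _ _ (2 : R) s) (continuousD (cD (1, 0) s) c2).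
pose S s := a s * r s; pose S' s := a' s * r s + a s * S s.
have cS : continuous (S \o clamp01).
  by move=> s; have := continuousM (ca' s) (cr s).
have cS' : continuous (S' \o clamp01).
  by move=> s; have := continuousD (continuousM (ca2 s) (cr s)) (continuousM (ca' s) (cS s)).
have dS (s : R) : s \in `]0, 1[ -> is_derive s 1 S (S' s).
  move=> s01; apply: is_derive_eq (is_derive_radial a_C1 dX dA c x s01) _.
  by rewrite (slab_C1_pair a_C1)// (diff_rV_sum (slab_C1_section a_C1 s01)).
have [L L0 HL] := lipschitz01 cS cS' dS.
exact: lipschitz_abs_continuous L0 HL.
Qed.

Definition flow_path (c : cone R d) (s : R) : cone R d :=
  map_cone (X (clamp01 s)) (flow_radius (clamp01 s)) c.

Lemma flow_path_AC1 c : flow_path c \in @AC1_path R d.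
Proof.
rewrite inE; split=> [t|]; first by rewrite /flow_path (_ : Num.max 0 (Num.min t 1) = clamp01 t)// (clamp01_id (clamp01_in t)).
exists (X^~ (cone_x c)), (fun s => scale_nng (flow_radius s (cone_x c)) (repr c).2).
split; [exact: flow_AC|exact: radius_AC|].
by move=> t t01; rewrite /flow_path clamp01_id.
Qed.

Definition flow_lift (c : borel (cone R d)) : mOmega R d := exist _ (flow_path c) (flow_path_AC1 c).

Lemma path_eval_flow_lift (t : R) c : t \in `[0, 1] ->
  path_eval t (flow_lift c) = map_cone (X t) (flow_radius t) c.
Proof. by move=> t01; rewrite /path_eval /= /flow_path clamp01_id. Qed.

Lemma flow_radius_continuous (t : R) : t \in `[0, 1] ->
  continuous (fun x => (flow_radius t x)%:num).
Proof.
move=> t01 x; have c1 := continuousM (@cst_continuous _ _ (2 : R) x) (cA t01 (x := x)).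
exact: (@continuous_compf _ _ _ (@expR R) _ x (@continuous_expR R _) c1).
Qed.

(** The sigma-algebra on paths is generated by the evaluations, and each evaluation composed with
    [flow_lift] is a continuous map of the cone. *)
Lemma measurable_flow_lift : measurable_fun setT flow_lift.
Proof.
apply: (@measurability _ _ _ _ setT flow_lift (@cylinders R d)) => //.
move=> _ [_ [t [B [t01 mB ->]]] <-]; rewrite setTI.
rewrite (_ : _ @^-1` _ = map_cone (X t) (flow_radius t) @^-1` B); last first.
  by apply/funext => c; rewrite /preimage /mkset path_eval_flow_lift.
rewrite -[X in measurable X]setTI.
exact: (continuous_borel (map_cone_continuous (cX t01) (flow_radius_continuous t01))).
Qed.

Lemma flow_lift_accel c (t : R) : t \in `]0, 1[ ->
  path_accel_sqnorm (flow_lift c) t = cone_r c ^+ 2 *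
    (expR (4 * A t (cone_x c)) * accel_density v alpha t (X t (cone_x c))).
Proof.
move=> t01; have t01' := subset_itv_oo_cc t01.
rewrite /path_accel_sqnorm vertexE path_eval_flow_lift// cone_mk_r /=.
set x := cone_x c; rewrite mulf_eq0 (gt_eqF (expR_gt0 _)) orFb -/(cone_r c).
have [->|r0] := eqVneq (cone_r c) 0; first by rewrite expr0n mul0r.
have rp : 0 < cone_r c.
  by rewrite lt_neqAle eq_sym r0; have : 0 <= (repr c).2%:num by [].
pose q s := row_mx (X s x) (const_mx (expR (2 * A s x) * cone_r c) : 'rV[R]_1).
have qn : \forall s \near t, cone_chart (path_eval s (flow_lift c)) = q s.
  apply: filterS (near_interior t01) => s s01.
  rewrite path_eval_flow_lift; last exact: subset_itv_oo_cc.
  rewrite /cone_chart cone_mk_r cone_mk_x//=.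
  by rewrite mulf_neq0// gt_eqF ?expR_gt0.
have qt := nbhs_singleton qn; rewrite path_eval_flow_lift// in qt.
rewrite (covariant_accel_near _ qn) qt.
rewrite (flow_acceleration v_C1 a_C1 v_grad dX dA x t01 rp).
have -> : 4 * A t x = 2 * A t x + 2 * A t x by ring.
by rewrite expRD; ring.
Qed.

End FlowPaths.

(** * Measurability on the path space *)

Section JointMeasurability.
Context {R : realType} {d : nat}.
Notation E := 'rV[R]_d.

(** A Caratheodory function is jointly measurable: rounding time down to multiples of [1 / (n + 1)]
    leaves, on each of countably many strips, a continuous function of [x] alone, and continuity in
    time gives the pointwise limit. *)
Lemma measurable_sections_continuous (G : R -> E -> R) :
  (forall t : R, t \in `[0, 1] -> continuous (G t)) ->
  (forall x, continuous (fun t => G (clamp01 t) x)) ->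
  measurable_fun setT (fun p : measurableTypeR R * borel E => G (clamp01 p.1) p.2).
Proof.
move=> cGx cGt.
pose k n (t : R) := Num.truncn (n.+1%:R * clamp01 t).
pose s n (t : R) : R := (k n t)%:R / n.+1%:R.
have u0 n (t : R) : 0 <= n.+1%:R * clamp01 t.
  by have := clamp01_in t; rewrite in_itv /= => /andP[h _]; rewrite mulr_ge0.
have s01 n (m : nat) (t : R) : k n t = m -> (m%:R / n.+1%:R : R) \in `[0, 1].
  move=> <-; rewrite in_itv /= divr_ge0//= ler_pdivrMr// mul1r.
  have /andP[h _] := truncn_itv (u0 n t); apply: le_trans h _.
  have := clamp01_in t; rewrite in_itv /= => /andP[_ h].
  by rewrite ler_piMr.
apply: (@measurable_fun_cvg _ _ _ _ (fun n (p : measurableTypeR R * borel E) => G (clamp01 (s n p.1)) p.2)).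
- move=> n _ B mB; rewrite setTI.
  pose q m : R := m%:R / n.+1%:R.
  have -> : (fun p : measurableTypeR R * borel E => G (clamp01 (s n p.1)) p.2) @^-1` B =
      \bigcup_m ([set t : measurableTypeR R | k n t = m] `*`
        [set x : borel E | q m \in `[0, 1] /\ B (G (q m) x)]).
    apply/seteqP; split=> -[t x] /=.
      move=> Bx; exists (k n t) => //=; have h := s01 n (k n t) t erefl.
      by split=> //; split=> //; move: Bx; rewrite /s clamp01_id.
    by move=> [m _ /= [km [h Bx]]]; rewrite /s km -/(q m) clamp01_id.
  apply: bigcupT_measurable => m; apply: measurableX.
    have cu : continuous (fun t : R => n.+1%:R * clamp01 t).
      by move=> t; have := continuousM (@cst_continuous _ _ (n.+1%:R : R) t) (@continuous_clamp01 R t).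
    rewrite (_ : [set t : measurableTypeR R | k n t = m] = (fun t => n.+1%:R * clamp01 t) @^-1` `[m%:R, m.+1%:R[).
      rewrite -[X in measurable X]setTI.
      by apply: (continuous_measurable_fun cu) => //; exact: measurable_itv.
    apply/seteqP; split=> t /=; rewrite in_itv /=.
      by move=> <-; exact: truncn_itv.
    by move=> h; apply: truncn_def.
  have [h|h] := boolP (q m \in `[0, 1]); last first.
    rewrite (_ : [set _ | _] = set0); first exact: measurable0.
    by apply/seteqP; split=> // x /= [].
  rewrite (_ : [set _ | _] = G (q m) @^-1` B).
    by rewrite -[X in measurable X]setTI; apply: (continuous_borel_R (cGx _ h)).
  by apply/seteqP; split=> x /=; [case|].
- move=> [t x] _ /=.
  have cs : s n t @[n --> \oo] --> clamp01 t.
    apply/cvgrPdist_le => e e0.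
    have := near_infty_natSinv_lt (PosNum e0).
    apply: filterS => n /= /ltW ne; apply: le_trans ne.
    have n0 : (0 : R) < n.+1%:R by [].
    have /andP[h1 h2] := truncn_itv (u0 n t).
    rewrite ger0_norm.
      rewrite lerBlDr /s -[X in X + _]mul1r -mulrDl ler_pdivlMr// mulrC ltW//.
      by rewrite addrC -[X in _ + X]/(1%:R) -natrD addn1.
    by rewrite subr_ge0 /s ler_pdivrMr// mulrC.
  have := @cvg_comp _ _ _ (fun n => s n t) (fun t => G (clamp01 t) x) _ _ _ cs (cGt x (clamp01 t)).
  by rewrite (clamp01_id (clamp01_in t)).
Qed.

End JointMeasurability.

Section ImageIntegral.
Context d1 d2 (T1 : measurableType d1) (T2 : measurableType d2) (R : realType).
Local Open Scope ereal_scope.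

(* F is not assumed measurable: on the measurable set of fixed points of
   Psi \o pi, which carries the push-forward, it agrees with the measurable
   function F \o Psi \o pi. *)
Lemma ge0_integral_pushforward_retract (m : {measure set T1 -> \bar R})
    (Psi : T1 -> T2) (pi : T2 -> T1) (F : T2 -> \bar R) :
  measurable_fun setT Psi -> measurable_fun setT pi ->
  measurable [set z | Psi (pi z) = z] ->
  (forall x, Psi (pi (Psi x)) = Psi x) ->
  (forall z, 0 <= F z) -> measurable_fun setT (F \o Psi) ->
  \int[pushforward m Psi]_z F z = \int[m]_x F (Psi x).
Proof.
move=> mPsi mpi mS PpP F0 mF; set S := [set z | _] in mS.
pose g z := F (Psi (pi z)).
have mg : measurable_fun setT g by exact: (measurableT_comp mF mpi).
have gPsi x : g (Psi x) = F (Psi x) by rewrite /g PpP.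
have SPsi x : S (Psi x) by exact: PpP.
have key h : measurable_fun setT h -> (forall z, 0 <= h z) -> (forall z, S z -> h z = g z) ->
    \int[pushforward m Psi]_z h z = \int[m]_x F (Psi x).
  move=> mh h0 hg; rewrite ge0_integral_pushforward//.
  by rewrite preimage_setT; apply: eq_integral => x _; rewrite /= hg.
(* [L <= F <= U] are measurable envelopes equal to [g] on [S]. Off [S], [L] is 0 and [U] is [+oo],
   but the push-forward charges only [S], so their integrals coincide and enclose that of [F]. *)
pose L z := g z * (\1_S z)%:E.
pose U z := g z + +oo * (\1_(~` S) z)%:E.
have mind (B : set T2) : measurable B -> measurable_fun setT (fun z => (\1_B z : R)%:E).
  by move=> mB; apply/measurable_EFinP; exact: measurable_indic.
have g0 z : 0 <= g z by exact: F0.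
have L0 z : 0 <= L z by rewrite mule_ge0 ?lee_fin.
have U0 z : 0 <= U z by rewrite adde_ge0// mule_ge0 ?lee_fin.
have LE : \int[pushforward m Psi]_z L z = \int[m]_x F (Psi x).
  apply: key => // [|z Sz]; last by rewrite /L indicE mem_set// mule1.
  by apply: emeasurable_funM => //; exact: mind.
have UE : \int[pushforward m Psi]_z U z = \int[m]_x F (Psi x).
  apply: key => // [|z Sz]; last first.
    by rewrite /U indicE memNset ?mule0 ?adde0//; exact.
  apply: emeasurable_funD => //; apply: emeasurable_funM => //.
  by apply: mind; exact: measurableC.
apply/eqP; rewrite eq_le; apply/andP; split.
  rewrite -UE; apply: ge0_le_integral_lower => // z _.
  rewrite /U indicE; have [Sz|nSz] := pselect (S z).
    by rewrite memNset ?mule0 ?adde0 /g; [rewrite [Psi _]Sz|exact].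
  by rewrite mem_set// mule1 addey// ?leey// -ltNye; apply: lt_le_trans (F0 _).
rewrite -LE; apply: ge0_le_integral_lower => // z _.
rewrite /L indicE; have [Sz|nSz] := pselect (S z).
  by rewrite mem_set// mule1 /g [Psi _]Sz.
by rewrite memNset// mule0.
Qed.

(** The density [rho^2] is the total mass. When the mass is 0 the normalization falls back on the
    Dirac mass at [x0], and [rho = 0] makes the identity hold. *)
Lemma normalization d (T : measurableType d) (m : {finite_measure set T -> \bar R}) (x0 : T) :
  exists (nu : probability T R) (rho : {nonneg R}), forall f : T -> \bar R,
    measurable_fun setT f -> (forall x, 0 <= f x) ->
    \int[m]_x f x = \int[nu]_x ((rho%:num ^+ 2)%:E * f x).
Proof.
have fm : m setT \is a fin_num by exact: fin_num_measure.
pose M := fine (m setT).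
have M0 : (0 <= M)%R by exact: fine_ge0.
pose nu := mnormalize m (dirac x0 : probability T R).
pose rho : {nonneg R} := NngNum (sqrtr_ge0 M).
exists nu, rho => f mf f0.
have rE : (rho%:num ^+ 2 = M)%R by exact: sqr_sqrtr.
rewrite ge0_integralZl_EFin ?exprn_ge0//.
rewrite rE -[M in RHS]/((NngNum M0)%:num) -ge0_integral_mscale//.
apply: eq_measure_integral => B mB _.
transitivity (M%:E * nu B); last by [].
have [m0|m0] := eqVneq (m setT) 0.
  have mB0 : m B = 0 by apply/eqP; rewrite eq_le measure_ge0 andbT -m0 le_measure ?inE.
  have -> : M = 0%R by rewrite /M m0.
  by rewrite mul0e; exact: mB0.
rewrite /nu /mnormalize /= (negbTE m0) /=.
have -> : (m setT == +oo) = false by move: fm; rewrite fin_numE => /andP[_ /negbTE].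
have MM : M != 0%R by rewrite fine_eq0.
by rewrite muleC -muleA -EFinM mulVf// mule1.
Qed.

End ImageIntegral.

Section OmegaMeasurability.
Context {R : realType} {d : nat}.
Notation E := 'rV[R]_d.

Lemma path_eval_clamp (z : Omega R d) t : path_eval t z = path_eval (clamp01 t) z.
Proof. by have := svalP z; rewrite inE => -[h _]; exact: h. Qed.

Lemma path_lift (z : Omega R d) : exists (x : R -> E) (r : R -> {nonneg R}),
  [/\ continuous (x \o clamp01), continuous (fun t => (r (clamp01 t))%:num) &
      forall t, path_eval t z = cone_mk (x (clamp01 t)) (r (clamp01 t))].
Proof.
have := svalP z; rewrite inE => -[hc [x [r [[cx _] [cr _] zE]]]].
exists x, r; split=> [||t].
- exact: (continuous_comp_within cx (@continuous_clamp01 R) (@clamp01_in R)).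
- exact: (continuous_comp_within cr (@continuous_clamp01 R) (@clamp01_in R)).
- by rewrite path_eval_clamp; apply: zE; exact: clamp01_in.
Qed.

Lemma path_r_continuous (z : Omega R d) : continuous (fun t => cone_r (path_eval t z)).
Proof.
have [x [r [cx cr zE]]] := path_lift z.
rewrite (_ : (fun t => _) = fun t => (r (clamp01 t))%:num)//.
by apply/funext => t; rewrite zE cone_mk_r.
Qed.

Lemma path_moment_continuous (z : Omega R d) i :
  continuous (fun t => cone_moment i (path_eval t z)).
Proof.
have [x [r [cx cr zE]]] := path_lift z.
rewrite (_ : (fun t => _) = fun t => (r (clamp01 t))%:num * (x \o clamp01) t 0 i).
  by move=> t; have := continuousM (cr t) (@continuous_coord _ _ _ _ (x \o clamp01) t 0 i (cx t)).
by apply/funext => t; rewrite zE cone_mk_moment.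
Qed.

Lemma continuous_eq_rat (f g : R -> R) : continuous f -> continuous g ->
  (forall q : rat, f (ratr q) = g (ratr q)) -> f = g.
Proof.
move=> cf cg fg; apply/funext => t; apply/eqP/negPn/negP => nfg.
have ch : continuous (fun t => f t - g t) by move=> u; have := continuousB (cf u) (cg u).
have oh : open [set t | f t - g t != 0].
  by apply: (open_comp _ (@open_neq R 0)) => u _; exact: ch.
have [|u [/= hu [q _ qu]]] := dense_rat _ oh; first by exists t; rewrite /= subr_eq0.
by move: hu; rewrite -qu fg subrr eqxx.
Qed.

(** The functions [cone_r] and [cone_moment i] are continuous along every path, including through
    the vertex, and determine the point; so their values at rational times determine the path. *)
Lemma omega_eq (z z' : Omega R d) :
  (forall q : rat, cone_r (path_eval (ratr q) z) = cone_r (path_eval (ratr q) z')) ->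
  (forall i (q : rat), cone_moment i (path_eval (ratr q) z) = cone_moment i (path_eval (ratr q) z')) ->
  z = z'.
Proof.
move=> hr hm; apply: val_inj; apply/funext => t; apply: cone_eq.
  exact: (f_equal (@^~ t) (continuous_eq_rat (@path_r_continuous z) (@path_r_continuous z') hr)).
move=> i.
exact: (f_equal (@^~ t) (continuous_eq_rat (@path_moment_continuous z i) (@path_moment_continuous z' i) (hm i))).
Qed.

Lemma measurable_path_eval (t : R) : t \in `[0, 1] ->
  measurable_fun setT (path_eval t : mOmega R d -> borel (cone R d)).
Proof.
by move=> t01 _ B mB; rewrite setTI; apply: sub_gen_smallest; exists t, B.
Qed.

Lemma measurable_path_coord (f : cone R d -> R) t : continuous f ->
  measurable_fun setT (fun z : mOmega R d => f (path_eval t z)).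
Proof.
move=> cf; rewrite (_ : (fun z => _) = f \o path_eval (clamp01 t)).
  exact: (measurableT_comp (continuous_borel_R cf) (measurable_path_eval (clamp01_in t))).
by apply/funext => z; rewrite /= path_eval_clamp.
Qed.

(** By [omega_eq], equality of two paths amounts to countably many equalities between measurable
    real functions, so it is an event of the cylinder sigma-algebra. *)
Lemma measurable_fixed_paths (Psi : mOmega R d -> mOmega R d) :
  measurable_fun setT Psi -> measurable [set z | Psi z = z].
Proof.
move=> mPsi.
have mq (f : cone R d -> R) t : continuous f ->
    measurable [set z : mOmega R d | f (path_eval t (Psi z)) = f (path_eval t z)].
  move=> cf; have m1 := measurable_path_coord t cf.
  have m2 := measurableT_comp m1 mPsi.
  have m3 := measurable_fun_eqr m2 m1.
  have := m3 measurableT [set true] I; rewrite setTI.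
  rewrite (_ : _ @^-1` _ = [set z | f (path_eval t (Psi z)) = f (path_eval t z)])//.
  by apply/seteqP; split=> z /= /eqP.
pose C (q : rat) : set (mOmega R d) :=
  [set z | cone_r (path_eval (ratr q) (Psi z)) = cone_r (path_eval (ratr q) z)] `&`
  \big[setI/setT]_(i < d)
    [set z | cone_moment i (path_eval (ratr q) (Psi z)) = cone_moment i (path_eval (ratr q) z)].
have mC q : measurable (C q).
  apply: measurableI; first exact: mq _ _ (@cone_r_continuous R d).
  by apply: bigsetI_measurable => i _; exact: mq _ _ (@cone_moment_continuous R d i).
rewrite (_ : [set z | _] = \bigcap_n (if unpickle n is Some q then C q else setT)).
  by apply: bigcapT_measurable => n; case: (unpickle n).
apply/seteqP; split=> z /=.
  move=> zz n _; case: (unpickle n) => [q|//]; split; first by rewrite /= zz.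
  by elim/big_ind: _ => [|A B ? ?|i _] //=; rewrite zz.
move=> h; have hC q : C q z by have := h (pickle q) I; rewrite pickleK.
apply: omega_eq => [q|i q]; first by have [] := hC q.
by have [_] := hC q; rewrite (bigD1 i)//= => -[].
Qed.

End OmegaMeasurability.

Lemma pushforward_probability d1 d2 (T1 : measurableType d1) (T2 : measurableType d2)
    (R : realType) (nu : probability T1 R) (f : T1 -> T2) : measurable_fun setT f ->
  exists P : probability T2 R, (P : set T2 -> \bar R) = pushforward nu f.
Proof.
move=> mf; pose F : {mfun T1 >-> T2} := HB.pack f (isMeasurableFun.Build _ _ _ _ f mf).
by exists (distribution nu F : probability T2 R).
Qed.

(** The accelerations are specified only at interior times, and the endpoints are negligible.
    Measurability of [f] on the open interval is inherited from [g]. *)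
Lemma eq_integral_interior (R : realType) (f g : R -> \bar R) :
  measurable_fun setT g -> (forall t : R, t \in `]0, 1[ -> f t = g t) ->
  (\int[lebR R]_(t in `[0%R, 1%R]) f t = \int[lebR R]_(t in `[0%R, 1%R]) g t)%E.
Proof.
move=> mg fg.
have mg' : measurable_fun (`]0, 1[%classic : set R) g by exact: measurable_funTS.
have mf' : measurable_fun (`]0, 1[%classic : set R) f.
  by apply: (eq_measurable_fun g) => // t; rewrite inE => t01; rewrite fg.
rewrite (integral_itv_bndoo true false mf') (integral_itv_bndoo true false mg').
by apply: eq_integral => t; rewrite inE => t01; rewrite fg.
Qed.

Section Tonelli01.
Context d (T : measurableType d) (R : realType).
Variables (m : {finite_measure set T -> \bar R}) (G : measurableTypeR R * T -> R).
Hypothesis G_ge0 : forall p, 0 <= G p.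
Hypothesis mG : measurable_fun setT G.

(** The indicator turns integrals over [[0, 1]] into integrals over the line, where Tonelli's
    theorem applies. *)
Let H (p : measurableTypeR R * T) : \bar R := ((\1_(`[0, 1]%classic : set R) p.1 * G p)%:E).

Let mH : measurable_fun setT H.
Proof.
apply/measurable_EFinP; apply: measurable_funM => //.
have m1 : measurable_fun setT (\1_(`[0, 1]%classic : set R) : measurableTypeR R -> R).
  by apply: measurable_indic; exact: measurable_itv.
exact: (measurableT_comp m1 measurable_fst).
Qed.

Let H_ge0 p : (0 <= H p)%E.
Proof. by rewrite lee_fin mulr_ge0. Qed.

Let int01 (g : R -> R) : (\int[lebR R]_(t in `[0%R, 1%R]) (g t)%:E =
  \int[lebR R]_t ((\1_(`[0, 1]%classic : set R) t * g t)%:E))%E.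
Proof.
rewrite integral_mkcond epatch_indic; apply: eq_integral => t _.
by rewrite /= -EFinM mulrC.
Qed.

Lemma measurable_integral01 :
  measurable_fun setT (fun x => \int[lebR R]_(t in `[0%R, 1%R]) (G (t, x))%:E)%E.
Proof.
rewrite (_ : (fun x => _) = (fun x => \int[lebR R]_t H (t, x))%E).
  exact: (@measurable_fun_fubini_tonelli_G _ _ (measurableTypeR R) T R (lebR R) H).
by apply/funext => x; rewrite int01.
Qed.

Lemma measurable_integral_section : measurable_fun setT (fun t => \int[m]_x (G (t, x))%:E)%E.
Proof.
apply: (@measurable_fun_fubini_tonelli_F _ _ _ _ _ m (EFin \o G)) => //.
exact/measurable_EFinP.
Qed.

Lemma tonelli01 :
  (\int[lebR R]_(t in `[0%R, 1%R]) \int[m]_x (G (t, x))%:E =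
   \int[m]_x \int[lebR R]_(t in `[0%R, 1%R]) (G (t, x))%:E)%E.
Proof.
transitivity (\int[lebR R]_t \int[m]_x H (t, x))%E; last first.
  apply: etrans (@fubini_tonelli _ _ (measurableTypeR R) T R (lebR R) m H mH H_ge0) _.
  by apply: eq_integral => x _; rewrite int01.
rewrite integral_mkcond epatch_indic; apply: eq_integral => t _ /=.
under [RHS]eq_integral => x _ do rewrite /H /= EFinM.
rewrite ge0_integralZl_EFin//.
- by rewrite muleC.
- by move=> x _; rewrite lee_fin.
- by apply/measurable_EFinP; exact: (measurableT_comp mG (measurable_pair1 t)).
Qed.

End Tonelli01.

(** * Equality of the costs *)

Section FlowLaw.
Context {R : realType} {d : nat}.
Notation E := 'rV[R]_d.
Variables (mu : R -> {finite_measure set (borel E) -> \bar R}).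
Variables (v : R -> E -> E) (alpha : R -> E -> R).
Variables (Dv : R * E -> R * E -> E) (Da : R * E -> R * E -> R).
Hypothesis v_C1 : slab_C1 (fun p => v p.1 p.2) (clamped v) Dv.
Hypothesis a_C1 : slab_C1 (fun p => alpha p.1 p.2) (clamped alpha) Da.
Hypothesis v_grad : forall (t : R) x, t \in `[0, 1] -> v t x = grad (alpha t) x.
Variables (X : R -> E -> E) (A : R -> E -> R).
Hypothesis X0 : forall x, X 0 x = x.
Hypothesis dX : forall (t : R) x, t \in `[0, 1] -> is_derive t 1 (X^~ x) (clamped v (t, X t x)).
Hypothesis dA : forall (t : R) x, t \in `[0, 1] -> is_derive t 1 (A^~ x) (clamped alpha (t, X t x)).
Hypothesis cX : forall t : R, t \in `[0, 1] -> continuous (X t).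
Hypothesis cA : forall t : R, t \in `[0, 1] -> continuous (A t).
Hypothesis mu_flow : forall (t : R) (F : borel E -> \bar R), t \in `[0, 1] ->
  measurable_fun setT F -> (forall x, 0 <= F x)%E ->
  (\int[mu t]_x F x = \int[mu 0]_x ((expR (4 * A t x))%:E * F (X t x)))%E.
Variables (nu : probability (borel E) R) (rho : {nonneg R}).
Hypothesis mu_nu : forall f : borel E -> \bar R,
  measurable_fun setT f -> (forall x, 0 <= f x)%E ->
  (\int[mu 0]_x f x = \int[nu]_x ((rho%:num ^+ 2)%:E * f x))%E.
Variables (lam0 : probability (borel (cone R d)) R) (P : probability (mOmega R d) R).
Hypothesis lam0E : (lam0 : set _ -> \bar R) =
  pushforward nu (fun x : borel E => cone_mk x rho : borel (cone R d)).
Let Phi := flow_lift v_C1 a_C1 dX dA.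
Hypothesis PE : (P : set _ -> \bar R) = pushforward lam0 Phi.

Let mPhi : measurable_fun setT Phi.
Proof. exact: measurable_flow_lift. Qed.

Let mcone : measurable_fun setT (fun x : borel E => cone_mk x rho : borel (cone R d)).
Proof. exact: (continuous_borel (@cone_mk_continuous R d rho)). Qed.

Let Psi (x : borel E) : mOmega R d := Phi (cone_mk x rho).

Let mPsi : measurable_fun setT Psi.
Proof. exact: (measurableT_comp mPhi mcone). Qed.

Lemma law_pushforward : (P : set _ -> \bar R) = pushforward nu Psi.
Proof. by rewrite PE lam0E. Qed.

Lemma law_integral (F : mOmega R d -> \bar R) :
  (\int[P]_z F z = \int[pushforward nu Psi]_z F z)%E.
Proof. exact: (f_equal (fun m => integral m setT F) law_pushforward). Qed.

Let h (f : borel E -> \bar R) (c : borel (cone R d)) := ((cone_r c ^+ 2)%:E * f (cone_x c))%E.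

Let mh f : measurable_fun setT f -> measurable_fun setT (h f).
Proof.
move=> mf; apply: emeasurable_funM.
  apply/measurable_EFinP; apply: measurable_funX.
  exact: (continuous_borel_R (@cone_r_continuous R d)).
exact: (measurableT_comp mf (@measurable_cone_x R d)).
Qed.

Let h_ge0 f c : (forall x, 0 <= f x)%E -> (0 <= h f c)%E.
Proof. by move=> f0; rewrite mule_ge0// lee_fin sqr_ge0. Qed.

Let h_mk f x r : h f (cone_mk x r) = ((r%:num ^+ 2)%:E * f x)%E.
Proof.
rewrite /h cone_mk_r; have [->|r0] := eqVneq r%:num 0.
  by rewrite expr0n !mul0e.
by rewrite cone_mk_x.
Qed.

Lemma lam0_lift : lift_of lam0 (mu 0).
Proof.
move=> f mf f0; rewrite -/(h f) mu_nu//.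
apply: etrans _ (esym (f_equal (fun m => integral m setT (h f)) lam0E)).
rewrite (ge0_integral_pushforward mcone _ measurableT (mh mf)); last by move=> c _; exact: h_ge0.
by rewrite preimage_setT; apply: eq_integral => x _; rewrite /= h_mk.
Qed.

(** Both sides reduce to integrals against [nu], and the weights match because
    [(exp (2 A) rho)^2 = exp (4 A) rho^2]. *)
Lemma law_lift (t : R) : t \in `[0, 1] ->
  lift_of (pushforward P (path_eval t : mOmega R d -> borel (cone R d))) (mu t).
Proof.
move=> t01 f mf f0; rewrite -/(h f).
have mfX : measurable_fun setT (fun x : borel E => f (X t x)).
  exact: (measurableT_comp mf (continuous_borel (cX t01))).
have mE : measurable_fun setT (fun x : borel E => (expR (4 * A t x))%:E).
  apply/measurable_EFinP; apply: continuous_borel_R => x.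
  have c1 := continuousM (@cst_continuous _ _ (4 : R) x) (cA t01 (x := x)).
  exact: (@continuous_compf _ _ _ (@expR R) (fun x => 4 * A t x) x (@continuous_expR R _) c1).
rewrite mu_flow// mu_nu//; first last.
- by move=> x; rewrite mule_ge0// lee_fin expR_ge0.
- exact: emeasurable_funM.
rewrite (ge0_integral_pushforward (measurable_path_eval t01) P measurableT (mh mf)); last first.
  by move=> c _; exact: h_ge0.
rewrite preimage_setT; apply: etrans _ (esym (law_integral _)).
rewrite (ge0_integral_pushforward mPsi nu measurableT); first last.
- by move=> z _; exact: h_ge0.
- exact: (measurableT_comp (mh mf) (measurable_path_eval t01)).
rewrite preimage_setT; apply: eq_integral => x _.
transitivity (h f (path_eval t (Psi x))); last by [].
rewrite /Psi /Phi path_eval_flow_lift// map_cone_mk h_mk.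
rewrite muleA -EFinM; congr (_%:E * _)%E.
have -> : 4 * A t x = 2 * A t x + 2 * A t x by ring.
by rewrite expRD /=; ring.
Qed.

Definition transported_density (t : R) x : R :=
  expR (4 * A t x) * density_ext v alpha Dv Da (t, X t x).

Lemma transported_density_ge0 (t : R) x : 0 <= transported_density t x.
Proof.
apply: mulr_ge0; first exact: expR_ge0.
apply: addr_ge0; last by apply: mulr_ge0 => //; exact: sqr_ge0.
by apply: sumr_ge0 => i _; rewrite -expr2 sqr_ge0.
Qed.

Let G (p : measurableTypeR R * borel E) := transported_density (clamp01 p.1) p.2.

Let G_ge0 p : 0 <= G p.
Proof. exact: transported_density_ge0. Qed.

Let mG : measurable_fun setT G.
Proof.
have cD := density_ext_continuous v_C1 a_C1.
apply: (@measurable_sections_continuous R d transported_density) => [t t01 x|x t].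
  have c1 := continuousM (@cst_continuous _ _ (4 : R) x) (cA t01 (x := x)).
  have c2 := @continuous_compf _ _ _ (@expR R) (fun x => 4 * A t x) x (@continuous_expR R _) c1.
  have c3 : {for x, continuous (fun x => (t, X t x))}.
    by apply: (@continuous_pair _ _ _ (cst t) (X t) x); [exact: cst_continuous|exact: cX].
  have c4 := @continuous_compf _ _ _ (density_ext v alpha Dv Da) (fun x => (t, X t x)) x (@cD _) c3.
  by have := continuousM c2 c4.
have c1 := continuousM (@cst_continuous _ _ (4 : R) t) (clamped_weight_continuous dA (x := x) (x0 := t)).
have c2 := @continuous_compf _ _ _ (@expR R) (fun t => 4 * A (clamp01 t) x) t (@continuous_expR R _) c1.
have c3 := clamped_path_continuous dX (x := x) (x0 := t).
have c4 := @continuous_compf _ _ _ (density_ext v alpha Dv Da) (fun s => (clamp01 s, X (clamp01 s) x)) t (@cD _) c3.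
by have := continuousM c2 c4.
Qed.

Lemma GE (t : R) x : t \in `]0, 1[ ->
  G (t, x) = expR (4 * A t x) * accel_density v alpha t (X t x).
Proof.
move=> t01; rewrite /G /= /transported_density clamp01_id; last exact: subset_itv_oo_cc.
by rewrite (density_extE v_C1 a_C1 v_grad).
Qed.

Lemma E_cost_flow : E_cost mu v alpha =
  (\int[mu 0]_x \int[lebR R]_(t in `[0%R, 1%R]) (G (t, x))%:E)%E.
Proof.
apply: etrans _ (tonelli01 (mu 0) G_ge0 mG).
apply: (@eq_integral_interior R _ (fun t => \int[mu 0]_x (G (t, x))%:E)%E).
  exact: (measurable_integral_section (mu 0) G_ge0 mG).
move=> t t01; have t01' := subset_itv_oo_cc t01; rewrite /WFR_sqnorm.
have cD : continuous (fun x => density_ext v alpha Dv Da (t, x)).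
  move=> x; apply: (@continuous_compf _ _ _ (density_ext v alpha Dv Da) (fun x => (t, x)) x).
    exact: (density_ext_continuous v_C1 a_C1).
  exact: continuous_pairl.
transitivity (\int[mu t]_x (density_ext v alpha Dv Da (t, x))%:E)%E.
  by apply: eq_integral => x _; rewrite (density_extE v_C1 a_C1 v_grad).
rewrite mu_flow//.
- by apply: eq_integral => x _; rewrite -EFinM GE// (density_extE v_C1 a_C1 v_grad).
- by apply/measurable_EFinP; exact: continuous_borel_R.
- move=> x; rewrite lee_fin; apply: addr_ge0; last by apply: mulr_ge0 => //; exact: sqr_ge0.
  by apply: sumr_ge0 => i _; rewrite -expr2 sqr_ge0.
Qed.

Let path_cost (z : Omega R d) : \bar R :=
  (\int[lebR R]_(t in `[0%R, 1%R]) (path_accel_sqnorm z t)%:E)%E.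

Lemma path_cost_flow x :
  path_cost (Psi x) = ((rho%:num ^+ 2)%:E * \int[lebR R]_(t in `[0%R, 1%R]) (G (t, x))%:E)%E.
Proof.
have mGx : measurable_fun setT (fun t : R => (G (t, x))%:E).
  by apply/measurable_EFinP; exact: (measurableT_comp mG (measurable_pair2 x)).
rewrite -ge0_integralZl_EFin ?sqr_ge0//; first last.
- exact: measurable_funTS.
- by move=> t _; rewrite lee_fin; exact: G_ge0.
apply: eq_integral_interior.
  exact: emeasurable_funM.
move=> t t01; rewrite -EFinM (flow_lift_accel v_C1 a_C1 v_grad dX dA)// cone_mk_r GE//.
have [->|r0] := eqVneq rho%:num 0; first by rewrite expr0n !mul0r.
by rewrite cone_mk_x.
Qed.

Lemma P_cost_flow : P_cost P =
  (\int[mu 0]_x \int[lebR R]_(t in `[0%R, 1%R]) (G (t, x))%:E)%E.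
Proof.
have mI := measurable_integral01 G_ge0 mG.
have I0 x : (0 <= \int[lebR R]_(t in `[0%R, 1%R]) (G (t, x))%:E)%E.
  by apply: integral_ge0 => t _; rewrite lee_fin; exact: G_ge0.
rewrite mu_nu//; apply: etrans (law_integral _) _.
(* If [rho = 0], every path is constant at the vertex: the starting position is lost, but [Psi] is
   constant, so the retraction identity still holds. *)
have Rho0 : rho%:num = 0 -> forall x y, Psi x = Psi y.
  by move=> r0 x y; rewrite /Psi; congr (Phi _); exact: cone_mk0.
pose pi (z : mOmega R d) : borel E := cone_x (path_eval 0 z).
have in01 : (0 : R) \in `[0, 1] by rewrite in_itv /= lexx ler01.
have mpi : measurable_fun setT pi.
  exact: (measurableT_comp (@measurable_cone_x R d) (measurable_path_eval in01)).
rewrite (@ge0_integral_pushforward_retract _ _ _ _ _ nu Psi pi path_cost)//.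
- by apply: eq_integral => x _; rewrite path_cost_flow.
- exact: (measurable_fixed_paths (measurableT_comp mPsi mpi)).
- move=> x; have [r0|r0] := eqVneq rho%:num 0; first exact: Rho0.
  congr Psi; rewrite /pi path_eval_flow_lift// map_cone_mk X0.
  by apply: cone_mk_x; rewrite mulf_neq0// gt_eqF ?expR_gt0.
- move=> z; apply: integral_ge0 => t _; rewrite lee_fin /path_accel_sqnorm.
  case: ifP => // _; apply: addr_ge0; last by rewrite -expr2 sqr_ge0.
  by apply: mulr_ge0; [exact: sqr_ge0|apply: sumr_ge0 => i _; rewrite -expr2 sqr_ge0].
- rewrite (_ : _ \o _ = fun x => ((rho%:num ^+ 2)%:E *
    \int[lebR R]_(t in `[0%R, 1%R]) (G (t, x))%:E)%E).
    exact: emeasurable_funM.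
  by apply/funext => x; exact: path_cost_flow.
Qed.

End FlowLaw.

Theorem theorem6 (R : realType) (d : nat)
    (mu : R -> {finite_measure set (borel 'rV[R]_d) -> \bar R})
    (v : R -> 'rV[R]_d -> 'rV[R]_d) (alpha : R -> 'rV[R]_d -> R)
    (mu_curve : WFR_curve mu v alpha)
    (smooth : sufficiently_smooth v alpha) :
  exists P : probability (mOmega R d) R,
    [/\ forall t : R, t \in `[0, 1] ->
          lift_of (pushforward P (path_eval t : mOmega R d -> borel (cone R d)))
                  (mu t),
        E_cost mu v alpha = P_cost P &
        exists (X : R -> 'rV[R]_d -> 'rV[R]_d)
               (Rad : R -> 'rV[R]_d -> {posnum R}),
          flow_maps v alpha X Rad /\ induced_by_flow P (mu 0) X Rad].
Proof.
have [mu_narrow mu_eq v_grad] := mu_curve.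
have [Dv [Da [M [B [X [A [[v_C1 a_C1 M0 vM] [X0 dX cX] [A0 dA AB cA]]]]]]]] := smooth_flow smooth.
have rep := ge0_integral_representation mu_narrow mu_eq v_C1 a_C1 vM X0 A0 dX dA AB cX cA.
have [nu [rho mu_nu]] := normalization (mu 0) (0 : borel 'rV[R]_d).
have [lam0 lam0E] := pushforward_probability nu (continuous_borel (@cone_mk_continuous R d rho)).
have mPhi := measurable_flow_lift v_C1 a_C1 dX dA cX cA.
have [P PE] := pushforward_probability lam0 mPhi.
exists P; split.
- by move=> t t01; exact: (law_lift cX cA rep mu_nu lam0E PE t01).
- rewrite (E_cost_flow v_C1 a_C1 v_grad dX dA cX cA rep).
  by rewrite (P_cost_flow v_grad X0 cX cA mu_nu lam0E PE).
exists X, (flow_radius A); split; last first.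
  exists lam0, (flow_lift v_C1 a_C1 dX dA); split=> //.
  + exact: (lam0_lift mu_nu lam0E).
  + by move=> x r t t01; rewrite path_eval_flow_lift// map_cone_mk.
  + by move=> B' _; rewrite PE.
have in_oo (t : R) : t \in `]0, 1[ -> t \in `[0, 1] by exact: subset_itv_oo_cc.
have dR (t : R) x : t \in `[0, 1] -> is_derive t 1 (fun s => (flow_radius A s x)%:num)
    (2 * clamped alpha (t, X t x) * (flow_radius A t x)%:num).
  move=> t01; have := is_derive_expRA dA 1 x t01; rewrite mulr1.
  by under eq_fun do rewrite mulr1.
move=> x; split; split.
- exact: X0.
- by apply: within_continuous_derive => t t01; exact: dX.
- by move=> t t01; rewrite -(clampedE v _ t01); exact: (dX t x (in_oo t t01)).
- by rewrite flow_radiusE A0 mulr0 expR0.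
- by apply: within_continuous_derive => t t01; exact: dR.
- by move=> t t01; rewrite -(clampedE alpha _ t01); exact: (dR t x (in_oo t t01)).
Qed.
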